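(* Let $V(x)=\|x\|^2$ on $\mathbb{Z}^d$. Then $\alpha^*(V)\le\pi\big((1+\rho_0)^{1/d}-1\big)^{-2}\approx\pi(1.44504^{1/d}-1)^{-2}$, where $\rho_0\approx0.44504$ is the unique solution $r\in[0,1]$ of $\frac{r}{(1-r)^2}-r=1$. Moreover, for every $\alpha>\alpha^*(V)$ there exists a family of random permutations $(\zeta_\Lambda,\ \Lambda\subseteq\mathbb{Z}^d)$ on a common probability space with $\zeta_\Lambda\in S_\Lambda$, $\zeta_\Lambda\sim G_\Lambda$ for finite $\Lambda$, $\zeta_\Lambda(x)\to\zeta_{\mathbb{Z}^d}(x)$ a.s. for all $x$, and whose limit law $\mu$ (the law of $\zeta_{\mathbb{Z}^d}$) is an ergodic Gibbs measure, such that for each $v\in\mathbb{Z}^d$: (i) for every finite $\Lambda$, $G_\Lambda\tau_v=G_{\Lambda|\tau_v}$; in particular $\tau_v\zeta_\Lambda$ has law $G_{\Lambda|\tau_v}$; (ii) $\lim_{\Lambda\nearrow\mathbb{Z}^d}\tau_v\zeta_\Lambda(x)=\tau_v\zeta_{\mathbb{Z}^d}(x)$ almost surely for all $x\in\mathbb{Z}^d$, and consequently $G_{\Lambda|\tau_v}\to\mu\tau_v$ weakly; (iii) $\mu\tau_v$ is an ergodic (with respect to spatial translations) Gibbs measure at temperature $\alpha$ with mean jump $v$.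
   Context: $S$ is the set of bijections of $\mathbb{Z}^d$ (product topology); $(\sigma\sigma')(x)=\sigma(\sigma'(x))$; $\tau_v(x)=x+v$; for a measure $\mu$ and $\tau\in S$, $\mu\tau$ is the law of $\tau\sigma$ with $\sigma\sim\mu$. For $\xi\in S$ and finite $\Lambda$, $S_{\Lambda|\xi}=\{\sigma:\sigma(x)=\xi(x),x\notin\Lambda\}$, $S_\Lambda=S_{\Lambda|\mathrm I}$ ($S_{\mathbb{Z}^d}=S$), $H_\Lambda(\sigma)=\sum_{x\in\Lambda}V(\sigma(x)-x)$, $G_{\Lambda|\xi}(\sigma)=Z^{-1}_{\Lambda|\xi}e^{-\alpha H_\Lambda(\sigma)}$ on $S_{\Lambda|\xi}$, $G_\Lambda=G_{\Lambda|\mathrm I}$. Gibbs measure at temperature $\alpha$: for all finite $\Lambda$ and $\mu$-a.e. $\xi$, $\mu(\cdot\mid\sigma=\xi\text{ off }\Lambda)=G_{\Lambda|\xi}$. Finite cycles $\gamma$ (length $|\gamma|\ge2$, support $\{\gamma\}$) form the set $\Gamma$; $w(\gamma)=\exp\{-\alpha\sum_{x\in\{\gamma\}}V(\gamma(x)-x)\}$, $\beta(V,\alpha)=\sum_{\gamma\in\Gamma,\vec0\in\{\gamma\}}|\gamma|w(\gamma)$, $\alpha^*(V)=\inf\{\alpha:\beta(V,\alpha)<1\}$. *)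

(* Defs.v *)
From HB Require Import structures.
From mathcomp Require Import all_boot all_order all_algebra.
From mathcomp Require Import all_classical all_reals all_analysis.
Import numFieldNormedType.Exports.
Import Order.TTheory GRing.Theory Num.Theory.

Set Implicit Arguments.
Unset Strict Implicit.
Unset Printing Implicit Defensive.

Local Open Scope classical_set_scope.
Local Open Scope ring_scope.

Definition Zd (d : nat) := 'rV[int]_d.
Definition Perm (d : nat) := Zd d -> Zd d.

Section Defs.
Variables (R : realType) (d : nat).
Local Notation Zd := (Zd d).
Local Notation Perm := (Perm d).

Definition sqnorm (x : Zd) : R := \sum_(i < d) ((x ord0 i)%:~R) ^+ 2.

Definition tau (v : Zd) : Perm := fun x => x + v.

Definition shift (u : Zd) (s : Perm) : Perm := fun x => s (x - u) + u.

(** S_{Lambda|xi}; S_Lambda = SL Lambda id; SL setT id = S (all bijections) *)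
Definition SL (L : set Zd) (xi : Perm) : set Perm :=
  [set s | bijective s /\ forall x, ~ L x -> s x = xi x].

Definition Ham (V : Zd -> R) (L : set Zd) (s : Perm) : R :=
  \sum_(x \in L) V (s x - x).

Definition gweight (V : Zd -> R) (a : R) (L : set Zd) (s : Perm) : R :=
  expR (- (a * Ham V L s)).

Definition Zpart (V : Zd -> R) (a : R) (L : set Zd) (xi : Perm) : R :=
  \sum_(s \in SL L xi) gweight V a L s.

Definition Gexp (V : Zd -> R) (a : R) (L : set Zd) (xi : Perm)
    (f : Perm -> R) : R :=
  \sum_(s \in SL L xi) (gweight V a L s / Zpart V a L xi) * f s.

Definition Gprob (V : Zd -> R) (a : R) (L : set Zd) (xi : Perm)
    (A : set Perm) : R := Gexp V a L xi (\1_A).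

Definition Gpt (V : Zd -> R) (a : R) (L : set Zd) (xi : Perm) (s : Perm) : R :=
  Gprob V a L xi [set s].

Definition supp (g : Perm) : set Zd := [set x | g x <> x].

Definition cyc_len (g : Perm) : nat := size (finmap.enum_fset (fset_set (supp g))).

Definition is_cycle (g : Perm) : Prop :=
  [/\ bijective g, finite_set (supp g), (2 <= cyc_len g)%N &
      forall x y, supp g x -> supp g y -> exists n, iter n g x = y].

Definition cyc_weight (V : Zd -> R) (a : R) (g : Perm) : R :=
  expR (- (a * \sum_(x \in supp g) V (g x - x))).

Definition beta (V : Zd -> R) (a : R) : \bar R :=
  \esum_(g in [set g | is_cycle g /\ supp g 0])
     ((cyc_len g)%:R * cyc_weight V a g)%:E.

Definition alpha_star (V : Zd -> R) : \bar R :=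
  ereal_inf [set a%:E | a in [set a : R | (beta V a < 1%:E)%E]].

(** cylinder events {sigma | sigma x = y}, x in A, and the sigma-algebra they
    generate; cyl_sigma setT is the product sigma-algebra *)
Definition cylinders (A : set Zd) : set (set Perm) :=
  [set C | exists x y, A x /\ C = [set s : Perm | s x = y]].
Definition cyl_sigma (A : set Zd) : set (set Perm) := <<s cylinders A >>.

(** product-topology continuity on S, written with the neighbourhood basis
    (agreement on finite sets; Z^d is discrete) *)
Definition cont_on_S (f : Perm -> R) : Prop :=
  forall s, bijective s -> forall e : R, 0 < e ->
    exists F : set Zd, finite_set F /\
      forall s', bijective s' -> (forall x, F x -> s' x = s x) ->
        `|f s' - f s| < e.

Definition exhausting (L : nat -> set Zd) : Prop :=
  [/\ forall n, finite_set (L n), forall n, L n `<=` L n.+1 &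
      \bigcup_n L n = setT].

Section Prob.
Variables (dT : measure_display) (T : measurableType dT) (P : probability T R).

Definition rand_map (X : T -> Perm) : Prop :=
  forall x y, measurable [set w | X w x = y].

(** law of X is a Gibbs measure at temperature a (DLR equations) *)
Definition is_gibbs (V : Zd -> R) (a : R) (X : T -> Perm) : Prop :=
  {ae P, forall w, bijective (X w)} /\
  forall L : set Zd, finite_set L ->
  forall A B, cyl_sigma setT A -> cyl_sigma (~` L) B ->
    P (X @^-1` (A `&` B)) =
    (\int[P]_w (Gprob V a L (X w) A * \1_B (X w))%:E)%E.

Definition ergodic (X : T -> Perm) : Prop :=
  (forall u A, cyl_sigma setT A ->
     P (X @^-1` (shift u @^-1` A)) = P (X @^-1` A)) /\
  (forall A, cyl_sigma setT A -> (forall u, shift u @^-1` A = A) ->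
     P (X @^-1` A) = 0%E \/ P (X @^-1` A) = 1%E).

Definition mean_jump (X : T -> Perm) (v : Zd) : Prop :=
  forall x (i : 'I_d),
    P.-integrable setT (fun w => (((X w x - x) ord0 i)%:~R : R)%:E) /\
    (\int[P]_w (((X w x - x) ord0 i)%:~R : R)%:E = ((v ord0 i)%:~R : R)%:E)%E.

Definition as_conv (Y : set Zd -> T -> Perm) : Prop :=
  forall L, exhausting L ->
    {ae P, forall w, forall x, exists N, forall n, (N <= n)%N ->
       Y (L n) w x = Y setT w x}.

End Prob.
End Defs.

(* Main.v *)
(* When beta(V, alpha) < 1, summing over the cycle through x writes 1/rho_L(x), where rho_L(x) is the probability
   that x is fixed under G_L, as 1 plus a sum over cycles g of w(g) times a product of |g| such ratios in smaller
   volumes. This recursion contracts by the factor beta, so the finite-volume expectations of local functions are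
   insensitive to distant changes of the volume, and local functions with distant supports decorrelate. Hence the
   G_L converge along every exhausting sequence.

   All volumes are coupled by one uniform variable u: a permutation is encoded by the bits [s x = y], and u is
   decoded into bits by splitting [0, 1) in proportion to the probabilities under G_L. These converge, so each bit
   does, except when u is an endpoint; the tail bound for cycles, used for s and for its inverse, shows that the limit
   bits encode a bijection almost surely. DLR equations, invariance under isometries of V and mixing pass to the limit
   law. The reflection at x makes the mean jump 0, and composing with tau_v adds v because sqnorm (x + v) - sqnorm x
   is affine in x, so that the extra energy sums to a constant on each S_L.

   For the bound on alpha*, a cycle through 0 of length n is determined by its n nonzero jumps, so
   beta <= sum_(n >= 2) n q^n with q = sum_(x != 0) exp(- alpha |x|^2) <= (1 + sqrt(pi / alpha))^d - 1, comparing
   the one-dimensional sum with the Gauss integral. *)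
Require Import Defs.
From HB Require Import structures.
From mathcomp Require Import all_boot all_order all_algebra.
From mathcomp Require Import finmap.
From mathcomp Require Import all_classical all_reals all_analysis.
From mathcomp Require Import measurable_realfun lra zify.
Import numFieldNormedType.Exports.
Import Order.TTheory GRing.Theory Num.Theory.
Set Implicit Arguments.
Unset Strict Implicit.
Unset Printing Implicit Defensive.
Local Open Scope classical_set_scope.
Local Open Scope ring_scope.

(** * Finite sums and permutations of Zd *)

(** The recursion leaves the class of boxes: the volumes it produces have holes of arbitrary shape.
    The estimate that is iterated is therefore uniform over all pairs of finite volumes that agree
    near the site, and holes never have to be described. Any limit of laws on bit strings is again
    such a law, by compactness; the danger is a loss of mass, a limit string giving some site no
    image or no preimage. Both lie on the cycle of the site, so the weight of long cycles controls
    both. The exceptional null set is defined from the limit law alone, and thus serves all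
    exhausting sequences at once. The kernels of the DLR equations must be local functions of the
    boundary condition to pass to the limit; this is achieved by reading the boundary permutation
    also inside the volume. The strict inequality [alpha_star V < a] leaves a margin [a' < a] with
    [beta V a' < 1], and this margin makes the jumps integrable. The number rho_0 comes from
    [sum_(n >= 2) n r^n = r / (1 - r)^2 - r]: the bound on beta drops below 1 once q < rho_0, and
    solving [(1 + sqrt(pi / alpha))^d = 1 + rho_0] for alpha gives the stated threshold. *)

Section FsBig.
Variable R : realType.

Lemma ler_fsumr (I : choiceType) (P : set I) (F G : I -> R) : finite_set P ->
  (forall i, P i -> F i <= G i) -> \sum_(i \in P) F i <= \sum_(i \in P) G i.
Proof.
move=> Pf FG; rewrite !fsbig_finite//= [leLHS]big_seq [leRHS]big_seq.
by apply: ler_sum => i; rewrite in_fset_set// inE; exact: FG.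
Qed.

Lemma ler_norm_fsumr (I : choiceType) (P : set I) (F : I -> R) : finite_set P ->
  `|\sum_(i \in P) F i| <= \sum_(i \in P) `|F i|.
Proof. by move=> Pf; rewrite !fsbig_finite//=; exact: ler_norm_sum. Qed.

Lemma fsumrB (I : choiceType) (P : set I) (F G : I -> R) : finite_set P ->
  \sum_(i \in P) F i - \sum_(i \in P) G i = \sum_(i \in P) (F i - G i).
Proof. by move=> Pf; rewrite !fsbig_finite//= sumrB. Qed.

Lemma fsumrD (I : choiceType) (P : set I) (F G : I -> R) : finite_set P ->
  \sum_(i \in P) (F i + G i) = \sum_(i \in P) F i + \sum_(i \in P) G i.
Proof. by move=> Pf; rewrite !fsbig_finite//= big_split. Qed.

Lemma fsumr_subset (I : choiceType) (P Q : set I) (F : I -> R) : finite_set Q ->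
  P `<=` Q -> (forall i, Q i -> 0 <= F i) ->
  \sum_(i \in P) F i <= \sum_(i \in Q) F i.
Proof.
move=> Qf PQ F0; rewrite [leRHS](fsbigID P)//= (setIidr PQ) lerDl.
by apply: fsumr_ge0 => i [/F0].
Qed.

Lemma fsumr_cond (I : choiceType) (P Q : set I) (F : I -> R) : finite_set P ->
  \sum_(i \in P) (if i \in Q then F i else 0) = \sum_(i \in P `&` Q) F i.
Proof.
move=> Pf; rewrite (fsbigID Q)//= [X in _ + X]fsbig1 ?addr0.
  by apply: eq_fsbigr => i; rewrite inE => -[_ Qi]; rewrite mem_set.
by move=> i [_ /= nQ]; rewrite memNset.
Qed.

(** The hypotheses make [h] a bijection from the dependent pairs onto [C]: each [k] in [C] is
    counted in exactly one inner sum. *)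
Lemma fsumr_dep (I J K : choiceType) (A : set I) (B : I -> set J) (C : set K)
    (h : I -> J -> K) (F : K -> R) :
  finite_set A -> finite_set C ->
  (forall i j, A i -> B i j -> C (h i j)) ->
  (forall k, C k -> exists i j, [/\ A i, B i j & h i j = k]) ->
  (forall i j i' j', A i -> B i j -> A i' -> B i' j' -> h i j = h i' j' ->
     i = i' /\ j = j') ->
  \sum_(k \in C) F k = \sum_(i \in A) \sum_(j \in B i) F (h i j).
Proof.
move=> fA fC AB CA inj.
transitivity (\sum_(i \in A) \sum_(k \in C)
    (if k \in (h i @` B i) then F k else 0)); last first.
  apply: eq_fsbigr => i; rewrite inE => Ai.
  rewrite fsumr_cond// -(fsbig_image (B i) (h i)); last first.
    move=> j j'; rewrite !inE => Bj Bj' e.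
    by have [] := inj _ _ _ _ Ai Bj Ai Bj' e.
  apply: eq_fsbigl; apply/seteqP; split=> [k []//|k kB].
  by split=> //; case: kB => j Bj <-; exact: AB.
rewrite exchange_fsbig//; apply: eq_fsbigr => k; rewrite inE => Ck.
have [i [j [Ai Bj e]]] := CA _ Ck.
rewrite (fsbigD1 i)//= ifT; last by rewrite inE; exists j.
rewrite fsbig1 ?addr0// => i' [Ai' ne]; rewrite ifF//; apply/negbTE.
rewrite notin_setE => -[j' Bj' e']; apply: ne.
by have [] := inj _ _ _ _ Ai' Bj' Ai Bj (etrans e' (esym e)).
Qed.

End FsBig.

Section Perms.
Variable d : nat.
Local Notation Zd := (Zd d).
Local Notation Perm := (Perm d).
Implicit Types (s t g : Perm) (L D A : set Zd).

Lemma bij_surj s y : bijective s -> exists x, s x = y.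
Proof. by move=> -[t _ ts]; exists (t y). Qed.

Lemma bijP s : injective s -> (forall y, exists x, s x = y) -> bijective s.
Proof.
move=> si ss; pose t y := projT1 (cid (ss y)).
have st y : s (t y) = y by rewrite /t; case: cid.
by exists t => // x; apply: si (st _).
Qed.

Lemma SL_id L : SL L id id.
Proof. by split => //; exists id. Qed.

Lemma SL_bij L xi s : SL L xi s -> bijective s. Proof. by case. Qed.

Lemma SL_inj L xi s : SL L xi s -> injective s.
Proof. by move=> [/bij_inj]. Qed.

Lemma SL_stable L s x : SL L id s -> L x -> L (s x).
Proof.
move=> Ls Lx; apply: contrapT => nL.
have e := Ls.2 _ nL; have /(SL_inj Ls) sx := e.
by apply: nL; rewrite sx.
Qed.

Lemma SL_stableN L s x : SL L id s -> ~ L x -> ~ L (s x).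
Proof. by move=> Ls Lx; rewrite (Ls.2 _ Lx). Qed.

Lemma SL_stableE L s x : SL L id s -> L (s x) <-> L x.
Proof.
move=> Ls; split=> [Lsx|Lx]; last exact: (SL_stable Ls Lx).
by apply: contrapT => /(SL_stableN Ls).
Qed.

Lemma SL_mono L L' xi : L `<=` L' -> SL L xi `<=` SL L' xi.
Proof. by move=> LL s [sb sL]; split=> // x nx; apply: sL => /LL. Qed.

Lemma SL_comp L s t : SL L id s -> SL L id t -> SL L id (s \o t).
Proof.
move=> Ls Lt; split; first exact: bij_comp Ls.1 Lt.1.
by move=> x nx /=; rewrite (Lt.2 _ nx) (Ls.2 _ nx).
Qed.

Lemma finite_SL_id L : finite_set L -> finite_set (SL L id).
Proof.
move=> Lf; pose r := fset_set L.
pose G (f : {ffun r -> r}) : Perm :=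
  fun x => if insub x is Some i then val (f i) else x.
apply: (@sub_finite_set _ _ (G @` [set: {ffun r -> r}])); last first.
  by apply: finite_image; exact: finite_finset.
move=> s Ls; have sr (i : r) : s (val i) \in r.
  rewrite in_fset_set// inE; apply: (SL_stable Ls).
  by have := valP i; rewrite in_fset_set// inE.
exists [ffun i => FSetSub (sr i)] => //; apply/funext => x; rewrite /G.
case: insubP => [i _ <-|]; first by rewrite ffunE.
by rewrite in_fset_set// notin_setE => /Ls.2.
Qed.

Lemma SL_trans L s xi : SL L xi s -> SL L s = SL L xi.
Proof.
move=> Ls; apply/seteqP; split=> t [tb tL]; split=> // x nx; rewrite tL//.
  by rewrite Ls.2.
by rewrite Ls.2.
Qed.

Lemma SL_sym L s xi : bijective xi -> SL L xi s -> SL L s xi.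
Proof. by move=> xb Ls; split=> // x nx; rewrite Ls.2. Qed.

(** This parametrizes [SL L xi] by a set that does not depend on [xi], so that different boundary
    conditions can be compared term by term. *)
Lemma SL_bij_comp L xi : bijective xi ->
  set_bij (SL L id) (SL L xi) (fun p => xi \o p).
Proof.
move=> xb; split.
- move=> p Lp; split; first exact: bij_comp xb Lp.1.
  by move=> x nx /=; rewrite Lp.2.
- move=> p q _ _ /funeqP e; apply/funext => x.
  by apply: (bij_inj xb); exact: e.
- move=> s Ls; case: (xb) => xi' k1 k2; exists (xi' \o s).
    split; first by apply: bij_comp Ls.1; exists xi.
    by move=> x nx /=; rewrite Ls.2.
  by apply/funext => x /=; rewrite k2.
Qed.

Lemma finite_SL L xi : finite_set L -> finite_set (SL L xi).
Proof.
move=> Lf; have [[s Ls]|/forallNP nL] := pselect (exists s, SL L xi s); last first.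
  by rewrite (_ : SL L xi = set0)// -subset0 => s /nL.
rewrite -(SL_trans Ls); have [_ _ sur] := SL_bij_comp L (SL_bij Ls).
exact: sub_finite_set sur (finite_image _ (finite_SL_id Lf)).
Qed.

End Perms.

(** * Cycle decomposition of partition functions *)

Section Orbits.
Variable d : nat.
Local Notation Zd := (Zd d).
Local Notation Perm := (Perm d).
Implicit Types (s t g p : Perm) (L D A : set Zd).

(** Forward iterates only; in finite volume every point is periodic, so this is the union of the
    full cycles that meet [A]. *)
Definition orb s A : set Zd := [set y | exists x n, A x /\ iter n s x = y].

Definition restr D s : Perm := fun y => if y \in D then s y else y.

Lemma SL_period L s x : finite_set L -> SL L id s -> exists n, iter n.+1 s x = x.
Proof.
move=> Lf Ls; have [Lx|nLx] := pselect (L x); last first.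
  by exists 0%N; rewrite /= Ls.2.
have Li n : L (iter n s x) by elim: n => //= n; exact: (SL_stable Ls).
have [n [m [nm e]]] : exists n m, (n < m)%N /\ iter n s x = iter m s x.
  apply: contrapT => H; apply: infinite_nat.
  have inj : injective (fun n => iter n s x).
    move=> n m e; case: (ltngtP n m) => // [nm|mn]; exfalso; apply: H.
      by exists n, m.
    by exists m, n.
  have /finite_preimage : set_inj ((fun n => iter n s x) @^-1` L) (fun n => iter n s x).
    by move=> i j _ _; exact: inj.
  by move=> /(_ Lf); apply: sub_finite_set => k _; exact: Li.
exists (m - n).-1; rewrite prednK ?subn_gt0//.
have ij k : injective (iter k s).
  by elim: k => // k IH y z /= /(SL_inj Ls)/IH.
by apply: (ij n); rewrite -iterD subnKC// ltnW.
Qed.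

Lemma orb_sub s A : A `<=` orb s A. Proof. by move=> x Ax; exists x, 0%N. Qed.

Lemma orb_stableE L s A y : finite_set L -> SL L id s ->
  orb s A (s y) <-> orb s A y.
Proof.
move=> Lf Ls; split => [|[x [n [Ax <-]]]]; last by exists x, n.+1.
have [k e] := SL_period y Lf Ls; move=> [x [n [Ax sy]]].
by exists x, (k + n)%N; split=> //; rewrite iterD sy -iterSr.
Qed.

Lemma restr_bij D s : bijective s -> (forall y, D (s y) <-> D y) ->
  bijective (restr D s).
Proof.
move=> sb Ds; apply: bijP => [x y|y]; rewrite /restr.
  case: ifPn; case: ifPn; rewrite ?inE ?notin_setE => Dy Dx.
  - exact: bij_inj.
  - by move=> e; case: Dy; rewrite -e; exact/Ds.
  - by move=> e; case: Dx; rewrite e; exact/Ds.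
  - by [].
have [Dy|nDy] := pselect (D y).
  have [x e] := bij_surj y sb; exists x; rewrite ifT// inE.
  by apply/Ds; rewrite e.
by exists y; rewrite ifF//; apply/negbTE; rewrite notin_setE.
Qed.

Lemma restr_in D s y : D y -> restr D s y = s y.
Proof. by move=> Dy; rewrite /restr mem_set. Qed.

Lemma restr_out D s y : ~ D y -> restr D s y = y.
Proof. by move=> Dy; rewrite /restr memNset. Qed.

Lemma supp_SL L s : SL L id s -> supp s `<=` L.
Proof. by move=> Ls x sx; apply: contrapT => /Ls.2. Qed.

Lemma SL_supp L s : bijective s -> supp s `<=` L -> SL L id s.
Proof. by move=> sb sL; split=> // x nLx; apply: contrapT => /sL. Qed.

Lemma nsupp s x : ~ supp s x -> s x = x.
Proof. by move=> h; apply: contrapT. Qed.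

Lemma suppP s x : bijective s -> supp s (s x) <-> supp s x.
Proof.
move=> /bij_inj si; split => sx; first by apply: contra_not sx => e; rewrite !e.
by move=> /si.
Qed.

Lemma finite_supp L s : finite_set L -> SL L id s -> finite_set (supp s).
Proof. by move=> Lf /supp_SL sL; exact: sub_finite_set Lf. Qed.

(** The permutations of [L] all of whose nontrivial cycles meet [A]: the possible values of the part
    of a permutation that touches [A]. *)
Definition lcl A L : set Perm := [set p | SL L id p /\ supp p `<=` orb p A].

Lemma finite_lcl A L : finite_set L -> finite_set (lcl A L).
Proof. by move=> /finite_SL_id; apply: sub_finite_set => p []. Qed.

Lemma lcl_id A L : lcl A L id.
Proof. by split; [exact: SL_id | move=> x; rewrite /supp /=]. Qed.

(** Uniqueness of the decomposition. Started in [A], the iterates of [p] stay in the union of [A]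
    and the support of [p], where [t] is the identity; hence [p \o t] has the same orbits from [A]
    as [p]. *)
Lemma lcl_comp A L p t : lcl A L p -> SL (L `\` (A `|` supp p)) id t ->
  restr (orb (p \o t) A) (p \o t) = p.
Proof.
move=> [Lp pA] Lt.
have it x n : A x -> iter n (p \o t) x = iter n p x /\ (A `|` supp p) (iter n p x).
  move=> Ax; elim: n => [|n [IH1 IH2]]; first by split=> //; left.
  rewrite !iterS IH1 /=; have ti : t (iter n p x) = iter n p x.
    by apply: Lt.2 => -[_]; apply.
  split; first by rewrite ti.
  have [h|/nsupp ->//] := pselect (supp p (iter n p x)).
  by right; apply/(suppP _ Lp.1).
apply/funext => y; have [oy|noy] := pselect (orb (p \o t) A y).
  rewrite restr_in//; case: oy => x [n [Ax <-]].
  have [-> h] := it x n Ax; rewrite /= Lt.2//; by case.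
rewrite restr_out//; apply/esym/nsupp => /pA [x [n [Ax e]]].
by apply: noy; exists x, n; rewrite (it x n Ax).1.
Qed.

(** Existence of the decomposition: [p] and [t] are the restrictions of [s] to the cycles meeting
    [A] and to the remaining cycles. *)
Lemma lcl_split A L s : finite_set L -> A `<=` L -> SL L id s ->
  let p := restr (orb s A) s in
  lcl A L p /\ exists2 t, SL (L `\` (A `|` supp p)) id t & p \o t = s.
Proof.
move=> Lf AL Ls p; pose t := restr (~` orb s A) s.
have os y : orb s A (s y) <-> orb s A y by exact: orb_stableE Lf Ls.
have pb : bijective p by apply: restr_bij => //; exact: Ls.1.
have tb : bijective t.
  by apply: restr_bij; [exact: Ls.1 | move=> y; rewrite /setC /= os].
have sp : supp p `<=` orb s A.
  by move=> y py; apply: contrapT => noy; apply: py; rewrite /p restr_out.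
split; first split.
- by apply: SL_supp => // y /[dup] /sp oy; rewrite /supp /= /p restr_in//; exact: (supp_SL Ls).
- move=> y /sp [x [n [Ax <-]]]; exists x, n; split => //.
  elim: n => //= n ->; rewrite /p restr_in//; by exists x, n.
exists t.
  split=> // y h; rewrite /t; have [oy|noy] := pselect (orb s A y).
    by rewrite restr_out.
  rewrite restr_in//; apply: Ls.2 => Ly; apply: h; split => // -[Ay|/sp//].
  exact/noy/orb_sub.
apply/funext => y /=; rewrite /t; have [oy|noy] := pselect (orb s A y).
  by rewrite restr_out// /p restr_in.
by rewrite restr_in// /p restr_out// os.
Qed.

End Orbits.

Section Weights.
Variables (R : realType) (d : nat) (V : Zd d -> R) (a : R).
Hypothesis V0 : V 0 = 0.
Local Notation Zd := (Zd d).
Local Notation Perm := (Perm d).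
Implicit Types (s t g p : Perm) (L D A : set Zd) (f : Perm -> R).
Local Notation wt := (cyc_weight V a).

(** Since [V 0 = 0], fixed points cost nothing and the weight does not depend on the volume;
    partition functions of different volumes become sums of the same weights over nested sets. *)
Lemma gweight_wt L s : SL L id s -> gweight V a L s = wt s.
Proof.
move=> Ls; rewrite /gweight /cyc_weight /Ham; congr (expR (- (a * _))).
apply/esym/fsbig_widen; first exact: supp_SL.
by move=> x [_ /nsupp] /= ->; rewrite subrr.
Qed.

Lemma gweight_comp L p t : finite_set L -> (forall x, t x = x \/ p (t x) = t x /\ p x = x) ->
  gweight V a L (p \o t) = gweight V a L p * gweight V a L t.
Proof.
move=> Lf h; rewrite /gweight -expRD -opprD -mulrDr /Ham -fsumrD//.
congr (expR (- (a * _))); apply: eq_fsbigr => x _ /=.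
by case: (h x) => [->|[-> ->]]; rewrite subrr V0 ?addr0 ?add0r.
Qed.

Lemma wt_gt0 s : 0 < wt s. Proof. exact: expR_gt0. Qed.
Lemma wt_ge0 s : 0 <= wt s. Proof. exact: expR_ge0. Qed.

Definition Nw L f := \sum_(s \in SL L id) wt s * f s.
Definition Zw L := Nw L (fun=> 1).

Lemma Zw_Zpart L : Zpart V a L id = Zw L.
Proof.
rewrite /Zpart /Zw /Nw; apply: eq_fsbigr => s; rewrite inE => Ls.
by rewrite mulr1 gweight_wt.
Qed.

Lemma Gexp_Nw L f : Gexp V a L id f = Nw L f / Zw L.
Proof.
rewrite /Gexp Zw_Zpart mulr_fsuml; apply: eq_fsbigr => s; rewrite inE => Ls.
by rewrite gweight_wt// mulrAC.
Qed.

Lemma wt_comp L A p t : finite_set L -> lcl A L p ->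
  SL (L `\` (A `|` supp p)) id t -> wt (p \o t) = wt p * wt t.
Proof.
move=> Lf [Lp pA] Lt.
have Lt' : SL L id t by apply: SL_mono Lt => x [].
rewrite -!(@gweight_wt L)//; last exact: SL_comp.
apply: gweight_comp => // x.
have [h|nh] := pselect ((L `\` (A `|` supp p)) x); last by left; exact: Lt.2.
right; split; apply: nsupp.
  by have [_ h' px] := SL_stable Lt h; apply: h'; right.
by move=> px; case: h => _; apply; right.
Qed.

(* [s = p \o t], where [p] gathers the cycles of [s] that meet [A] and [t] fixes [A] and the support of [p]. *)
Lemma Nw_dec A L f : finite_set L -> A `<=` L ->
  Nw L f = \sum_(p \in lcl A L)
    wt p * Nw (L `\` (A `|` supp p)) (fun t => f (p \o t)).
Proof.
move=> Lf AL; rewrite /Nw.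
rewrite (@fsumr_dep _ _ _ _ (lcl A L) (fun p => SL (L `\` (A `|` supp p)) id)
  _ (fun p t => p \o t)).
- apply: eq_fsbigr => p; rewrite inE => pA; rewrite mulr_fsumr.
  apply: eq_fsbigr => t; rewrite inE => Lt.
  by rewrite (wt_comp Lf pA Lt) mulrA.
- exact: finite_lcl.
- exact: finite_SL_id.
- move=> p t [Lp _] Lt; apply: SL_comp => //.
  by apply: SL_mono Lt => x [].
- move=> s Ls; have [pA [t Lt e]] := lcl_split Lf AL Ls.
  by exists (restr (orb s A) s), t.
- move=> p t p' t' pA Lt pA' Lt' e.
  have ep : p = p' by rewrite -(lcl_comp pA Lt) e (lcl_comp pA' Lt').
  split => //; apply/funext => x; case: pA => -[/bij_inj pi _] _.
  by apply: pi; rewrite -[LHS]/((p \o t) x) e /= -ep.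
Qed.

Lemma Zw_dec A L : finite_set L -> A `<=` L ->
  Zw L = \sum_(p \in lcl A L) wt p * Zw (L `\` (A `|` supp p)).
Proof. exact: Nw_dec. Qed.

Lemma Zw_mono L D : finite_set L -> D `<=` L -> Zw D <= Zw L.
Proof.
move=> Lf DL; apply: fsumr_subset.
- exact: finite_SL_id.
- exact: SL_mono.
- by move=> s _; rewrite mulr1 wt_ge0.
Qed.

Lemma Zw_gt0 L : finite_set L -> 0 < Zw L.
Proof.
move=> Lf; rewrite /Zw /Nw (fsbigD1 (id : Perm))//=; [|exact: finite_SL_id|exact: SL_id].
rewrite ltr_pwDl ?mulr1 ?wt_gt0//.
by apply: fsumr_ge0 => s _; rewrite mulr1 wt_ge0.
Qed.

(* The [Gexp]-probability that every site of [D] is a fixed point. *)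
Definition rho L D := Zw (L `\` D) / Zw L.

Lemma rho_ge0 L D : finite_set L -> 0 <= rho L D.
Proof.
by move=> Lf; rewrite divr_ge0// ltW// Zw_gt0//; exact: sub_finite_set Lf.
Qed.

Lemma rho_le1 L D : finite_set L -> rho L D <= 1.
Proof. by move=> Lf; rewrite ler_pdivrMr ?Zw_gt0// mul1r; exact: Zw_mono. Qed.

Lemma rho_norm L D : finite_set L -> `|rho L D| <= 1.
Proof. by move=> Lf; rewrite ger0_norm ?rho_ge0// rho_le1. Qed.

(** The chain rule for the events that sites are fixed: given that [D] is fixed, the rest is
    distributed as in the volume without [D]. It reduces every [rho] to one-site ratios. *)
Lemma rhoU L D E : finite_set L -> rho L (D `|` E) = rho L D * rho (L `\` D) E.
Proof.
move=> Lf; rewrite /rho setDDl [RHS]mulrC mulrA divfK//.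
by rewrite gt_eqF// Zw_gt0//; exact: sub_finite_set Lf.
Qed.

End Weights.

Lemma finite_fset_bound (T : choiceType) (F : set T) (P : T -> nat -> Prop) :
  finite_set F -> (forall z, F z -> exists n, P z n) ->
  (forall z n m, (n <= m)%N -> P z n -> P z m) ->
  exists n, forall z, F z -> P z n.
Proof.
move=> Ff ex mono.
have /choice[g gP] z : exists n, F z -> P z n.
  have [Fz|nFz] := pselect (F z); last by exists 0%N.
  by have [n] := ex _ Fz; exists n.
exists (\max_(z <- fset_set F) g z)%N => z Fz.
apply: mono (gP _ Fz); apply: leq_bigmax_seq => //.
by rewrite in_fset_set// inE.
Qed.

(** * Sup-norm balls, and conjugation by isometries of the potential *)

Section Norm.
Variable d : nat.
Local Notation Zd := (Zd d).
Implicit Types (x y z : Zd) (L D A : set Zd).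

Definition nrm x : nat := \max_(i < d) `|x ord0 i|%N.
Definition nball x n : set Zd := [set y | (nrm (y - x)%R <= n)%N].

Lemma nrm_le x n : (nrm x <= n)%N <-> forall i, (`|x ord0 i| <= n)%N.
Proof.
split=> [h i|h]; last by apply/bigmax_leqP => i _.
by apply: leq_trans h; rewrite /nrm; exact: leq_bigmax.
Qed.

Lemma nrm0 : nrm 0 = 0%N.
Proof. by apply/eqP; rewrite -leqn0; apply/nrm_le => i; rewrite mxE. Qed.

Lemma absz_addr (p q : int) : (`|(p + q)%R| <= `|p| + `|q|)%N.
Proof. lia. Qed.

Lemma nrmD x y : (nrm (x + y)%R <= nrm x + nrm y)%N.
Proof.
apply/nrm_le => i; rewrite mxE.
have hx : (`|x ord0 i| <= nrm x)%N by apply: (nrm_le _ _).1.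
have hy : (`|y ord0 i| <= nrm y)%N by apply: (nrm_le _ _).1.
exact/(leq_trans (absz_addr _ _))/leq_add.
Qed.

Lemma nballxx x n : nball x n x. Proof. by rewrite /nball /= subrr nrm0. Qed.

Lemma nball_sub x y n m : nball x m y -> nball y n `<=` nball x (n + m)%N.
Proof.
move=> xy z yz; rewrite /nball /=.
rewrite (_ : z - x = (z - y) + (y - x)); last by rewrite addrA subrK.
exact/(leq_trans (nrmD _ _))/leq_add.
Qed.

Lemma nball_mono x n m : (n <= m)%N -> nball x n `<=` nball x m.
Proof. by move=> nm y /leq_trans; apply. Qed.

Lemma finite_nball x n : finite_set (nball x n).
Proof.
pose G (f : {ffun 'I_d -> 'I_(n.*2.+1)}) : Zd :=
  (\row_i ((f i : nat)%:Z - n%:Z)) + x.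
apply: (@sub_finite_set _ _ (G @` [set: {ffun 'I_d -> 'I_(n.*2.+1)}])); last first.
  by apply: finite_image; exact: finite_finset.
move=> y /nrm_le yx.
exists [ffun i => inord `|((y - x)%R ord0 i + n%:Z)%R|%N] => //.
apply/rowP => i; rewrite /G !mxE ffunE.
have : (`|(y 0 i - x 0 i)%R| <= n)%N by have := yx i; rewrite !mxE.
have -> : (y - x)%R ord0 i = (y 0 i - x 0 i)%R by rewrite !mxE.
by move: (y 0 i) (x 0 i) => q r qr; rewrite inordK; lia.
Qed.

Lemma finite_sub_nball A : finite_set A -> exists n, A `<=` nball 0 n.
Proof.
move=> Af; exists (\max_(x <- fset_set A) nrm x)%N => x Ax.
rewrite /nball /= subr0; apply: leq_bigmax_seq => //.
by rewrite in_fset_set// inE.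
Qed.

End Norm.

Section Conj.
Variables (R : realType) (d : nat) (V : Zd d -> R) (a : R).
Local Notation Zd := (Zd d).
Local Notation Perm := (Perm d).
Implicit Types (s t g p : Perm) (L D A : set Zd) (f : Perm -> R).
Local Notation wt := (cyc_weight V a).

(** Here [h'] is to be the inverse of [h]. Translations serve for stationarity and mixing, the
    reflection [y |-> 2x - y] for the mean jump. *)
Definition conjp (h h' s : Perm) : Perm := h \o s \o h'.

Variables h h' : Perm.
Hypotheses (k1 : cancel h h') (k2 : cancel h' h).
Hypothesis Vh : forall x y, V (h x - h y) = V (x - y).

Let hb : bijective h. Proof. by exists h'. Qed.
Let hi : injective h. Proof. exact: can_inj k1. Qed.

Lemma conjpK : cancel (conjp h h') (conjp h' h).
Proof. by move=> s; apply/funext => x; rewrite /conjp /= !k1. Qed.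

Lemma conjpK' : cancel (conjp h' h) (conjp h h').
Proof. by move=> s; apply/funext => x; rewrite /conjp /= !k2. Qed.

Lemma conjp_bij s : bijective s -> bijective (conjp h h' s).
Proof.
by move=> sb; apply: bij_comp; [exact: bij_comp | exists h].
Qed.

Lemma supp_conjp s : supp (conjp h h' s) = h @` supp s.
Proof.
apply/seteqP; split=> [x /= sx|_ [x sx <-]].
  exists (h' x); last exact: k2.
  by apply: contra_not sx; rewrite /conjp /= => ->.
by rewrite /supp /= /conjp /= k1 => /hi.
Qed.

Lemma conjp_SL L s : SL L id s -> SL (h @` L) id (conjp h h' s).
Proof.
move=> Ls; split; first exact/conjp_bij/Ls.1.
move=> x nx; rewrite /conjp /= Ls.2 ?k2// => Lx; apply: nx.
by exists (h' x).
Qed.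

Lemma iter_conjp s n x : iter n (conjp h h' s) (h x) = h (iter n s x).
Proof. by elim: n => //= n ->; rewrite /conjp /= k1. Qed.

Lemma Ham_conjp L s : Ham V (h @` L) (conjp h h' s) = Ham V L s.
Proof.
rewrite /Ham fsbig_image; last by move=> x y _ _; exact: hi.
by apply: eq_fsbigr => x _; rewrite /conjp /= k1 Vh.
Qed.

Lemma wt_conjp s : wt (conjp h h' s) = wt s.
Proof. by rewrite /cyc_weight supp_conjp; congr (expR (- (a * _))); exact: Ham_conjp. Qed.

End Conj.

Section ConjG.
Variables (R : realType) (d : nat) (V : Zd d -> R) (a : R).
Local Notation Zd := (Zd d).
Local Notation Perm := (Perm d).
Implicit Types (s t g p : Perm) (L D A : set Zd) (f : Perm -> R).
Local Notation wt := (cyc_weight V a).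
Variables h h' : Perm.
Hypotheses (k1 : cancel h h') (k2 : cancel h' h).
Hypothesis Vh : forall x y, V (h x - h y) = V (x - y).

Lemma image_can L : h' @` (h @` L) = L.
Proof.
apply/seteqP; split=> [_ [_ [x Lx <-] <-]|x Lx]; first by rewrite k1.
by exists (h x) => //; exists x.
Qed.

Lemma conjp_set_bij L : set_bij (SL L id) (SL (h @` L) id) (conjp h h').
Proof.
split.
- by move=> s /(conjp_SL k1 k2).
- by move=> s t _ _ /(can_inj (conjpK k1)).
- move=> s /(conjp_SL k2 k1); rewrite image_can => Ls.
  by exists (conjp h' h s) => //; rewrite conjpK'.
Qed.

Lemma Gexp_conjp L f :
  Gexp V a (h @` L) id f = Gexp V a L id (f \o conjp h h').
Proof.
have E F : \sum_(s \in SL (h @` L) id) F s = \sum_(s \in SL L id) F (conjp h h' s) :> R.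
  exact: (reindex_fsbig _ _ _ _ (conjp_set_bij L)).
have e : Zpart V a (h @` L) id = Zpart V a L id.
  apply: (etrans (E _)).
  by apply: eq_fsbigr => s _; rewrite /gweight Ham_conjp.
rewrite /Gexp e; apply: (etrans (E _)).
by apply: eq_fsbigr => s _; rewrite /gweight Ham_conjp.
Qed.

Lemma cyc_len_conjp g : finite_set (supp g) ->
  cyc_len (conjp h h' g) = cyc_len g.
Proof.
move=> gf; rewrite /cyc_len (supp_conjp k1 k2) fset_set_image//.
by rewrite card_imfset//; exact: can_inj k1.
Qed.

Lemma is_cycle_conjp g : is_cycle g -> is_cycle (conjp h h' g).
Proof.
move=> [gb gf g2 gt]; split.
- exact: conjp_bij.
- by rewrite (supp_conjp k1 k2); exact: finite_image.
- by rewrite cyc_len_conjp.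
- move=> x y; rewrite !(supp_conjp k1 k2) => -[x' gx <-] [y' gy <-].
  by have [n e] := gt _ _ gx gy; exists n; rewrite (iter_conjp k1) e.
Qed.

End ConjG.

Lemma shift_conjp d (u : Zd d) (s : Perm d) :
  Defs.shift u s = conjp (fun x => x + u) (fun x => x - u) s.
Proof. by []. Qed.

Section Cycles.
Variables (d : nat).
Local Notation Zd := (Zd d).
Local Notation Perm := (Perm d).
Implicit Types (s t g p : Perm) (L D A : set Zd).

Definition cyc (x : Zd) : set Perm := [set g | is_cycle g /\ supp g x].

(** Every nontrivial orbit of [p] passes through [x], so there is only one. *)
Lemma lcl1_cyc L x p : finite_set L -> lcl [set x] L p -> p <> id -> cyc x p.
Proof.
move=> Lf [Lp px] pid.
have [y py] : exists y, supp p y.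
  by apply: contrapT => /forallNP H; apply: pid; apply/funext => y; exact: nsupp.
have sx : supp p x.
  apply: contrapT => /nsupp e; have [x' [n [-> ey]]] := px _ py.
  apply: py; rewrite -ey; suff -> : iter n p x = x by [].
  by elim: n {ey} => //= n ->.
have pf := finite_supp Lf Lp.
split => //; split => //; first exact: Lp.1.
- rewrite /cyc_len; have -> : 2%N = size (finmap.enum_fset [fset x; p x]%fset).
    by rewrite cardfs2; have -> // : x != p x; apply/eqP => e; apply: sx.
  apply: fsubset_leq_card; apply/fsubsetP => z.
  rewrite !inE in_fset_set// inE => /orP[/eqP ->//|/eqP ->].
  exact/(suppP _ Lp.1).
- move=> y1 y2 /px [x1 [n [-> <-]]] /px [x2 [m [-> <-]]].
  have o n' : orb p [set iter n p x] (iter n' p x) <-> orb p [set iter n p x] x.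
    elim: n' => //= n' <-; exact: orb_stableE Lf Lp.
  have : orb p [set iter n p x] (iter m p x).
    by apply/o/(o n); exists (iter n p x), 0%N.
  by move=> [z [k [-> e]]]; exists k.
Qed.

Lemma cyc_lcl L x g : cyc x g -> supp g `<=` L -> lcl [set x] L g.
Proof.
move=> [[gb gf _ gt] gx] gL; split; first exact: SL_supp.
by move=> y gy; have [n e] := gt _ _ gx gy; exists x, n.
Qed.

Lemma cyc_shift (x u : Zd) g : cyc x g -> cyc (x + u) (Defs.shift u g).
Proof.
have k1 : cancel (fun x : Zd => x + u) (fun x => x - u) by move=> y; rewrite addrK.
have k2 : cancel (fun x : Zd => x - u) (fun x => x + u) by move=> y; rewrite subrK.
move=> [gc gx]; split; first exact: (is_cycle_conjp k1 k2).
by rewrite shift_conjp (supp_conjp k1 k2); exists x.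
Qed.

Lemma supp_shift (u : Zd) s : supp (Defs.shift u s) = (fun x => x + u) @` supp s.
Proof.
apply: supp_conjp => y; first exact: addrK.
exact: subrK.
Qed.

Lemma cyc_len_shift (u : Zd) g : finite_set (supp g) -> cyc_len (Defs.shift u g) = cyc_len g.
Proof.
rewrite shift_conjp; apply: cyc_len_conjp => y; first exact: addrK.
exact: subrK.
Qed.

Lemma shiftK (u : Zd) : cancel (@Defs.shift d u) (Defs.shift (- u)).
Proof. by move=> s; apply/funext => x; rewrite /Defs.shift !opprK !addrK. Qed.

Lemma wt_shift (R : realType) (V : Zd -> R) a (u : Zd) g :
  cyc_weight V a (Defs.shift u g) = cyc_weight V a g.
Proof.
rewrite shift_conjp; apply: wt_conjp => [y|y|x y]; first exact: addrK.
  exact: subrK.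
by congr (V _); rewrite opprD addrACA subrr addr0.
Qed.

End Cycles.

(** * Contraction of the one-site ratios *)

Section Contraction.
Variables (R : realType) (d : nat) (V : Zd d -> R) (a : R).
Hypothesis V0 : V 0 = 0.
Hypothesis Hbeta : (beta V a < 1%:E)%E.
Local Notation Zd := (Zd d).
Local Notation Perm := (Perm d).
Implicit Types (g p : Perm) (L D A : set Zd) (f : Perm -> R) (x y : Zd).
Local Notation wt := (cyc_weight V a).
Local Notation rho := (rho V a).
Local Notation Zw := (Zw V a).

Definition b := fine (beta V a).

Lemma beta_ge0 : (0 <= beta V a)%E.
Proof. by apply: esum_ge0 => g _; rewrite lee_fin mulr_ge0// wt_ge0. Qed.

Lemma beta_b : beta V a = b%:E.
Proof.
rewrite /b fineK// fin_real// (lt_le_trans _ beta_ge0)//=.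
by rewrite (lt_trans Hbeta)// ltry.
Qed.

Lemma b_ge0 : 0 <= b. Proof. by rewrite -lee_fin -beta_b beta_ge0. Qed.
Lemma b_lt1 : b < 1. Proof. by rewrite -lte_fin -beta_b. Qed.

Lemma cyc0_sum F : finite_set F -> F `<=` cyc 0 ->
  \sum_(g \in F) (cyc_len g)%:R * wt g <= b.
Proof.
move=> Ff F0; rewrite -lee_fin -beta_b; apply: esum_ge; exists F => //.
rewrite fsbig_finite//= -sumEFin fsbig_finite//=.
Qed.

Lemma finite_shift (u : Zd) (F : set Perm) : finite_set F -> finite_set (Defs.shift u @` F).
Proof. exact: finite_image. Qed.

Lemma sum_shift (u : Zd) (F : set Perm) f :
  \sum_(g \in Defs.shift u @` F) f g = \sum_(g \in F) f (Defs.shift u g).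
Proof. by apply: fsbig_image => g g' _ _; exact: (can_inj (shiftK u)). Qed.

Lemma cyc_shift0 x F : F `<=` cyc x -> (Defs.shift (- x) @` F) `<=` cyc 0.
Proof. by move=> Fx _ [g /Fx gx <-]; rewrite -(subrr x); exact: cyc_shift. Qed.

Lemma cyc_sum x F : finite_set F -> F `<=` cyc x ->
  \sum_(g \in F) (cyc_len g)%:R * wt g <= b.
Proof.
move=> Ff Fx; apply: le_trans (cyc0_sum (finite_shift (- x) Ff) (cyc_shift0 Fx)).
rewrite sum_shift; apply: ler_fsumr => // g /Fx [[_ gf _ _] _].
by rewrite wt_shift cyc_len_shift.
Qed.

Lemma wt_le_len g : is_cycle g -> wt g <= (cyc_len g)%:R * wt g.
Proof.
by move=> [_ _ g2 _]; rewrite ler_peMl ?wt_ge0// ler1n (leq_trans _ g2).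
Qed.

Lemma cyc_sum_wt x F : finite_set F -> F `<=` cyc x -> \sum_(g \in F) wt g <= b.
Proof.
move=> Ff Fx; apply: le_trans (cyc_sum Ff Fx); apply: ler_fsumr => // g /Fx [gc _].
exact: wt_le_len.
Qed.

(** Uniform smallness of the weight of the cycles through [x] that leave the ball of radius [m]
    around [x]; finite families are enough, as only finite volumes are summed. *)
Definition tail m t := forall x F, finite_set F -> F `<=` cyc x ->
  (forall g, F g -> ~ supp g `<=` nball x m) -> \sum_(g \in F) wt g <= t.

Lemma tail0 (t : R) : 0 < t -> exists m, forall F, finite_set F -> F `<=` cyc 0 ->
  (forall g, F g -> ~ supp g `<=` nball 0 m) -> \sum_(g \in F) wt g <= t.
Proof.
move=> t0; have : (b%:E - t%:E < beta V a)%E.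
  by rewrite beta_b lte_fin ltrBlDr ltrDl.
move=> /ereal_sup_gt[_ [X [Xf X0] <-]].
rewrite fsbig_finite//= sumEFin lte_fin -fsbig_finite// => Xt.
have [m Hm] : exists m, forall g, X g -> supp g `<=` nball 0 m.
  apply: finite_fset_bound => // [g /X0 [[_ gf _ _] _]|g n m nm gn].
    exact: finite_sub_nball.
  exact: subset_trans gn (nball_mono nm).
exists m => F Ff F0 Fm.
have XF : X `&` F `<=` set0 by move=> g [/Hm gm /Fm].
have := cyc0_sum (F := X `|` F); rewrite fsbigU0//= finite_setU => /(_ (conj Xf Ff)).
have XF0 : X `|` F `<=` cyc 0 by move=> g [/X0|/F0].
move=> /(_ XF0) h.
have : \sum_(g \in F) wt g <= \sum_(g \in F) (cyc_len g)%:R * wt g.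
  by apply: ler_fsumr => // g /F0 [gc _]; exact: wt_le_len.
lra.
Qed.

Lemma tail_ex (t : R) : 0 < t -> exists m, tail m t.
Proof.
move=> /tail0[m Hm]; exists m => x F Ff Fx Fm.
have := Hm _ (finite_shift (- x) Ff) (cyc_shift0 Fx).
rewrite sum_shift; under eq_fsbigr do rewrite wt_shift.
apply=> _ [g Fg <-] h; apply: (Fm g Fg) => y gy.
have := h (y - x); rewrite supp_shift => /(_ (ex_intro2 _ _ y gy erefl)).
by rewrite /nball /= subr0.
Qed.

Definition agree L L' D := forall y, D y -> (L y <-> L' y).

(** The quantity that contracts: the effect on a one-site ratio of altering the volume farther than
    [n] from the site, uniformly over sites and finite volumes. *)
Definition site_lip n (delta : R) := forall x L L', finite_set L -> finite_set L' ->
  agree L L' (nball x n) -> `|rho L [set x] - rho L' [set x]| <= delta.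

Lemma agreeD L L' D E : agree L L' E -> agree (L `\` D) (L' `\` D) E.
Proof. by move=> h y /h [h1 h2]; split=> -[Ly nDy]; split=> //; [exact: h1|exact: h2]. Qed.

(** Peeling off the sites one at a time by [rhoU] gives a product of one-site ratios; all factors
    lie in [0, 1], so the errors of the factors merely add up. *)
Lemma rho_lip n delta : site_lip n delta -> forall (s : seq Zd) L L',
  finite_set L -> finite_set L' -> (forall y, y \in s -> agree L L' (nball y n)) ->
  `|rho L [set` s] - rho L' [set` s]| <= (size s)%:R * delta.
Proof.
move=> H; elim=> [|x s IH] L L' Lf Lf' ag.
  by rewrite /rho set_nil !setD0 !divff ?subrr ?normr0 ?mul0r// gt_eqF// Zw_gt0.
have -> : [set` x :: s] = [set x] `|` [set` s].
  apply/seteqP; split=> y /=; rewrite inE; first by move=> /orP[/eqP ->|]; [left|right].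
  by move=> [->|ys]; [rewrite eqxx|rewrite ys orbT].
rewrite !rhoU//.
have h1 := H x L L' Lf Lf' (ag _ (mem_head _ _)).
have h2 : `|rho (L `\ x) [set` s] - rho (L' `\ x) [set` s]| <= (size s)%:R * delta.
  apply: IH; [exact: finite_setD|exact: finite_setD|move=> y ys].
  by apply/agreeD/ag; rewrite inE ys orbT.
have r1 := @rho_norm _ _ V a L' [set x] Lf'.
have r2 := @rho_norm _ _ V a (L `\ x) [set` s] (finite_setD _ Lf).
move: h1 h2 r1 r2; set p := rho L _; set q := rho _ [set` s].
set p' := rho L' [set x]; set q' := rho _ [set` s] => h1 h2 r1 r2.
clearbody p q p' q'.
rewrite (_ : p * q - p' * q' = (p - p') * q + p' * (q - q')); last lra.
apply: (le_trans (ler_normD _ _)); rewrite !normrM /= -natr1 mulrDl mul1r addrC.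
apply: lerD.
  by apply: (le_trans _ h2); rewrite ler_piMl.
by apply: (le_trans _ h1); rewrite ler_piMr.
Qed.

Definition cycin x L : set Perm := [set g | cyc x g /\ supp g `<=` L].

Lemma lcl_cycin x L : finite_set L -> L x ->
  lcl [set x] L = [set (id : Perm)] `|` cycin x L.
Proof.
move=> Lf Lx; apply/seteqP; split=> [g gx|g [->|[gx gL]]].
- have [->|ne] := pselect (g = id); [by left|right; split].
    exact: lcl1_cyc gx ne.
  by case: gx => /supp_SL.
- exact: lcl_id.
- exact: cyc_lcl.
Qed.

Lemma finite_cycin x L : finite_set L -> finite_set (cycin x L).
Proof.
move=> Lf; apply: (@sub_finite_set _ _ (SL L id)); last exact: finite_SL_id.
by move=> g [[[gb _ _ _] _] gL]; exact: SL_supp.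
Qed.

Lemma supp_id : supp (id : Perm) = set0.
Proof. by apply/seteqP; split=> x // /(_ erefl). Qed.

Lemma wt_id : wt id = 1.
Proof. by rewrite /cyc_weight supp_id fsbig_set0 mulr0 oppr0 expR0. Qed.

Definition csum x L := \sum_(g \in cycin x L) wt g * rho (L `\ x) (supp g).

Lemma csum_ge0 x L : finite_set L -> 0 <= csum x L.
Proof.
move=> Lf; apply: fsumr_ge0 => g _; rewrite mulr_ge0 ?wt_ge0//.
by apply: rho_ge0 => //; exact: finite_setD.
Qed.

Lemma rho_csum x L : finite_set L -> L x -> rho L [set x] = (1 + csum x L)^-1.
Proof.
move=> Lf Lx; have Lxf : finite_set (L `\ x) := finite_setD _ Lf.
have Z1 := Zw_gt0 V a Lxf.
have e : Zw L = Zw (L `\ x) * (1 + csum x L).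
  rewrite (@Zw_dec _ _ _ _ V0 [set x])//; last by move=> y ->.
  rewrite lcl_cycin// fsbigU0//=; [|exact: finite_cycin|]; last first.
    by move=> g [-> [[_]]]; rewrite /supp /=.
  rewrite fsbig_set1 wt_id mul1r supp_id setU0 mulrDr mulr1; congr (_ + _).
  rewrite mulr_fsumr; apply: eq_fsbigr => g _.
  by rewrite /rho setDDl [RHS]mulrC -mulrA divfK// gt_eqF.
rewrite /rho e invfM mulrA divff ?mul1r// gt_eqF//.
Qed.

(** The Lipschitz constant is 1, so that passing from [1 + csum] to its inverse does not spoil the
    factor [b]. *)
Lemma inv1D_lip (u v : R) : 0 <= u -> 0 <= v ->
  `|(1 + u)^-1 - (1 + v)^-1| <= `|u - v|.
Proof.
move=> u0 v0; have u1 : 0 < 1 + u by lra.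
have v1 : 0 < 1 + v by lra.
have : (1 + u)^-1 * (1 + u) = 1 by rewrite mulVf// gt_eqF.
have : (1 + v)^-1 * (1 + v) = 1 by rewrite mulVf// gt_eqF.
have p0 : 0 <= (1 + u)^-1 <= 1 by rewrite invr_ge0 invf_le1//; lra.
have q0 : 0 <= (1 + v)^-1 <= 1 by rewrite invr_ge0 invf_le1//; lra.
move: p0 q0; set p := (1 + u)^-1; set q := (1 + v)^-1 => p0 q0 eq ep.
have -> : p - q = p * q * (v - u).
  have -> : p - q = p * (q * (1 + v)) - q * (p * (1 + u)) by rewrite eq ep !mulr1.
  lra.
by rewrite normrM distrC ler_piMl// ger0_norm ?mulr_ge0//; nra.
Qed.

(* [1 / rho L x = 1 + \sum_g wt g * rho (L `\ x) (supp g)], and the ratio attached to [g] is a product of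
   [cyc_len g] one-site ratios; hence the contraction factor [b = \sum_g cyc_len g * wt g < 1]. *)
Lemma site_lip_step n delta m t : 0 <= delta -> site_lip n delta -> tail m t ->
  site_lip (n + m) (b * delta + t).
Proof.
move=> d0 H Ht x L L' Lf Lf' ag.
have [Lx|nLx] := pselect (L x); last first.
  have nLx' : ~ L' x by move/(ag _ (nballxx _ _)).
  have e D : finite_set D -> ~ D x -> rho D [set x] = 1.
    move=> Df nDx; rewrite /rho (_ : D `\ x = D) ?divff// ?gt_eqF ?Zw_gt0//.
    by apply/seteqP; split=> [y []//|y Dy]; split=> // yx; apply: nDx; rewrite -yx.
  rewrite !e// subrr normr0 addr_ge0 ?mulr_ge0 ?b_ge0//.
  (* The tail bound for the empty family says [0 <= t]. *)
  have := Ht x set0 (finite_set0 _); rewrite fsbig_set0; apply=> //.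
have Lx' : L' x by apply/(ag _ (nballxx _ _)).
rewrite !rho_csum//; apply: (le_trans (inv1D_lip (csum_ge0 _ Lf) (csum_ge0 _ Lf'))).
(* Both sums are extended by zero to one common set of cycles, so that they can be subtracted term
   by term. *)
pose C := cycin x (L `|` L').
have LLf : finite_set (L `|` L') by rewrite finite_setU.
have Cf : finite_set C by exact: finite_cycin.
pose F D g := if g \in cycin x D then wt g * rho (D `\ x) (supp g) else 0.
have csE D : finite_set D -> D `<=` L `|` L' -> csum x D = \sum_(g \in C) F D g.
  move=> Df DL; rewrite /F fsumr_cond//; apply: eq_fsbigl.
  by apply/esym/setIidr => g [gx gD]; split=> // y /gD /DL.
rewrite (csE L)// 1?(csE L')// fsumrB//; apply: (le_trans (ler_norm_fsumr _ Cf)).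
pose G : set Perm := [set g | supp g `<=` nball x m].
rewrite (fsbigID G)//=; apply: lerD; last first.
  have Cf' : finite_set (C `&` ~` G) by exact: finite_setIl.
  apply: (@le_trans _ _ (\sum_(g \in C `&` ~` G) wt g)).
    apply: ler_fsumr => // g _; have w0 := wt_ge0 V a g.
    have B D : finite_set D -> 0 <= F D g <= wt g.
      move=> Df; rewrite /F; case: ifP => _; last by rewrite lexx.
      rewrite mulr_ge0 ?rho_ge0//=; last exact: finite_setD.
      by rewrite ler_piMr// rho_le1//; exact: finite_setD.
    have := B L Lf; have := B L' Lf'; rewrite ler_norml; lra.
  by apply: (Ht x) => // [g [[gx _] _]//|g [_ h]].
have Cf' : finite_set (C `&` G) by exact: finite_setIl.
apply: (@le_trans _ _ (\sum_(g \in C `&` G) (cyc_len g)%:R * wt g * delta)); last first.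
  rewrite -mulr_fsuml ler_wpM2r//; apply: (@cyc_sum x) => //.
  by move=> g [[]].
apply: ler_fsumr => // g [[gx _] gG].
(* A cycle inside the ball of radius [m] lies in both volumes or in neither, as they agree up to
   distance [n + m]; around each of its sites there remains agreement up to distance [n]. *)
have gLL : g \in cycin x L = (g \in cycin x L').
  apply/idP/idP; rewrite !inE => -[_ gL]; split=> // y gy.
    by apply/(ag y)/gL => //; apply: (nball_mono (leq_addl _ _)); exact: gG.
  by apply/(ag y)/gL => //; apply: (nball_mono (leq_addl _ _)); exact: gG.
rewrite /F gLL; case: ifP => _; last first.
  by rewrite subrr normr0 !mulr_ge0// wt_ge0.
rewrite -mulrBr normrM ger0_norm ?wt_ge0// [leRHS]mulrAC [leRHS]mulrC.
rewrite ler_wpM2l ?wt_ge0//.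
have gf : finite_set (supp g) by case: gx => -[].
have -> : supp g = [set` finmap.enum_fset (fset_set (supp g))].
  by rewrite -[LHS](fset_setK gf).
apply: (rho_lip H); [exact: finite_setD|exact: finite_setD|].
move=> y; rewrite in_fset_set// inE => /gG gy.
by apply: agreeD => z /(nball_sub gy); exact: ag.
Qed.

Lemma site_lip_ex e : 0 < e -> exists n, site_lip n e.
Proof.
move=> e0; have b1 := b_lt1; have b0 := b_ge0.
(* With this tail, [e / 2] is the fixed point of [delta |-> b * delta + t]; starting from the
   trivial bound 1, the excess over [e / 2] is multiplied by [b] at each step. *)
have [m Hm] : exists m, tail m ((1 - b) * e / 2).
  by apply: tail_ex; rewrite divr_gt0// mulr_gt0// subr_gt0.
have H k : site_lip (k * m) (b ^+ k + e / 2).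
  elim: k => [|k IH].
    move=> x L L' Lf Lf' _; rewrite expr0 ler_norml.
    have := rho_ge0 V a [set x] Lf; have := rho_le1 V a [set x] Lf.
    have := rho_ge0 V a [set x] Lf'; have := rho_le1 V a [set x] Lf'.
    lra.
  rewrite mulSn addnC exprS.
  have -> : b * b ^+ k + e / 2 = b * (b ^+ k + e / 2) + (1 - b) * e / 2 by lra.
  by apply: site_lip_step => //; rewrite addr_ge0 ?exprn_ge0// divr_ge0// ltW.
have [k Hk] : exists k, b ^+ k <= e / 2.
  have /cvgrPdist_le/(_ (e / 2)) : b ^+ n @[n --> \oo] --> 0.
    by apply: cvg_expr; rewrite ger0_norm.
  rewrite divr_gt0// => /(_ isT)[k _ /(_ k)/=].
  by rewrite leqnn sub0r normrN => /(_ isT) h; exists k; exact: le_trans (ler_norm _) h.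
exists (k * m)%N => x L L' Lf Lf' ag; apply: (le_trans (H k x L L' Lf Lf' ag)).
lra.
Qed.

End Contraction.

Section Local.
Variables (R : realType) (d : nat).
Local Notation Zd := (Zd d).
Local Notation Perm := (Perm d).
Implicit Types (s t g p : Perm) (L D A : set Zd) (f h : Perm -> R) (x y : Zd).

Definition local A f := forall s t, bijective s -> bijective t ->
  (forall x, A x -> s x = t x) -> f s = f t.

Definition bdd1 f := forall s, bijective s -> `|f s| <= 1.

End Local.

(** * Quasi-locality and decorrelation in finite volume *)

Section Estimates.
Variables (R : realType) (d : nat) (V : Zd d -> R) (a : R).
Hypothesis V0 : V 0 = 0.
Local Notation Zd := (Zd d).
Local Notation Perm := (Perm d).
Implicit Types (s t g p : Perm) (L D A : set Zd) (f h : Perm -> R) (x y : Zd).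
Local Notation wt := (cyc_weight V a).
Local Notation rho := (rho V a).
Local Notation Zw := (Zw V a).
Local Notation Nw := (Nw V a).
Local Notation E L f := (Gexp V a L id f).

Lemma eq_Nw L f h : (forall s, SL L id s -> f s = h s) -> Nw L f = Nw L h.
Proof. by move=> fh; apply: eq_fsbigr => s; rewrite inE => Ls; rewrite fh. Qed.

Lemma le_Nw L f h : finite_set L -> (forall s, SL L id s -> f s <= h s) ->
  Nw L f <= Nw L h.
Proof.
move=> Lf fh; apply: ler_fsumr; first exact: finite_SL_id.
by move=> s Ls; rewrite ler_wpM2l ?wt_ge0// fh.
Qed.

Lemma NwD L f h : finite_set L -> Nw L (fun s => f s + h s) = Nw L f + Nw L h.
Proof.
move=> Lf; rewrite /Nw -fsumrD; last exact: finite_SL_id.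
by apply: eq_fsbigr => s _; rewrite mulrDr.
Qed.

Lemma NwZ L (k : R) f : Nw L (fun s => k * f s) = k * Nw L f.
Proof. by rewrite /Nw mulr_fsumr; apply: eq_fsbigr => s _; rewrite mulrCA. Qed.

Lemma Nw_norm L f : finite_set L -> `|Nw L f| <= Nw L (fun s => `|f s|).
Proof.
move=> Lf; apply: (le_trans (ler_norm_fsumr _ (finite_SL_id Lf))).
apply: ler_fsumr; first exact: finite_SL_id.
by move=> s _; rewrite normrM ger0_norm// wt_ge0.
Qed.

Lemma Nw_sum (I : choiceType) (F : set I) L (f : I -> Perm -> R) : finite_set L -> finite_set F ->
  Nw L (fun s => \sum_(i \in F) f i s) = \sum_(i \in F) Nw L (f i).
Proof.
move=> Lf Ff; rewrite /Nw exchange_fsbig//; last exact: finite_SL_id.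
by apply: eq_fsbigr => s _; rewrite mulr_fsumr.
Qed.

Lemma E_Nw L f : finite_set L -> Nw L f = E L f * Zw L.
Proof. by move=> Lf; rewrite Gexp_Nw// divfK// gt_eqF// Zw_gt0. Qed.

Lemma ED L f h : finite_set L -> E L (fun s => f s + h s) = E L f + E L h.
Proof. by move=> Lf; rewrite !Gexp_Nw// NwD// mulrDl. Qed.

Lemma EZ L k f : E L (fun s => k * f s) = k * E L f.
Proof. by rewrite !Gexp_Nw// NwZ mulrA. Qed.

Lemma E1 L : finite_set L -> E L (fun=> 1) = 1.
Proof. by move=> Lf; rewrite Gexp_Nw// divff// gt_eqF// Zw_gt0. Qed.

Lemma eq_E L f h : (forall s, SL L id s -> f s = h s) -> E L f = E L h.
Proof. by move=> fh; rewrite !Gexp_Nw// (eq_Nw fh). Qed.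

Lemma le_E L f h : finite_set L -> (forall s, SL L id s -> f s <= h s) -> E L f <= E L h.
Proof.
move=> Lf fh; rewrite !Gexp_Nw// ler_wpM2r ?le_Nw// invr_ge0 ltW// Zw_gt0//.
Qed.

Lemma E_norm L f k : finite_set L -> (forall s, SL L id s -> `|f s| <= k) -> `|E L f| <= k.
Proof.
move=> Lf fk; rewrite Gexp_Nw// normrM normfV (gtr0_norm (Zw_gt0 _ _ Lf)).
rewrite ler_pdivrMr ?Zw_gt0//; apply: (le_trans (Nw_norm _ Lf)).
apply: (le_trans (le_Nw Lf fk)).
have <- : Nw L (fun=> k * 1) = k * Zw L by exact: NwZ.
by apply: le_Nw => // s _; rewrite mulr1.
Qed.

(* [f] on the event that the cycles meeting [A] form a permutation belonging to [G]. *)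
Definition isin (G : set Perm) A f s := if restr (orb s A) s \in G then f s else 0.

Lemma Nw_decG A L (G : set Perm) f : finite_set L -> A `<=` L ->
  Nw L (isin G A f) = \sum_(p \in lcl A L `&` G)
    wt p * Nw (L `\` (A `|` supp p)) (fun t => f (p \o t)).
Proof.
move=> Lf AL; have lf := finite_lcl A Lf.
rewrite (Nw_dec _ V0 _ Lf AL) -(fsumr_cond G _ lf).
apply: eq_fsbigr => p; rewrite inE => pA.
have e t : SL (L `\` (A `|` supp p)) id t -> isin G A f (p \o t) = if p \in G then f (p \o t) else 0.
  by move=> Lt; rewrite /isin (lcl_comp pA Lt).
rewrite (eq_Nw e); case: ifP => // _.
by rewrite /Nw fsbig1 ?mulr0// => t _; rewrite mulr0.
Qed.

Lemma isinC G A f s : f s = isin G A f s + isin (~` G) A f s.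
Proof.
rewrite /isin; case: (pselect (G (restr (orb s A) s))) => Gs.
  by rewrite mem_set// memNset ?addr0//=; apply.
by rewrite memNset// mem_set ?add0r.
Qed.

Lemma isin_le G A f s : `|isin G A f s| <= `|f s| * isin G A (fun=> 1) s.
Proof. by rewrite /isin; case: ifP; rewrite ?mulr1 ?mulr0 ?normr0. Qed.

Lemma isin1_ge0 G A s : 0 <= isin G A (fun=> 1 : R) s.
Proof. by rewrite /isin; case: ifP. Qed.

Definition inside m : set Perm := [set p | supp p `<=` nball 0 m].

(** The cycle of [x] equals [p] with probability [wt p] times a ratio of partition functions, and
    this ratio is at most 1 because the numerator belongs to a smaller volume. *)
Lemma bad1_le x L m M (t : R) : tail V a m t -> nball x m `<=` nball 0 M ->
  finite_set L -> L x -> E L (isin (~` inside M) [set x] (fun=> 1)) <= t.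
Proof.
move=> Ht xM Lf Lx; have xL : [set x] `<=` L by move=> y ->.
rewrite Gexp_Nw// ler_pdivrMr ?Zw_gt0// (Nw_decG _ _ Lf xL).
apply: (@le_trans _ _ (\sum_(p \in lcl [set x] L `&` ~` inside M) wt p * Zw L)).
  apply: ler_fsumr; first exact/finite_setIl/finite_lcl.
  by move=> p _; rewrite ler_wpM2l ?wt_ge0// Zw_mono.
rewrite -mulr_fsuml ler_wpM2r ?(ltW (Zw_gt0 _ _ Lf))//.
apply: (Ht x); first exact/finite_setIl/finite_lcl.
  move=> p [px npM]; apply: (lcl1_cyc Lf px) => e; apply: npM.
  by rewrite e => y; rewrite supp_id.
by move=> p [_ npM] pm; apply: npM; exact: subset_trans pm xM.
Qed.

Definition ncard A : R := \sum_(x \in A) (1 : R).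

Lemma ncard_ge0 A : 0 <= ncard A. Proof. exact: fsumr_ge0. Qed.

Lemma bad_le A L m M (t : R) : tail V a m t -> (forall x, A x -> nball x m `<=` nball 0 M) ->
  finite_set L -> A `<=` L -> E L (isin (~` inside M) A (fun=> 1)) <= ncard A * t.
Proof.
move=> Ht AM Lf AL; have Af : finite_set A by exact: sub_finite_set AL Lf.
rewrite Gexp_Nw// ler_pdivrMr ?Zw_gt0//.
apply: (@le_trans _ _ (Nw L (fun s => \sum_(x \in A) isin (~` inside M) [set x] (fun=> 1) s))).
  apply: le_Nw => // s Ls; rewrite {1}/isin; case: ifP => [|_]; last first.
    by apply: fsumr_ge0 => x _; exact: isin1_ge0.
  rewrite inE => nin.
  (* Union bound: a moved site outside the ball lies on the cycle of some [x] in [A], so the bad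
     event for that [x] occurs. *)
  have [y /= [sy nMy]] : exists y, supp (restr (orb s A) s) y /\ ~ nball 0 M y.
    apply: contrapT => /forallNP h; apply: nin => y sy; apply: contrapT => ny.
    by apply: (h y).
  have oy : orb s A y by apply: contrapT => noy; apply: sy; rewrite restr_out.
  have [x [n [Ax e]]] := oy.
  have oxy : orb s [set x] y by exists x, n.
  rewrite (fsbigD1 x)//= {1}/isin ifT ?lerDl.
    by apply: fsumr_ge0 => z _; exact: isin1_ge0.
  rewrite inE => /(_ y) h; apply: nMy; apply: h.
  by rewrite /supp /= restr_in// -(restr_in s oy).
rewrite Nw_sum// /ncard mulrAC mulr_fsuml mulr_fsuml; apply: ler_fsumr => // x Ax.
rewrite mul1r E_Nw// mulrC ler_wpM2l//; first exact/ltW/Zw_gt0.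
by apply: (bad1_le Ht) => //; [exact: AM|exact: AL].
Qed.

Lemma isin_bad_le A L m M (t : R) f : tail V a m t ->
  (forall x, A x -> nball x m `<=` nball 0 M) ->
  finite_set L -> A `<=` L -> bdd1 f -> `|E L (isin (~` inside M) A f)| <= ncard A * t.
Proof.
move=> Ht AM Lf AL f1; apply: le_trans (bad_le Ht AM Lf AL).
rewrite !Gexp_Nw// normrM normfV (gtr0_norm (Zw_gt0 _ _ Lf)).
rewrite ler_wpM2r ?invr_ge0 ?(ltW (Zw_gt0 _ _ Lf))//.
apply: (le_trans (Nw_norm _ Lf)); apply: le_Nw => // s Ls.
apply: (le_trans (isin_le _ _ _ _)); rewrite ler_piMl ?isin1_ge0//.
exact/f1/(SL_bij Ls).
Qed.

Lemma local_comp A L f p t : local A f -> SL L id p ->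
  SL (L `\` (A `|` supp p)) id t -> f (p \o t) = f p.
Proof.
move=> Af Lp Lt; apply: Af; first exact: bij_comp Lp.1 Lt.1.
  exact: Lp.1.
by move=> x Ax /=; rewrite Lt.2// => -[_]; apply; left.
Qed.

(** As [t] fixes [A], the observable sees only [p]; summing out [t] leaves the law of the cycles
    meeting [A], with masses [wt p * rho L (A union supp p)]. *)
Lemma E_good A L G f : finite_set L -> A `<=` L -> local A f ->
  E L (isin G A f) = \sum_(p \in lcl A L `&` G) wt p * f p * rho L (A `|` supp p).
Proof.
move=> Lf AL Af; rewrite Gexp_Nw// Nw_decG// mulr_fsuml; apply: eq_fsbigr => p.
rewrite inE => -[[Lp pA] _].
have e t : SL (L `\` (A `|` supp p)) id t -> f (p \o t) = f p * 1.
  by move=> Lt; rewrite mulr1; exact: (local_comp Af Lp Lt).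
by rewrite (eq_Nw e) NwZ -/(Zw _) /rho !mulrA.
Qed.

Lemma rho_sum_le1 A L G : finite_set L -> A `<=` L ->
  \sum_(p \in lcl A L `&` G) wt p * rho L (A `|` supp p) <= 1.
Proof.
move=> Lf AL; have : E L (isin G A (fun=> 1)) <= 1.
  rewrite -[leRHS](E1 Lf); apply: le_E => // s _; rewrite /isin.
  by case: ifP => // _; exact: ler01.
rewrite E_good//; apply: le_trans; apply: ler_fsumr => [|p _].
  exact/finite_setIl/finite_lcl.
by rewrite mulr1.
Qed.

Hypothesis Hbeta : (beta V a < 1%:E)%E.

Lemma tail_set A (e : R) : finite_set A -> 0 < e -> exists m (t : R) M, [/\ tail V a m t,
  ncard A * t <= e, A `<=` nball 0 M & forall x, A x -> nball x m `<=` nball 0 M].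
Proof.
move=> Af e0; have n0 := ncard_ge0 A.
(* The [+ 1] covers the empty [A]. *)
have t0 : 0 < e / (ncard A + 1) by rewrite divr_gt0// ltr_wpDl.
have [m Hm] := tail_ex Hbeta t0; have [r Ar] := finite_sub_nball Af.
exists m, (e / (ncard A + 1)), (m + r)%N; split => //.
- rewrite mulrCA ler_piMr ?(ltW e0)// ler_pdivrMr ?mul1r; last by rewrite ltr_wpDl.
  by rewrite lerDl.
- by apply: subset_trans Ar _; apply: nball_mono; exact: leq_addl.
- by move=> x /Ar xr; exact: nball_sub.
Qed.

(** Up to the bad event, [E L f] is a finite sum over [p] supported in a fixed ball, and the volume
    enters it only through the ratios [rho], which [site_lip] controls. The good part and the two
    bad parts cost [e / 4] each. *)
Lemma quasi_local A f e : finite_set A -> local A f -> bdd1 f -> 0 < e ->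
  exists n, forall L L', finite_set L -> finite_set L' -> A `<=` L -> A `<=` L' ->
    agree L L' (nball 0 n) -> `|E L f - E L' f| <= e.
Proof.
move=> Af fA f1 e0.
have [m [t [M [Ht nt AM AmM]]]] := tail_set Af (divr_gt0 e0 (ltr0n R 4)).
pose B := nball (0 : Zd) M; have Bf : finite_set B := finite_nball _ _.
pose N : R := (size (finmap.enum_fset (fset_set B)))%:R.
have N0 : 0 <= N by [].
have ZB := Zw_gt0 V a Bf.
have K0 : 0 < Zw B * N + 1 by rewrite ltr_wpDl// mulr_ge0// ltW.
(* In the good part each [p] costs at most [N * delta], where [N] is the number of sites of the
   ball, and the weights of all [p] in the ball sum to at most [Zw B]; this fixes [delta]. *)
have [n Hn] := site_lip_ex V0 Hbeta (divr_gt0 (divr_gt0 e0 (ltr0n R 4)) K0).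
set delta := _ / _ in Hn; have d0 : 0 < delta by rewrite !divr_gt0.
exists (n + M)%N => L L' Lf Lf' AL AL' ag.
have good : `|E L (isin (inside M) A f) - E L' (isin (inside M) A f)| <= e / 4.
  rewrite !E_good//.
  have -> : lcl A L' `&` inside M = lcl A L `&` inside M.
    apply/seteqP; split=> p [[Lp pA] pM]; split=> //; split=> //;
      apply: SL_supp (SL_bij Lp) _ => y py; have yM := pM _ py;
      have yL := supp_SL Lp py; by apply/(ag y (nball_mono (leq_addl _ _) yM)).
  have If : finite_set (lcl A L `&` inside M) by exact/finite_setIl/finite_lcl.
  rewrite fsumrB//; apply: (le_trans (ler_norm_fsumr _ If)).
  apply: (@le_trans _ _ (\sum_(p \in lcl A L `&` inside M) wt p * (N * delta))).
    apply: ler_fsumr => // p [[Lp pA] pM].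
    rewrite -mulrBr !normrM ger0_norm ?wt_ge0// -mulrA ler_wpM2l ?wt_ge0//.
    apply: (@le_trans _ _ `|rho L (A `|` supp p) - rho L' (A `|` supp p)|).
      by rewrite ler_piMl//; exact/f1/(SL_bij Lp).
    have ApB : A `|` supp p `<=` B by move=> y [/AM|/pM].
    have Apf : finite_set (A `|` supp p) by exact: sub_finite_set ApB Bf.
    have -> : A `|` supp p = [set` finmap.enum_fset (fset_set (A `|` supp p))].
      by rewrite -[LHS](fset_setK Apf).
    apply: (le_trans (rho_lip Hn Lf Lf' _)).
      move=> y; rewrite in_fset_set// inE => /ApB yB.
      by move=> z /(nball_sub yB); exact: ag.
    rewrite ler_wpM2r ?(ltW d0)// ler_nat.
    by apply: fsubset_leq_card; rewrite -fset_set_sub.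
  rewrite -mulr_fsuml; apply: (@le_trans _ _ (Zw B * (N * delta))).
    rewrite ler_wpM2r ?(mulr_ge0 N0 (ltW d0))//.
    apply: (@le_trans _ _ (\sum_(p \in SL B id) wt p)).
      apply: fsumr_subset; first exact: finite_SL_id.
        by move=> p [[Lp _] pM]; exact: SL_supp (SL_bij Lp) pM.
      by move=> p _; exact: wt_ge0.
    by rewrite /Zw /Nw; under [leRHS]eq_fsbigr do rewrite mulr1.
  rewrite mulrA /delta mulrCA ler_piMr ?divr_ge0 ?(ltW e0)//.
  by rewrite ler_pdivrMr// mul1r lerDl.
have bad1 := isin_bad_le Ht AmM Lf AL f1.
have bad2 := isin_bad_le Ht AmM Lf' AL' f1.
have split D : finite_set D ->
    E D f = E D (isin (inside M) A f) + E D (isin (~` inside M) A f).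
  by move=> Df; rewrite -ED//; apply: eq_E => s _; exact: isinC.
rewrite !split//; move: good bad1 bad2; rewrite !ler_norml; lra.
Qed.

(** Given the cycles [p] meeting [A], the remaining permutation follows the law in [L] without [A]
    and the support of [p]. A distant [h] sees only that part, and its mean there is within [eta] of
    the one in [L]. The radius [M] is fixed before [L] and [h], so [h] may later be a far
    translate. *)
Lemma decorrelation A f e : finite_set A -> local A f -> bdd1 f -> 0 < e ->
  exists M, forall L, finite_set L -> A `<=` L -> forall A' h eta,
    local A' h -> bdd1 h -> (forall x, A' x -> ~ nball 0 M x) ->
    (forall D, D `<=` nball 0 M -> `|E (L `\` D) h - E L h| <= eta) ->
    `|E L (fun s => f s * h s) - E L f * E L h| <= e + eta.
Proof.
move=> Af fA f1 e0.
have [m [t [M [Ht nt AM AmM]]]] := tail_set Af (divr_gt0 e0 (ltr0n R 2)).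
exists M => L Lf AL A' h eta hA h1 far Hh.
have fh1 : bdd1 (fun s => f s * h s).
  by move=> s sb; rewrite normrM -[leRHS]mulr1 ler_pM ?f1 ?h1.
have bad1 := isin_bad_le Ht AmM Lf AL f1.
have bad2 := isin_bad_le Ht AmM Lf AL fh1.
have split k : E L k = E L (isin (inside M) A k) + E L (isin (~` inside M) A k).
  by rewrite -ED//; apply: eq_E => s _; exact: isinC.
have hL : `|E L h| <= 1 by apply: E_norm => // s Ls; exact/h1/(SL_bij Ls).
have If : finite_set (lcl A L `&` inside M) by exact/finite_setIl/finite_lcl.
have good : `|E L (isin (inside M) A (fun s => f s * h s)) -
    E L (isin (inside M) A f) * E L h| <= eta.
  rewrite (E_good _ Lf AL fA) Gexp_Nw// Nw_decG// mulr_fsuml mulr_fsuml fsumrB//.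
  apply: (le_trans (ler_norm_fsumr _ If)).
  have eta0 : 0 <= eta by exact: le_trans (Hh set0 (@sub0set _ _)).
  apply: (@le_trans _ _ (\sum_(p \in lcl A L `&` inside M)
      wt p * rho L (A `|` supp p) * eta)); last first.
    by rewrite -mulr_fsuml ler_piMl// rho_sum_le1.
  apply: ler_fsumr => // p [[Lp pA] pM].
  have Df : finite_set (L `\` (A `|` supp p)) by exact: finite_setD.
  have -> : Nw (L `\` (A `|` supp p)) (fun t => f (p \o t) * h (p \o t)) =
      f p * Nw (L `\` (A `|` supp p)) h.
    rewrite -NwZ; apply: eq_Nw => s Ls; rewrite (local_comp fA Lp Ls).
    congr (_ * _); apply: hA; [exact: bij_comp Lp.1 Ls.1|exact: Ls.1|].
    (* For a far site [x], either [t] keeps it in the reduced volume, off the support of [p], or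
       [t x = x] lies outside the ball that contains this support. *)
    move=> x Ax /=; apply: nsupp => ps.
    have [h2|nh] := pselect ((L `\` (A `|` supp p)) x).
      by have [_ h3] := SL_stable Ls h2; apply: h3; right.
    by move: ps; rewrite Ls.2// => /pM; exact: far.
  rewrite (E_Nw _ Df).
  have -> : wt p * (f p * (E (L `\` (A `|` supp p)) h * Zw (L `\` (A `|` supp p)))) / Zw L
      - wt p * f p * rho L (A `|` supp p) * E L h =
     wt p * rho L (A `|` supp p) * (f p * (E (L `\` (A `|` supp p)) h - E L h)).
    rewrite /rho; move: (Zw L)^-1 => z; lra.
  have r0 : 0 <= wt p * rho L (A `|` supp p) by rewrite mulr_ge0 ?wt_ge0 ?rho_ge0.
  rewrite normrM (ger0_norm r0) ler_wpM2l//.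
  have fp := f1 _ (SL_bij Lp); rewrite normrM -[leRHS]mul1r ler_pM//.
  by apply: Hh => y [/AM|/pM].
rewrite (split (fun s => f s * h s)) (split f).
move: good bad1 bad2 hL; set x1 := E L _; set x2 := E L _; set x3 := E L h.
set x4 := E L _; set x5 := E L _ => good bad1 bad2 hL.
have : `|x4 * x3| <= e / 2.
  rewrite normrM -[leRHS]mulr1 ler_pM//; exact: le_trans bad1 nt.
move: good bad1 bad2; rewrite !ler_norml => *; lra.
Qed.

End Estimates.

(** * Coupling all volumes by one uniform variable *)

Section Tree.
Variable R : realType.
Implicit Types (F : seq bool -> R) (u : R) (s : seq bool).

(* [F] gives the masses of the cylinders of a measure on infinite bit strings; words are written most recent bit first. *)
Definition tree F := F [::] = 1 /\
  forall s, 0 <= F s /\ F s = F (false :: s) + F (true :: s).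

(* [`[lft F s, lft F s + F s[] is the interval of [0, 1) assigned to the word [s]. *)
Fixpoint lft F s : R :=
  if s is b :: s' then lft F s' + (if b then F (false :: s') else 0) else 0.

Fixpoint tpath F u n : seq bool :=
  if n is n'.+1 then
    (lft F (tpath F u n') + F (false :: tpath F u n') <= u) :: tpath F u n'
  else [::].

Definition bit F u n := lft F (tpath F u n) + F (false :: tpath F u n) <= u.

Lemma size_tpath F u n : size (tpath F u n) = n.
Proof. by elim: n => //= n ->. Qed.

Lemma tree_ge0 F s : tree F -> 0 <= F s. Proof. by move=> [_ /(_ s)[]]. Qed.

Lemma tpath_in F u n : tree F -> 0 <= u < 1 ->
  lft F (tpath F u n) <= u < lft F (tpath F u n) + F (tpath F u n).
Proof.
move=> FT u01; have [F1 Fs] := FT.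
elim: n => [|n IH] /=; first by rewrite F1 add0r.
have [_ e] := Fs (tpath F u n); move: IH; rewrite e addrA.
by case: ifP; rewrite ?addr0 => h /andP[h1 h2]; apply/andP; split=> //; rewrite ltNge h.
Qed.

Lemma tpath_gt0 F u n : tree F -> 0 <= u < 1 -> 0 < F (tpath F u n).
Proof. by move=> FT /(tpath_in n FT) /andP[h1 h2]; have := le_lt_trans h1 h2; rewrite ltrDl. Qed.

(** The intervals of the two children of a word partition the interval of the word, so the interval
    containing [u] determines the path. *)
Lemma tpath_uniq F u s : tree F -> 0 <= u < 1 ->
  lft F s <= u < lft F s + F s -> tpath F u (size s) = s.
Proof.
move=> FT u01; have [F1 Fs] := FT; elim: s => //= b s IH h.
have [_ e] := Fs s.
have f0 := tree_ge0 (false :: s) FT; have f1 := tree_ge0 (true :: s) FT.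
have -> : tpath F u (size s) = s by apply: IH; move: h; rewrite e; case: b; lra.
by congr (_ :: _); case: b h; [lra|move=> /andP[_]; rewrite addr0 ltNge => /negbTE].
Qed.

Lemma lft_ge0 F s : tree F -> 0 <= lft F s.
Proof.
move=> FT; elim: s => //= b s IH; rewrite addr_ge0//.
by case: b => //; exact: tree_ge0.
Qed.

Lemma lft_le1 F s : tree F -> lft F s + F s <= 1.
Proof.
move=> FT; have [F1 Fs] := FT; elim: s => /= [|b s IH]; first by rewrite F1 add0r.
have [_ e] := Fs s.
have f0 := tree_ge0 (false :: s) FT; have f1 := tree_ge0 (true :: s) FT.
by move: IH; rewrite e; case: b; lra.
Qed.

Lemma lft_cvg (Fn : nat -> seq bool -> R) F s :
  (forall s, Fn n s @[n --> \oo] --> F s) -> lft (Fn n) s @[n --> \oo] --> lft F s.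
Proof.
move=> H; elim: s => /= [|b s IH]; first exact: cvg_cst.
apply: cvgD => //; case: b => //; exact: cvg_cst.
Qed.

(** The intervals are half-open, so a [u] that is no left endpoint is interior to its limit
    interval; the endpoints converge, and the interval of the same word contains [u] for all large
    [n]. *)
Lemma tpath_cvg (Fn : nat -> seq bool -> R) F u k : (forall n, tree (Fn n)) -> tree F ->
  (forall s, Fn n s @[n --> \oo] --> F s) -> 0 <= u < 1 -> (forall s, u <> lft F s) ->
  exists N, forall n, (N <= n)%N -> tpath (Fn n) u k = tpath F u k.
Proof.
move=> Fnt FT cv u01 ul; set s := tpath F u k.
have /andP[h1 h2] := tpath_in k FT u01.
have h1' : lft F s < u by rewrite lt_neqAle h1 andbT eq_sym; apply/eqP/ul.
have c1 := lft_cvg (s := s) cv.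
have c2 : lft (Fn n) s + Fn n s @[n --> \oo] --> lft F s + F s by exact: cvgD.
have [N1 _ H1] := cvgr_lt _ c1 _ h1'.
have [N2 _ H2] := cvgr_gt _ c2 _ h2.
exists (maxn N1 N2) => n; rewrite geq_max => /andP[/H1 /= l1 /H2 /= l2].
by rewrite -[k](size_tpath F u) -/s; apply: tpath_uniq => //; rewrite ltW.
Qed.

Definition U01 : probability (measurableTypeR R) R := uniform_prob (@ltr01 R).

Lemma U01_itv (a b : R) : 0 <= a -> a <= b -> b <= 1 -> U01 `[a, b[%classic = (b - a)%:E.
Proof.
move=> a0 ab b1; rewrite /U01 /= /uniform_prob integral_uniform_pdf.
rewrite setIidl; last first.
  by move=> x /=; rewrite !in_itv /= => /andP[h1 h2]; apply/andP; split; lra.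
rewrite (eq_integral (fun=> 1%E)); last first.
  move=> x; rewrite inE /= in_itv /= => /andP[h1 h2].
  rewrite /uniform_pdf ifT; last by apply/andP; split; lra.
  by rewrite subr0 invr1.
rewrite integral_cst//= mul1e lebesgue_measure_itv /=.
by move: ab; rewrite le_eqVlt => /orP[/eqP ->|ab]; rewrite lte_fin ?ltxx ?subrr// ab.
Qed.

Definition prefix_set F n (Q : seq bool -> bool) : set R :=
  [set u | 0 <= u < 1 /\ Q (tpath F u n)].

Let leaf F n (s : n.-tuple bool) : set R := `[lft F s, lft F s + F s[%classic.

Lemma prefix_set_bigcup F n Q : tree F ->
  prefix_set F n Q = \bigcup_(s in [set s : n.-tuple bool | Q s]) leaf F s.
Proof.
move=> FT; apply/seteqP; split=> [u [u01 Qu]|u [s /= Qs]].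
  exists (Tuple (introT eqP (size_tpath F u n))) => //=.
  by rewrite /leaf /= in_itv /=; exact: tpath_in.
rewrite /leaf /= in_itv /= => h.
have u01 : 0 <= u < 1.
  by move: h (lft_ge0 s FT) (lft_le1 s FT) => /andP[h1 h2] h3 h4; apply/andP; split; lra.
by split=> //; have := tpath_uniq FT u01 h; rewrite size_tuple => ->.
Qed.

Lemma measurable_prefix_set F n Q : tree F -> measurable (prefix_set F n Q : set (measurableTypeR R)).
Proof.
move=> FT; rewrite prefix_set_bigcup//; apply: fin_bigcup_measurable.
  by apply: finite_finset.
by move=> s _; exact: measurable_itv.
Qed.

(** The words of length [n] cut [0, 1) into disjoint intervals of lengths [F s]; hence the bits
    decoded from a uniform variable have the law described by [F]. *)
Lemma U01_prefix_set F n Q : tree F ->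
  U01 (prefix_set F n Q) = (\sum_(s : n.-tuple bool | Q s) F s)%:E.
Proof.
move=> FT; rewrite prefix_set_bigcup//.
have fin : finite_set [set s : n.-tuple bool | Q s] by exact: finite_finset.
have triv : trivIset [set s : n.-tuple bool | Q s] (leaf F (n:=n)).
  move=> s t _ _ [u []]; rewrite /leaf /= !in_itv /= => hs ht.
  have u01 : 0 <= u < 1.
    by move: hs (lft_ge0 s FT) (lft_le1 s FT) => /andP[h1 h2] h3 h4; apply/andP; split; lra.
  have := tpath_uniq FT u01 hs; have := tpath_uniq FT u01 ht; rewrite !size_tuple => -> e.
  exact/val_inj/esym.
rewrite measure_fin_bigcup//; last by move=> s _; exact: measurable_itv.
rewrite (eq_fsbigr (fun s : n.-tuple bool => (F s)%:E)); last first.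
  move=> s _; rewrite -[LHS]/(U01 `[lft F s, lft F s + F s[%classic) U01_itv.
  - by rewrite addrAC subrr add0r.
  - exact: lft_ge0.
  - by rewrite lerDl tree_ge0.
  - exact: lft_le1.
have -> : [set s : n.-tuple bool | Q s] = [set` [seq s <- index_enum _ | Q (val s)]].
  by apply/seteqP; split=> s /=; rewrite mem_filter mem_index_enum andbT.
by rewrite -fsbig_seq ?filter_uniq ?index_enum_uniq// big_filter sumEFin.
Qed.

End Tree.

Section Bits.
Variable d : nat.
Local Notation Zd := (Zd d).
Local Notation Perm := (Perm d).
Implicit Types (s t : Perm) (x y : Zd).

(* The [n]-th bit of a permutation answers the [n]-th question "is [s x = y]?". *)
Definition query (n : nat) : (Zd * Zd)%type := odflt (0, 0) (choice.unpickle n).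
Definition qidx x y : nat := choice.pickle (x, y).

Lemma qidxK x y : query (qidx x y) = (x, y).
Proof. by rewrite /query /qidx choice.pickleK. Qed.

Definition sbit s n : bool := s (query n).1 == (query n).2.

Fixpoint bits s n : seq bool := if n is n'.+1 then sbit s n' :: bits s n' else [::].

Lemma size_bits s n : size (bits s n) = n.
Proof. by elim: n => //= n ->. Qed.

Lemma sbit_qidx s x y : sbit s (qidx x y) = (s x == y).
Proof. by rewrite /sbit qidxK. Qed.

Definition qsites n : set Zd := [set (query i).1 | i in `I_n].

Lemma finite_qsites n : finite_set (qsites n).
Proof. exact/finite_image/finite_II. Qed.

Lemma bits_local s t n : (forall x, qsites n x -> s x = t x) -> bits s n = bits t n.
Proof.
elim: n => //= n IH h; rewrite IH; last first.
  by move=> _ [i /= ni <-]; apply: h; exists i => //=; exact: ltn_trans ni (ltnSn n).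
by rewrite /sbit h//; exists n => /=.
Qed.

Lemma path_bits_le (R : realType) (F : seq bool -> R) u s n m : (n <= m)%N ->
  tpath F u m = bits s m -> tpath F u n = bits s n.
Proof. by move=> /subnK <-; elim: (m - n)%N => //= k IH [_ /IH]. Qed.

Lemma path_bitsP (R : realType) (F : seq bool -> R) u s n :
  tpath F u n = bits s n <-> forall k, (k < n)%N -> bit F u k = sbit s k.
Proof.
elim: n => [|n IH]; first by split.
split=> [/= [e1 /IH e2] k|h /=].
  by rewrite ltnS leq_eqVlt => /orP[/eqP ->|/e2].
congr (_ :: _); first exact: (h n).
by apply/IH => k kn; apply: h; exact: ltn_trans kn _.
Qed.

Lemma bits_inj s t : (forall n, bits s n = bits t n) -> s = t.
Proof.
move=> h; apply/funext => x; have [/= e _] := h (qidx x (t x)).+1.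
by apply/eqP; rewrite -sbit_qidx e sbit_qidx.
Qed.

Lemma bits_sbit s t n : bits s n.+1 = bits t n.+1 -> sbit s n = sbit t n.
Proof. by case. Qed.

End Bits.

Lemma exhausting_sub d (L : nat -> set (Zd d)) (A : set (Zd d)) : exhausting L -> finite_set A ->
  exists N, forall n, (N <= n)%N -> A `<=` L n.
Proof.
move=> [Lf Lm LT] Af.
have mono n m : (n <= m)%N -> L n `<=` L m.
  by move=> /subnK <-; elim: (m - n)%N => //= k IH x /IH; exact: Lm.
have [N HN] : exists N, forall x, A x -> L N x.
  apply: finite_fset_bound => // [x _|x n m nm]; last exact: mono.
  by have : setT x by []; rewrite -LT => -[n _ Lx]; exists n.
by exists N => n Nn x /HN; exact: mono.
Qed.

(** * Infinite-volume limits of expectations, and tightness *)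

Section Limit.
Variables (R : realType) (d : nat) (V : Zd d -> R) (a : R).
Hypothesis V0 : V 0 = 0.
Hypothesis Hbeta : (beta V a < 1%:E)%E.
Local Notation Zd := (Zd d).
Local Notation Perm := (Perm d).
Implicit Types (s t g p : Perm) (L D A : set Zd) (f h : Perm -> R) (x y : Zd).
Local Notation E L f := (Gexp V a L id f).

(** Two volumes containing the same ball agree on it, so [quasi_local] is a Cauchy property along
    the directed set of finite volumes; the limit is then the same for every exhausting sequence. *)
Lemma einf_ex A f : finite_set A -> local A f -> bdd1 f -> exists l, forall e, 0 < e ->
  exists N, forall L, finite_set L -> nball 0 N `<=` L -> `|E L f - l| <= e.
Proof.
move=> Af fA f1; have [r Ar] := finite_sub_nball Af.
have C e : 0 < e -> exists N, forall L L', finite_set L -> finite_set L' ->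
    nball 0 N `<=` L -> nball 0 N `<=` L' -> `|E L f - E L' f| <= e.
  move=> e0; have [n Hn] := quasi_local V0 Hbeta Af fA f1 e0.
  exists (maxn n r) => L L' Lf Lf' nL nL'.
  have rm : nball 0 r `<=` nball (0 : Zd) (maxn n r) by exact/nball_mono/leq_maxr.
  have nm : nball 0 n `<=` nball (0 : Zd) (maxn n r) by exact/nball_mono/leq_maxl.
  by apply: Hn => // x; [move=> /Ar/rm/nL|move=> /Ar/rm/nL'|move=> /nm nx; split=> _; [exact: nL'|exact: nL]].
pose u n := E (nball 0 n) f.
have cu : cvgn u.
  apply/cauchy_cvgP/cauchy_exP => e e0; have [N HN] := C _ (divr_gt0 e0 (ltr0n R 2)).
  exists (u N); exists N => // n /= Nn; rewrite /ball /=.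
  apply: (@le_lt_trans _ _ (e / 2)); last by lra.
  by apply: HN; [exact: finite_nball|exact: finite_nball| |exact: nball_mono].
exists (limn u) => e e0; have [N HN] := C _ (divr_gt0 e0 (ltr0n R 2)).
exists N => L Lf NL.
have /cvgrPdist_le/(_ (e / 2)) := cu; rewrite divr_gt0// => /(_ isT)[M _ /(_ (maxn M N))/=].
rewrite leq_maxl => /(_ isT) h.
have := HN L (nball 0 (maxn M N)) Lf (finite_nball _ _) NL (nball_mono (leq_maxr _ _)).
by move: h; rewrite -/(u _) !ler_norml; lra.
Qed.

Definition Einf f := limn (fun n => E (nball 0 n) f).

Lemma Einf_close A f e : finite_set A -> local A f -> bdd1 f -> 0 < e ->
  exists N, forall L, finite_set L -> nball 0 N `<=` L -> `|E L f - Einf f| <= e.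
Proof.
move=> Af fA f1; have [l Hl] := einf_ex Af fA f1.
suff -> : Einf f = l by exact: Hl.
apply/cvg_lim => //; apply/cvgrPdist_le => eps eps0; have [N HN] := Hl _ eps0.
exists N => // n /= Nn; rewrite distrC; apply: HN; first exact: finite_nball.
exact: nball_mono.
Qed.

Lemma Einf_cvg A f (L : nat -> set Zd) : finite_set A -> local A f -> bdd1 f ->
  exhausting L -> E (L n) f @[n --> \oo] --> Einf f.
Proof.
move=> Af fA f1 Lex; apply/cvgrPdist_le => e e0.
have [N HN] := Einf_close Af fA f1 e0.
have [M HM] := exhausting_sub Lex (finite_nball 0 N).
by exists M => // n /= Mn; rewrite distrC; apply: HN; [case: Lex|exact: HM].
Qed.

Lemma exhausting_nball : exhausting (nball (0 : Zd)).
Proof.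
split; [by move=> n; exact: finite_nball|by move=> n; exact: nball_mono|].
apply/seteqP; split=> // x _; exists (nrm x) => //.
by rewrite /nball /= subr0.
Qed.

Lemma E_sum (I : Type) (r : seq I) (P : pred I) (f : I -> Perm -> R) L : finite_set L ->
  E L (fun s => \sum_(i <- r | P i) f i s) = \sum_(i <- r | P i) E L (f i).
Proof.
move=> Lf; elim: r => [|i r IH].
  rewrite big_nil; have -> : (fun s => \sum_(i <- [::] | P i) f i s) = (fun s => 0 * (fun=> 1) s).
    by apply/funext => s; rewrite big_nil mul0r.
  by rewrite EZ// mul0r.
rewrite big_cons -IH; case: ifP => Pi; last first.
  by apply: eq_E => // s _; rewrite big_cons Pi.
by rewrite -ED//; apply: eq_E => // s _; rewrite big_cons Pi.
Qed.

Definition ind (Q : Perm -> bool) : Perm -> R := fun s => (Q s)%:R.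

Lemma ind_bdd1 Q : bdd1 (ind Q).
Proof. by move=> s _; rewrite /ind; case: (Q s); rewrite ?normr1 ?normr0. Qed.

Definition FL L (w : seq bool) : R := E L (ind (fun s => bits s (size w) == w)).
Definition FI (w : seq bool) : R := Einf (ind (fun s => bits s (size w) == w)).

Lemma ind_bits_local n (Q : seq bool -> bool) : local (@qsites d n) (ind (fun s => Q (bits s n))).
Proof. by move=> s t _ _ st; rewrite /ind (bits_local st). Qed.

Lemma tree_FL L : finite_set L -> tree (FL L).
Proof.
move=> Lf; split.
  by rewrite /FL -[RHS](@E1 _ _ V a V0 L Lf); apply: eq_E => // s _; rewrite /ind /= eqxx.
move=> w; split.
  have -> : 0 = E L (fun s => 0 * (fun=> 1) s) by rewrite EZ// mul0r.
  by apply: le_E => // s _; rewrite mul0r /ind ler0n.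
rewrite /FL -ED//; apply: eq_E => // s _; rewrite /ind /= !eqseq_cons.
by case: (sbit s (size w)); rewrite ?add0r ?addr0.
Qed.

Lemma FL_cvg (L : nat -> set Zd) w : exhausting L -> FL (L n) w @[n --> \oo] --> FI w.
Proof.
apply: Einf_cvg; first exact: (finite_qsites d (size w)).
  exact: (@ind_bits_local (size w) (fun v => v == w)).
exact: ind_bdd1.
Qed.

Lemma tree_FI : tree FI.
Proof.
have c w := FL_cvg (w := w) exhausting_nball.
have T n := tree_FL (finite_nball (0 : Zd) n).
split.
  have := c [::]; have -> : (fun n => FL (nball 0 n) [::]) = fun=> 1.
    by apply/funext => n; exact: (T n).1.
  by move=> /cvg_lim <-//; exact: lim_cst.
move=> w; split.
  rewrite -(cvg_lim _ (c w))//; apply: limr_ge; first exact: cvgP (c w).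
  by apply: nearW => n; exact: ((T n).2 w).1.
have h : FL (nball 0 n) w @[n --> \oo] --> FI (false :: w) + FI (true :: w).
  have -> : (fun n => FL (nball 0 n) w) =
      (fun n => FL (nball 0 n) (false :: w) + FL (nball 0 n) (true :: w)).
    by apply/funext => n; rewrite -((T n).2 w).2.
  exact: cvgD.
by rewrite -(cvg_lim _ h)//; apply/esym/cvg_lim.
Qed.

Lemma FL_sum L n (Q : seq bool -> bool) : finite_set L ->
  \sum_(w : n.-tuple bool | Q w) FL L w = E L (ind (fun s => Q (bits s n))).
Proof.
move=> Lf; rewrite -E_sum//; apply: eq_E => // s _.
pose w0 : n.-tuple bool := Tuple (introT eqP (size_bits s n)).
rewrite /ind; case: (boolP (Q (bits s n))) => Qs.
  rewrite (bigD1 w0)//= size_bits eqxx big1 ?addr0// => w /andP[_ ne].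
  rewrite size_tuple; case: eqP => // e; case/negP: ne.
  by apply/eqP/val_inj; rewrite /= -e.
rewrite big1// => w Qw; rewrite size_tuple; case: eqP => // e.
by move: Qs; rewrite e Qw.
Qed.

(** This and the next lemma prevent mass from escaping in the limit of the bits. The image of [x]
    lies on the cycle of [x], so if it is outside the ball, that cycle leaves the ball. *)
Lemma row_tail x e : 0 < e -> exists M, forall L, finite_set L -> L x ->
  E L (ind (fun s => s x \notin nball 0 M)) <= e.
Proof.
move=> e0; have [m Hm] := tail_ex Hbeta e0; have [r xr] := finite_sub_nball (finite_set1 x).
have mM : nball x m `<=` nball 0 (m + r)%N by apply/nball_sub/xr.
have xM : nball 0 (m + r)%N x by apply/mM/nballxx.
exists (m + r)%N => L Lf Lx; apply: le_trans (bad1_le V0 Hm mM Lf Lx).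
apply: le_E => // s Ls; rewrite /ind /isin.
case: (boolP (s x \in nball 0 (m + r)%N)) => /= sx; first by case: ifP.
move: sx; rewrite notin_setE => sx.
rewrite ifT// inE => h; apply: (sx); apply: h.
have osx : orb s [set x] (s x) by exists x, 1%N.
by rewrite /supp /= restr_in// => /(SL_inj Ls) e1; apply: sx; rewrite e1.
Qed.

(** The preimage of [y] also lies on the cycle of [y], so the same bound on cycles applies. *)
Lemma col_tail y e : 0 < e -> exists M, forall L, finite_set L -> L y ->
  E L (ind (fun s => `[< forall x, nball 0 M x -> s x <> y >])) <= e.
Proof.
move=> e0; have [m Hm] := tail_ex Hbeta e0; have [r yr] := finite_sub_nball (finite_set1 y).
have mM : nball y m `<=` nball 0 (m + r)%N by apply/nball_sub/yr.
have yM : nball 0 (m + r)%N y by apply/mM/nballxx.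
exists (m + r)%N => L Lf Ly; apply: le_trans (bad1_le V0 Hm mM Lf Ly).
apply: le_E => // s Ls; rewrite /ind /isin.
case: asboolP => /= sy; last by case: ifP.
rewrite ifT// inE => h; have [x sx] := bij_surj y (SL_bij Ls).
have ox : orb s [set y] x by apply/(orb_stableE _ _ Lf Ls); rewrite sx; exact: orb_sub.
apply: (sy x) => //; apply: h; rewrite /supp /= restr_in// sx => e1.
by apply: (sy x) => //; rewrite -e1.
Qed.

End Limit.

(** * The coupling: decoding a permutation from the uniform variable *)

Section Coupling.
Variables (R : realType) (d : nat) (V : Zd d -> R) (a : R).
Hypothesis d0 : (0 < d)%N.
Hypothesis V0 : V 0 = 0.
Hypothesis Hbeta : (beta V a < 1%:E)%E.
Local Notation Zd := (Zd d).
Local Notation Perm := (Perm d).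
Implicit Types (s t g p : Perm) (L D A : set Zd) (f h : Perm -> R) (x y : Zd) (u : R).
Local Notation E L f := (Gexp V a L id f).
Local Notation FI := (FI V a).
Local Notation FL := (FL V a).

Lemma infinite_Zd : infinite_set [set: Zd].
Proof.
move=> /finite_sub_nball[n Hn].
have := Hn (const_mx n.+1%:Z) I; rewrite /nball /= subr0 => /nrm_le/(_ (Ordinal d0)).
by rewrite mxE absz_nat ltnn.
Qed.

Definition cfl L : seq bool -> R := if pselect (finite_set L) then FL L else FI.

Lemma cflF L : finite_set L -> cfl L = FL L.
Proof. by rewrite /cfl; case: pselect. Qed.

Lemma cflT : cfl setT = FI.
Proof. by rewrite /cfl; case: pselect => // h; case: (infinite_Zd h). Qed.

Lemma tree_cfl L : tree (cfl L).
Proof. rewrite /cfl; case: pselect => h; [exact: tree_FL|exact: tree_FI]. Qed.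

Lemma FL_gt0 L w : finite_set L -> 0 < FL L w ->
  exists2 s, SL L id s & bits s (size w) = w.
Proof.
move=> Lf; rewrite /FL => h; apply: contrapT => /forall2NP H; move: h.
have -> : E L (ind R (fun s => bits s (size w) == w)) = E L (fun s => 0 * (fun=> 1) s).
  apply: eq_E => // s Ls; rewrite mul0r /ind; case: eqP => // e.
  by case: (H s).
by rewrite EZ// mul0r ltxx.
Qed.

(** A word of positive limit mass has positive mass in some box, where it is read off an actual
    permutation. In this way properties visible in finitely many bits reach the infinite volume. *)
Lemma FI_gt0 w : 0 < FI w -> exists2 s : Perm, bijective s & bits s (size w) = w.
Proof.
move=> F0; have [N _ /(_ N)/=] := cvgr_gt _ (FL_cvg V0 Hbeta (w := w) (exhausting_nball d)) _ F0.
rewrite leqnn => /(_ isT) /(FL_gt0 (finite_nball _ _))[s Ls e].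
by exists s => //; exact: SL_bij Ls.
Qed.

Definition follows L u s := SL L id s /\ forall n, tpath (cfl L) u n = bits s n.

(** There are finitely many candidates; if all failed, they would all fail at one common level [N],
    although the prefix of length [N] has positive mass and so comes from one of them. *)
Lemma follows_finite L u : finite_set L -> 0 <= u < 1 -> exists s, follows L u s.
Proof.
move=> Lf u01; apply: contrapT => /forallNP H.
have [N HN] : exists N, forall s, SL L id s -> tpath (cfl L) u N <> bits s N.
  apply: finite_fset_bound => [|s Ls|s n m nm h e]; first exact: finite_SL_id.
    apply: contrapT => /forallNP h; apply: (H s); split=> // n.
    by apply: contrapT; exact: h.
  exact/h/(path_bits_le nm e).
have := tpath_gt0 N (tree_cfl L) u01; rewrite {1}cflF// => /(FL_gt0 Lf)[s Ls].
by rewrite size_tpath => e; apply: (HN s Ls).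
Qed.

Definition bad_row x : set R :=
  [set u | 0 <= u < 1 /\ forall y, bit FI u (qidx x y) = false].
Definition bad_col y : set R :=
  [set u | 0 <= u < 1 /\ forall x, bit FI u (qidx x y) = false].
(* Off this null set the bits read from [u] depend continuously on the tree and, in infinite volume, describe a
   permutation: no row or column of answers is entirely negative. *)
Definition bad : set R := ~` `[0, 1[%classic `|` (\bigcup_w [set lft FI w])
  `|` (\bigcup_x bad_row x) `|` (\bigcup_y bad_col y).

Lemma nbad_u01 u : ~ bad u -> 0 <= u < 1.
Proof.
move=> nb; apply: contrapT => h; apply: nb; left; left; left.
by rewrite /setC /= in_itv.
Qed.

(** Every row and every column contains a positive answer. Any two answers are shared with some
    bijection that has the same initial bits, so answers never conflict and the map they define is
    injective. *)
Lemma follows_T u : ~ bad u -> exists s, follows setT u s.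
Proof.
move=> nb; have u01 := nbad_u01 nb.
have ex n : exists2 s : Perm, bijective s & forall k, (k < n)%N -> bit FI u k = sbit s k.
  have [s sb] := FI_gt0 (tpath_gt0 n (tree_FI V0 Hbeta) u01).
  rewrite size_tpath => e; exists s => //.
  exact/path_bitsP.
have row x : exists y, bit FI u (qidx x y) = true.
  apply: contrapT => /forallNP h; apply: nb; left; right; exists x => //; split=> // y.
  by apply/negbTE/negP; exact: h.
have col y : exists x, bit FI u (qidx x y) = true.
  apply: contrapT => /forallNP h; apply: nb; right; exists y => //; split=> // x.
  by apply/negbTE/negP; exact: h.
have two x y x' y' : bit FI u (qidx x y) = true -> bit FI u (qidx x' y') = true ->
    x = x' <-> y = y'.
  have [s sb hs] := ex (maxn (qidx x y).+1 (qidx x' y').+1).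
  rewrite !hs ?leq_max ?ltnSn ?orbT// !sbit_qidx => /eqP <- /eqP <-.
  by split=> [->|/(bij_inj sb)].
have [s Hs] := choice row.
have sb : bijective s.
  apply: bijP => [x x' e|y]; first exact: ((two _ _ _ _ (Hs x) (Hs x')).2 e).
  have [x hx] := col y; exists x; exact: ((two _ _ _ _ (Hs x) hx).1 erefl).
exists s; split; first by split=> // z /(_ I).
move=> n; rewrite cflT; apply/path_bitsP => k _.
have [t tb ht] := ex (maxn k.+1 (qidx (query d k).1 (s (query d k).1)).+1).
have e1 := ht (qidx (query d k).1 (s (query d k).1)).
rewrite Hs leq_max ltnSn orbT sbit_qidx in e1; have /esym/eqP e2 := e1 isT.
by rewrite ht ?leq_max ?ltnSn// /sbit e2.
Qed.

(* The value [id] on the null set makes all the convergences below hold surely. *)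
Definition zeta L u : Perm :=
  if pselect (~ bad u) then xget (id : Perm) [set s | follows L u s] else id.

Lemma zeta_follows L u : finite_set L \/ L = setT -> ~ bad u -> follows L u (zeta L u).
Proof.
move=> hL nb; rewrite /zeta; case: pselect => [nb'|/(_ nb)//] /=.
have [s hs] : exists s, follows L u s.
  case: hL => [Lf|->]; last exact: follows_T.
  exact: follows_finite (nbad_u01 nb).
by case: xgetP => [t -> //|/(_ s)].
Qed.

Lemma zeta_bad L u : bad u -> zeta L u = id.
Proof. by rewrite /zeta; case: pselect. Qed.

Lemma zeta_SL L u : finite_set L \/ L = setT -> SL L id (zeta L u).
Proof.
move=> hL; have [b|nb] := pselect (bad u); last exact: (zeta_follows hL nb).1.
by rewrite zeta_bad//; exact: SL_id.
Qed.

Lemma zeta_cvg (L : nat -> set Zd) u x : exhausting L ->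
  exists N, forall n, (N <= n)%N -> zeta (L n) u x = zeta setT u x.
Proof.
move=> Lex; have [b|nb] := pselect (bad u); first by exists 0%N => n _; rewrite !zeta_bad.
have Lf n : finite_set (L n) by case: Lex.
have u01 := nbad_u01 nb.
(* A single bit decides: once the answer to the question whether [x] goes to its limit value [y] is
   positive in volume [L n], the values at [x] coincide. *)
set y := zeta setT u x; have [k kE] : exists k, k = qidx x y by exists (qidx x y).
have [N HN] : exists N, forall n, (N <= n)%N -> tpath (cfl (L n)) u k.+1 = tpath (cfl setT) u k.+1.
  apply: tpath_cvg => //.
  - by move=> n; exact: tree_cfl.
  - exact: tree_cfl.
  - move=> w; rewrite cflT; have -> : (fun n => cfl (L n) w) = (fun n => FL (L n) w).
      by apply/funext => n; rewrite cflF.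
    exact: FL_cvg.
  - move=> w e; apply: nb; do 2!left; right; exists w => //.
    by rewrite e cflT.
have [_ fT] := @zeta_follows setT u (or_intror (erefl _)) nb.
exists N => n /HN; have [_ fn] := @zeta_follows (L n) u (or_introl (Lf n)) nb.
move=> h; have := bits_sbit (etrans (esym (fn k.+1)) (etrans h (fT k.+1))).
rewrite kE /y; move: (zeta (L n) u) (zeta setT u) => s t.
by rewrite !sbit_qidx eqxx => /eqP.
Qed.

Lemma U01_null (A : set R) : measurable A -> (forall e, 0 < e -> (U01 R A <= e%:E)%E) ->
  U01 R A = 0%E.
Proof.
move=> mA h; apply/eqP; rewrite eq_le measure_ge0 andbT.
by apply/lee_addgt0Pr => e e0; rewrite add0e h.
Qed.

Lemma measurable_bit F k (b : bool) : tree F ->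
  measurable ([set u : R | 0 <= u < 1 /\ bit F u k = b] : set (measurableTypeR R)).
Proof.
move=> FT; have -> : [set u : R | 0 <= u < 1 /\ bit F u k = b] =
    prefix_set F k.+1 (fun w => head (~~ b) w == b).
  apply/seteqP; split=> u [u01 h]; split=> //; last exact: (eqP h).
  by rewrite /= -/(bit F u k) h eqxx.
exact: measurable_prefix_set.
Qed.

Lemma bigcup_pickle (T : Type) (I : countType) (F : I -> set T) :
  \bigcup_i F i = \bigcup_k (if choice.unpickle k is Some i then F i else set0).
Proof.
apply/seteqP; split=> t [i _ Fi].
  by exists (choice.pickle i) => //; rewrite choice.pickleK.
by move: Fi; case: (choice.unpickle i) => // j Fj; exists j.
Qed.

Lemma bigcup_count_measurable (I : countType) (F : I -> set (measurableTypeR R)) :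
  (forall i, measurable (F i)) -> measurable (\bigcup_i F i).
Proof.
move=> mF; rewrite bigcup_pickle; apply: bigcup_measurable => k _.
by case: (choice.unpickle k) => [i|]; [exact: mF|exact: measurable0].
Qed.

Lemma bigcap_count_measurable (I : countType) (F : I -> set (measurableTypeR R)) :
  (forall i, measurable (F i)) -> measurable (\bigcap_i F i).
Proof.
move=> mF; rewrite -[X in measurable X]setCK setC_bigcap; apply: measurableC.
by apply: bigcup_count_measurable => i; exact: measurableC.
Qed.

Lemma U01_negP (A : set (measurableTypeR R)) : measurable A ->
  (U01 R).-negligible A <-> U01 R A = 0%E.
Proof. by move=> mA; exact: negligibleP. Qed.

Lemma bigcup_count_null (I : countType) (F : I -> set (measurableTypeR R)) :
  (forall i, measurable (F i)) -> (forall i, U01 R (F i) = 0%E) -> U01 R (\bigcup_i F i) = 0%E.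
Proof.
move=> mF F0; apply/(U01_negP (bigcup_count_measurable mF)).
rewrite bigcup_pickle; apply: negligible_bigcup => k.
case: (choice.unpickle k) => [i|]; last exact: negligible_set0.
exact/(U01_negP (mF i)).
Qed.

Lemma measurable_bits_false (I : countType) (i0 : I) (idx : I -> nat) :
  measurable ([set u : R | 0 <= u < 1 /\ forall z, bit FI u (idx z) = false] : set (measurableTypeR R)).
Proof.
have -> : [set u : R | 0 <= u < 1 /\ forall z, bit FI u (idx z) = false] =
   \bigcap_z [set u | 0 <= u < 1 /\ bit FI u (idx z) = false].
  apply/seteqP; split=> [u [u01 h] z _|u h]; first by split.
  by split=> [|z]; [have [] := h i0 Logic.I | have [] := h z Logic.I].
by apply: bigcap_count_measurable => z; apply: measurable_bit; exact: tree_FI.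
Qed.

(** The event [B] concerns infinitely many bits; it is enlarged to the event that the first [n] bits
    look like those of a point of [B]. The measure of the latter is a finite sum of limit masses,
    hence a limit of probabilities in boxes. *)
Lemma null_bits_false (B : set R) :
  measurable (B : set (measurableTypeR R)) -> (forall u, B u -> 0 <= u < 1) ->
  (forall e, 0 < e -> exists n N, forall k, (N <= k)%N ->
    E (nball 0 k) (ind R (fun s => `[< exists2 u, B u & tpath FI u n = bits s n >])) <= e) ->
  U01 R B = 0%E.
Proof.
move=> mB B01 H; apply: U01_null => // e e0.
have [n [N HN]] := H e e0.
pose q (w : seq bool) := `[< exists2 u, B u & tpath FI u n = w >].
have FT := tree_FI V0 Hbeta.
apply: (@le_trans _ _ (U01 R (prefix_set FI n q))).
  apply: le_measure; rewrite ?inE//; first exact: measurable_prefix_set.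
  by move=> u Bu; split; [exact: B01|apply/asboolP; exists u].
rewrite U01_prefix_set// lee_fin.
have c : \sum_(w : n.-tuple bool | q w) FL (nball 0 k) w @[k --> \oo] -->
    \sum_(w : n.-tuple bool | q w) FI w.
  apply: cvg_big; first exact: add_continuous.
  by move=> w _; apply: FL_cvg => //; exact: exhausting_nball.
rewrite -(cvg_lim _ c)//; apply: limr_le; first exact: cvgP c.
exists N => // k /= Nk; rewrite FL_sum//; last exact: finite_nball.
exact: HN.
Qed.

Lemma qidx_bound (I : choiceType) (F : set I) (idx : I -> nat) : finite_set F ->
  exists n, forall z, F z -> (idx z < n)%N.
Proof.
move=> Ff; apply: finite_fset_bound => // [z _|z n m nm zn]; first by exists (idx z).+1.
exact: leq_trans zn nm.
Qed.

Lemma null_bad_row x : U01 R (bad_row x) = 0%E.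
Proof.
apply: null_bits_false.
- exact: (measurable_bits_false (0 : Zd)).
- by move=> u [].
- move=> e e0; have [M HM] := row_tail V0 Hbeta x e0.
  (* [n] is large enough for the first [n] questions to include all those about [x] and a target in
     the ball; if all are answered negatively, the image of [x] is outside the ball. *)
  have [n Hn] := qidx_bound (qidx x) (finite_nball 0 M).
  exists n, (nrm x) => k xk; apply: le_trans (HM (nball 0 k) (finite_nball _ _) _); last first.
    by rewrite /nball /= subr0.
  apply: le_E => //; first exact: finite_nball.
  move=> s Ls; rewrite /ind; case: asboolP => [[u [u01 Bu]]|_]; last exact: ler0n.
  move=> /path_bitsP pb; rewrite (_ : _ \notin _)//.
  rewrite notin_setE => /Hn /pb; rewrite Bu sbit_qidx eqxx//.
Qed.

Lemma null_bad_col y : U01 R (bad_col y) = 0%E.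
Proof.
apply: null_bits_false.
- exact: (measurable_bits_false (0 : Zd) (fun x => qidx x y)).
- by move=> u [].
- move=> e e0; have [M HM] := col_tail V0 Hbeta y e0.
  have [n Hn] := qidx_bound (fun x => qidx x y) (finite_nball 0 M).
  exists n, (nrm y) => k yk; apply: le_trans (HM (nball 0 k) (finite_nball _ _) _); last first.
    by rewrite /nball /= subr0.
  apply: le_E => //; first exact: finite_nball.
  move=> s Ls; rewrite /ind; case: asboolP => [[u [u01 Bu]]|_]; last exact: ler0n.
  move=> /path_bitsP pb; rewrite (_ : `[< _ >])//.
  by apply/asboolP => x /Hn /pb; rewrite Bu sbit_qidx => /esym/eqP.
Qed.

Lemma measurable_bad : measurable (bad : set (measurableTypeR R)).
Proof.
rewrite /bad; apply: measurableU; last first.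
  by apply: bigcup_count_measurable => y; exact: (measurable_bits_false (0 : Zd) (fun x => qidx x y)).
apply: measurableU; last first.
  by apply: bigcup_count_measurable => x; exact: (measurable_bits_false (0 : Zd)).
apply: measurableU; last by apply: bigcup_count_measurable => w; exact: measurable_set1.
by apply: measurableC; exact: measurable_itv.
Qed.

Lemma null_bad : U01 R bad = 0%E.
Proof.
have mr : measurable (\bigcup_x bad_row x : set (measurableTypeR R)).
  by apply: bigcup_count_measurable => x; exact: (measurable_bits_false (0 : Zd)).
have mc : measurable (\bigcup_y bad_col y : set (measurableTypeR R)).
  by apply: bigcup_count_measurable => y; exact: (measurable_bits_false (0 : Zd) (fun x => qidx x y)).
have ml : measurable (\bigcup_w [set lft FI w] : set (measurableTypeR R)).
  by apply: bigcup_count_measurable => w; exact: measurable_set1.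
have mi : measurable (~` `[0, 1[%classic : set (measurableTypeR R)).
  by apply: measurableC; exact: measurable_itv.
have i0 : U01 R (~` `[0, 1[%classic) = 0%E.
  rewrite probability_setC; last exact: measurable_itv.
  by rewrite U01_itv// subr0 subee.
rewrite /bad null_set_setU//; first by apply: measurableU => //; exact: measurableU.
  rewrite null_set_setU//; first exact: measurableU.
    rewrite null_set_setU//.
    apply: bigcup_count_null => w; first exact: measurable_set1.
    have /null_content_dominatesP := dominates_uniform_prob (@ltr01 R); apply.
      exact: measurable_set1.
    exact: lebesgue_measure_set1.
  apply: bigcup_count_null => x; last exact: null_bad_row.
  exact: (measurable_bits_false (0 : Zd)).
apply: bigcup_count_null => y; last exact: null_bad_col.
exact: (measurable_bits_false (0 : Zd) (fun x => qidx x y)).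
Qed.

Lemma zeta_bit L u x y : finite_set L \/ L = setT -> ~ bad u ->
  zeta L u x = y <-> bit (cfl L) u (qidx x y) = true.
Proof.
move=> hL nb; have [_ fl] := zeta_follows hL nb.
have /path_bitsP/(_ _ (ltnSn _)) -> := fl (qidx x y).+1.
by rewrite sbit_qidx; split=> /eqP.
Qed.

Lemma zeta_rand_map L : finite_set L \/ L = setT ->
  rand_map (zeta L : measurableTypeR R -> Perm).
Proof.
move=> hL x y.
have -> : [set w | zeta L w x = y] =
   (~` bad `&` [set u : R | 0 <= u < 1 /\ bit (cfl L) u (qidx x y) = true]) `|`
   (bad `&` (if x == y then setT else set0)).
  apply/seteqP; split=> u /=.
    have [b|nb] := pselect (bad u).
      by rewrite zeta_bad// => xy; right; split=> //; rewrite xy eqxx.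
    by move=> /(zeta_bit x y hL nb) h; left; split=> //; split=> //; exact: nbad_u01.
  move=> [[nb [_ h]]|[b]]; first exact/(zeta_bit x y hL nb).
  by case: eqP => // xy _; rewrite zeta_bad.
apply: measurableU; apply: measurableI.
- by apply: measurableC; exact: measurable_bad.
- apply: measurable_bit; exact: tree_cfl.
- exact: measurable_bad.
- by case: ifP.
Qed.

(** Finitely many bits separate [s] from the other elements of the finite set [SL L id]; off the
    null set, the event is then a prefix event, whose measure is known. *)
Lemma zeta_law L s : finite_set L ->
  U01 R (zeta L @^-1` [set s]) = (Gpt V a L id s)%:E.
Proof.
move=> Lf; have hL : finite_set L \/ L = setT by left.
have [Ls|nLs] := pselect (SL L id s); last first.
  have -> : zeta L @^-1` [set s] = set0.
    by apply/seteqP; split=> u //= e; apply: nLs; rewrite -e; exact: zeta_SL.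
  rewrite measure0; congr (_%:E); apply/esym.
  rewrite /Gpt /Gprob /Gexp fsbig1// => t Lt; rewrite indicE memNset ?mulr0//= => e.
  by apply: nLs; rewrite -e.
have [n Hn] : exists n, forall t, (SL L id `\ s) t -> bits t n <> bits s n.
  apply: finite_fset_bound => [|t [Lt ts]|t n m nm h].
  - exact/finite_setD/finite_SL_id.
  - by apply: contrapT => /forallNP h; apply: ts; apply: bits_inj => n; apply: contrapT; exact: h.
  - by move=> e; apply: h; move: e; rewrite -(subnK nm); elim: (m - n)%N => //= k IH [_ /IH].
have inj t : SL L id t -> bits t n = bits s n -> t = s.
  by move=> Lt e; apply: contrapT => ts; apply: (Hn t).
have FT := tree_cfl L.
have mpre := measurable_prefix_set n (fun w => w == bits s n) FT.
have e : zeta L @^-1` [set s] `&` ~` bad = prefix_set (cfl L) n (fun w => w == bits s n) `&` ~` bad.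
  apply/seteqP; split=> u /= [h nb]; split=> //; have [zL fl] := zeta_follows hL nb.
    by split; [exact: nbad_u01|rewrite fl h].
  by case: h => _; rewrite fl => /eqP; exact: inj.
have mz : measurable (zeta L @^-1` [set s] : set (measurableTypeR R)).
  have -> : zeta L @^-1` [set s] = \bigcap_x [set w | zeta L w x = s x].
    apply/seteqP; split=> u /=; first by move=> eu x _ /=; rewrite eu.
    by move=> h; apply/funext => x; exact: h.
  by apply: bigcap_count_measurable => x; exact: zeta_rand_map.
have drop (A : set (measurableTypeR R)) : measurable A -> U01 R A = U01 R (A `&` ~` bad).
  move=> mA; rewrite (measureDI _ mA measurable_bad) -setDE -[RHS]adde0; congr (_ + _)%E.
  apply/eqP; rewrite eq_le measure_ge0 andbT -null_bad; apply: le_measure; rewrite ?inE//.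
  - by apply: measurableI => //; exact: measurable_bad.
  - exact: measurable_bad.
rewrite drop// e -drop// (U01_prefix_set n _ FT) cflF// (@FL_sum _ _ V a V0 L n (fun w => w == bits s n) Lf); congr (_%:E).
rewrite /Gpt /Gprob; apply: eq_E => // t Lt; rewrite /ind indicE; congr (_%:R).
apply: congr1; apply/eqP/idP; last by rewrite inE => ->.
by move=> /(inj _ Lt) ->; rewrite inE.
Qed.

End Coupling.

(** * Cylinder events and the infinite-volume law *)

Section Cyl.
Variables (d : nat).
Local Notation Zd := (Zd d).
Local Notation Perm := (Perm d).
Implicit Types (s t : Perm) (F D : set Zd) (A B C : set Perm).

(** Quantified over all maps and not only bijections, because [cyl_sigma] is a sigma-algebra on all
    of [Perm]. *)
Definition levent F C := forall s t, (forall x, F x -> s x = t x) -> C s -> C t.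

Lemma cyl_sigma_sigma D : sigma_algebra setT (@cyl_sigma d D).
Proof. exact: smallest_sigma_algebra. Qed.

Lemma cyl_sub D D' : D `<=` D' -> @cyl_sigma d D `<=` cyl_sigma D'.
Proof.
move=> DD; apply: sub_smallest2r; first exact: smallest_sigma_algebra.
by move=> _ [x [y [Dx ->]]]; exists x, y; split => //; exact: DD.
Qed.

Lemma cyl_setT D : @cyl_sigma d D setT.
Proof. by have [h0 hC _] := cyl_sigma_sigma D; rewrite -(setD0 setT); exact: hC. Qed.

Lemma cyl_set0 D : @cyl_sigma d D set0.
Proof. by have [h0 _ _] := cyl_sigma_sigma D. Qed.

Lemma cyl_setC D C : cyl_sigma D C -> cyl_sigma D (~` C).
Proof. by have [_ hC _] := cyl_sigma_sigma D; rewrite -setTD; exact: hC. Qed.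

Lemma cyl_bigcup D (G : (set Perm)^nat) : (forall n, cyl_sigma D (G n)) ->
  cyl_sigma D (\bigcup_n G n).
Proof. by have [_ _ hU] := cyl_sigma_sigma D; exact: hU. Qed.

Lemma cyl_setU D A B : cyl_sigma D A -> cyl_sigma D B -> cyl_sigma D (A `|` B).
Proof.
move=> hA hB; rewrite -bigcup2E; apply: cyl_bigcup => -[|[|n]] //=.
exact: cyl_set0.
Qed.

Lemma cyl_setI D A B : cyl_sigma D A -> cyl_sigma D B -> cyl_sigma D (A `&` B).
Proof.
move=> hA hB; rewrite -(setCK (A `&` B)) setCI.
exact: (cyl_setC (cyl_setU (cyl_setC hA) (cyl_setC hB))).
Qed.

Lemma cyl_setD D A B : cyl_sigma D A -> cyl_sigma D B -> cyl_sigma D (A `\` B).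
Proof. by move=> hA hB; rewrite setDE; apply: cyl_setI => //; exact: cyl_setC. Qed.

(** Induction on events by the pi-lambda theorem, the pi-system being the measurable events that
    depend on finitely many sites. *)
Lemma cyl_ind D (Q : set (set Perm)) : Q setT ->
  (forall A B, cyl_sigma D A -> cyl_sigma D B -> B `<=` A -> Q A -> Q B -> Q (A `\` B)) ->
  (forall G : (set Perm)^nat, (forall n, cyl_sigma D (G n)) -> nondecreasing_seq G ->
    (forall n, Q (G n)) -> Q (\bigcup_n G n)) ->
  (forall F C, finite_set F -> F `<=` D -> cyl_sigma D C -> levent F C -> Q C) ->
  forall C, cyl_sigma D C -> Q C.
Proof.
move=> QT QD QU Ql.
pose Gl := [set C | cyl_sigma D C /\ exists F, [/\ finite_set F, F `<=` D & levent F C]].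
have GlI : setI_closed Gl.
  move=> A B [sA [F [Ff FD FA]]] [sB [F' [Ff' FD' FB]]]; split; first exact: cyl_setI.
  exists (F `|` F'); split; first by rewrite finite_setU.
    by move=> x [/FD|/FD'].
  move=> s t st [As Bs]; split.
    by apply: FA As => x Fx; apply: st; left.
  by apply: FB Bs => x Fx; apply: st; right.
have cG : cylinders D `<=` Gl.
  move=> C [x [y [Dx eC]]]; split; first by apply: sub_gen_smallest; exists x, y.
  exists [set x]; split; [exact: finite_set1|by move=> z ->|].
  by rewrite eC => s t st /= <-; apply/esym/st.
have cS : cyl_sigma D `<=` <<s Gl >>.
  by apply: sub_smallest2r => //; exact: smallest_sigma_algebra.
pose Q' := [set C | cyl_sigma D C /\ Q C].
have dQ : dynkin Q'.
  apply/dynkin_lambda_system; split=> //.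
  - by split; [exact: cyl_setT|].
  - by move=> A B BA [sA QA] [sB QB]; split; [exact: cyl_setD|exact: QD].
  - move=> G Gnd GQ; split; first by apply: cyl_bigcup => n; case: (GQ n).
    by apply: QU => // n; case: (GQ n).
move=> C /cS; rewrite -setI_closed_g_dynkin_g_sigma_algebra//.
have : <<d Gl >> `<=` Q'.
  apply: smallest_sub => // A [sA [F [Ff FD FA]]]; split=> //.
  exact: Ql FA.
by move=> h /h [].
Qed.

Lemma cyl_insens D B : cyl_sigma D B -> forall s t, (forall x, D x -> s x = t x) -> B s <-> B t.
Proof.
move: B; apply: cyl_ind => [s t st|A B _ _ _ IA IB s t st|G _ _ IG s t st|F C _ FD _ FC s t st].
- by [].
- have [h1 h2] := IA _ _ st; have [h3 h4] := IB _ _ st.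
  by split=> -[hA hB]; split; [exact: h1|move=> /h4|exact: h2|move=> /h3].
- by split=> -[n _ Gn]; exists n => //; have [h1 h2] := IG n _ _ st; [exact: h1|exact: h2].
- by split; apply: FC => x /FD /st.
Qed.

Lemma cyl_preimage D D' (Phi : Perm -> Perm) :
  (forall x y, D x -> cyl_sigma D' (Phi @^-1` [set s | s x = y])) ->
  forall C, cyl_sigma D C -> cyl_sigma D' (Phi @^-1` C).
Proof.
move=> H; apply: smallest_sub => /=; last by move=> _ [x [y [Dx ->]]]; exact: H.
split=> [|A hA|G hG].
- by rewrite /= preimage_set0; exact: cyl_set0.
- by rewrite /= setTD preimage_setC; exact: cyl_setC.
- by rewrite /= preimage_bigcup; exact: cyl_bigcup.
Qed.

Lemma cylinder_in (D : set Zd) x y : D x -> cyl_sigma D [set s | s x = y].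
Proof. by move=> Dx; apply: sub_gen_smallest; exists x, y. Qed.

Lemma cyl_conjp h h' : cancel h h' -> forall C, cyl_sigma setT C ->
  cyl_sigma setT (conjp h h' @^-1` C).
Proof.
move=> k1; have k2 : injective h := can_inj k1.
apply: cyl_preimage => x y _.
have [[z e]|/forallNP nz] := pselect (exists z, h z = y).
  rewrite (_ : _ @^-1` _ = [set s | s (h' x) = z]); first exact: cylinder_in.
  by apply/seteqP; split=> s; rewrite /conjp /= -e; [move=> /k2|move=> ->].
rewrite (_ : _ @^-1` _ = set0); first exact: cyl_set0.
by apply/seteqP; split=> s //=; rewrite /conjp /= => /nz.
Qed.

Lemma cyl_tau D v C : cyl_sigma D C -> cyl_sigma D ((fun s : Perm => tau v \o s) @^-1` C).
Proof.
move: C; apply: cyl_preimage => x y Dx.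
rewrite (_ : _ @^-1` _ = [set s | s x = y - v]); first exact: cylinder_in.
by apply/seteqP; split=> s; rewrite /tau /=; [move=> <-; rewrite addrK|move=> ->; rewrite subrK].
Qed.

End Cyl.

Section Law.
Variables (R : realType) (d : nat) (V : Zd d -> R) (a : R).
Hypothesis V0 : V 0 = 0.
Local Notation Zd := (Zd d).
Local Notation Perm := (Perm d).
Implicit Types (s t : Perm) (L F D : set Zd) (A B C : set Perm) (f : Perm -> R).
Local Notation E L f := (Gexp V a L id f).
Variables (dT : measure_display) (T : measurableType dT) (P : probability T R).

Section RandMap.
Variable X : T -> Perm.
Hypothesis HX : rand_map X.

Lemma rand_map_pre C : cyl_sigma setT C -> measurable (X @^-1` C).
Proof.
suff : cyl_sigma setT `<=` [set C | measurable (X @^-1` C)] by apply.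
apply: smallest_sub => /=; last by move=> _ [x [y [_ ->]]]; exact: HX.
split=> [|A hA|G hG].
- by rewrite /= preimage_set0; exact: measurable0.
- by rewrite /= setTD preimage_setC; exact: measurableC.
- by rewrite /= preimage_bigcup; apply: bigcup_measurable => n _; exact: hG.
Qed.

Definition pr C : R := fine (P (X @^-1` C)).

Lemma prE C : cyl_sigma setT C -> P (X @^-1` C) = (pr C)%:E.
Proof. by move=> sC; rewrite /pr fineK// fin_num_measure//; exact: rand_map_pre. Qed.

Lemma pr_ge0 C : 0 <= pr C. Proof. exact: fine_ge0. Qed.

Lemma prT : pr setT = 1. Proof. by rewrite /pr preimage_setT probability_setT. Qed.

Lemma prD A B : cyl_sigma setT A -> cyl_sigma setT B -> B `<=` A -> pr (A `\` B) = pr A - pr B.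
Proof.
move=> sA sB BA; have sAB := cyl_setD sA sB; apply: EFin_inj; rewrite EFinB -!prE//.
rewrite setDE preimage_setI preimage_setC -setDE measureD.
- by rewrite setIidr// => w; exact: BA.
- exact: rand_map_pre.
- exact: rand_map_pre.
- by apply: (le_lt_trans (probability_le1 _ _)); [exact: rand_map_pre|exact: ltry].
Qed.

Lemma pr_mono A B : cyl_sigma setT A -> cyl_sigma setT B -> A `<=` B -> pr A <= pr B.
Proof.
move=> sA sB AB; rewrite -lee_fin -!prE//; apply: le_measure; rewrite ?inE//.
- exact: rand_map_pre.
- exact: rand_map_pre.
- by move=> w; exact: AB.
Qed.

Lemma pr_cvg (G : (set Perm)^nat) : (forall n, cyl_sigma setT (G n)) -> nondecreasing_seq G ->
  pr (G n) @[n --> \oo] --> pr (\bigcup_n G n).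
Proof.
move=> sG ndG; have mU : measurable (X @^-1` (\bigcup_n G n)).
  by apply: rand_map_pre; exact: cyl_bigcup.
apply: fine_cvg; rewrite fineK ?fin_num_measure//.
rewrite preimage_bigcup in mU *.
apply: (@nondecreasing_cvg_mu _ _ _ P (fun n => X @^-1` G n)).
- by move=> n; exact: rand_map_pre.
- exact: mU.
- by move=> n m nm; apply/subsetPset => w; have /subsetPset := ndG _ _ nm; exact.
Qed.

End RandMap.

(* Just enough additivity to apply the pi-lambda theorem to real-valued set functions. *)
Definition cmeas (m : set Perm -> R) :=
  (forall A B, cyl_sigma setT A -> cyl_sigma setT B -> B `<=` A -> m (A `\` B) = m A - m B) /\
  (forall G : (set Perm)^nat, (forall n, cyl_sigma setT (G n)) -> nondecreasing_seq G ->
    m (G n) @[n --> \oo] --> m (\bigcup_n G n)).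

Lemma cmeas_pr X : rand_map X -> cmeas (pr X).
Proof. by move=> HX; split=> *; [exact: prD|exact: pr_cvg]. Qed.

Lemma cmeas_eq m1 m2 : cmeas m1 -> cmeas m2 -> m1 setT = m2 setT ->
  (forall F C, finite_set F -> cyl_sigma setT C -> levent F C -> m1 C = m2 C) ->
  forall C, cyl_sigma setT C -> m1 C = m2 C.
Proof.
move=> [D1 U1] [D2 U2] eT el; apply: cyl_ind => //.
- by move=> A B sA sB BA eA eB; rewrite D1// D2// eA eB.
- move=> G sG ndG eG; have c1 := U1 _ sG ndG; have c2 := U2 _ sG ndG.
  rewrite -(cvg_lim _ c1)// -(cvg_lim _ c2)//; congr (lim (_ @ \oo)).
  by apply/funext => n; exact: eG.
- by move=> F C Ff _; exact: el.
Qed.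

Variable zeta : set Zd -> T -> Perm.
Hypothesis Hrm : forall L, finite_set L \/ L = setT -> rand_map (zeta L).
Hypothesis HSL : forall L, finite_set L \/ L = setT -> forall w, SL L id (zeta L w).
Hypothesis Hlaw : forall L, finite_set L -> forall s,
  P (zeta L @^-1` [set s]) = (Gpt V a L id s)%:E.
Hypothesis Hcvg : forall L : nat -> set Zd, exhausting L -> forall w x,
  exists N, forall n, (N <= n)%N -> zeta (L n) w x = zeta setT w x.

Local Notation X := (zeta setT).

Lemma zeta_bij w : bijective (X w).
Proof. by have [] := HSL (or_intror erefl) w. Qed.

Lemma rmX : rand_map X. Proof. by apply: Hrm; right. Qed.

Lemma zetaF_bij L w : finite_set L -> bijective (zeta L w).
Proof. by move=> Lf; have [] := HSL (or_introl Lf) w. Qed.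

Lemma zetaF_decomp L f : finite_set L -> forall w,
  f (zeta L w) = \sum_(s <- fset_set (SL L id)) f s * \1_(zeta L @^-1` [set s]) w.
Proof.
move=> Lf w; have Sf := finite_SL_id Lf.
rewrite -fsbig_finite// (fsbigD1 (zeta L w))//=; last by apply: HSL; left.
rewrite indicE mem_set//= mulr1 fsbig1 ?addr0// => s [_ ns].
by rewrite indicE memNset ?mulr0//= => e; apply: ns.
Qed.

Lemma measurable_zetaF L s : finite_set L -> measurable (zeta L @^-1` [set s]).
Proof.
move=> Lf; have -> : zeta L @^-1` [set s] = \bigcap_x [set w | zeta L w x = s x].
  apply/seteqP; split=> u /=; first by move=> eu x _ /=; rewrite eu.
  by move=> h; apply/funext => x; exact: h.
rewrite -[X in measurable X]setCK setC_bigcap bigcup_pickle; apply: measurableC.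
apply: bigcup_measurable => k _; case: (choice.unpickle k) => [x|]; last exact: measurable0.
by apply: measurableC; apply: Hrm; left.
Qed.

Lemma measurable_fun_zetaF L f : finite_set L -> measurable_fun setT (fun w => f (zeta L w)).
Proof.
move=> Lf; under eq_fun do rewrite zetaF_decomp//.
apply: measurable_sum => s; apply: measurable_funM; first exact: measurable_cst.
by apply: measurable_indic; exact: measurable_zetaF.
Qed.

Lemma Gexp_Gpt L f : finite_set L -> E L f = \sum_(s <- fset_set (SL L id)) f s * Gpt V a L id s.
Proof.
move=> Lf; have Sf := finite_SL_id Lf; rewrite -fsbig_finite//.
apply: eq_fsbigr => s; rewrite inE => Ls; rewrite mulrC; congr (_ * _).
rewrite /Gpt /Gprob /Gexp (fsbigD1 s)//= indicE mem_set//= mulr1 fsbig1 ?addr0//.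
by move=> t [_ ts]; rewrite indicE memNset ?mulr0.
Qed.

Lemma integral_zetaF L f : finite_set L -> (\int[P]_w (f (zeta L w))%:E = (E L f)%:E)%E.
Proof.
move=> Lf; rewrite Gexp_Gpt// -sumEFin.
under eq_integral do rewrite zetaF_decomp// -sumEFin.
have mz s := measurable_zetaF s Lf.
have iz s : P.-integrable setT (fun w => (\1_(zeta L @^-1` [set s]) w)%:E).
  exact: integrable_indic.
rewrite integral_sum//; last first.
  by move=> s; under eq_fun do rewrite EFinM; exact: integrableZl.
apply: eq_bigr => s _; under eq_integral do rewrite EFinM.
rewrite integralZl// integral_indic// setIT EFinM; congr (_ * _)%E; exact: Hlaw.
Qed.

(** At each sample point the permutations eventually agree with the limit on any finite set, so
    continuity gives pointwise convergence and dominated convergence gives the rest. Measurability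
    of [f] along the limit also comes from this: in finite volume only finitely many values
    occur. *)
Lemma exp_cvg f : (exists M, forall s, bijective s -> `|f s| <= M) -> cont_on_S f ->
  measurable_fun setT (fun w => f (X w)) /\
  forall Ls, exhausting Ls -> (E (Ls n) f)%:E @[n --> \oo] --> (\int[P]_w (f (X w))%:E)%E.
Proof.
move=> [M fM] fc.
have pt Ls w : exhausting Ls -> f (zeta (Ls n) w) @[n --> \oo] --> f (X w).
  move=> Lex; have Lf n : finite_set (Ls n) by case: Lex.
  apply/cvgrPdist_lt => e e0; have [F [Ff HF]] := fc _ (zeta_bij w) e e0.
  have [N HN] : exists N, forall x, F x -> forall n, (N <= n)%N -> zeta (Ls n) w x = X w x.
    apply: finite_fset_bound => // [x _|x n m nm h k mk]; first exact: Hcvg.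
    by apply: h; exact: leq_trans mk.
  exists N => // n /= Nn; rewrite distrC; apply: HF; first exact: zetaF_bij.
  by move=> x Fx; exact: HN.
have mX : measurable_fun setT (fun w => f (X w)).
  apply: (@measurable_fun_cvg _ _ _ setT (fun n w => f (zeta (nball 0 n) w))).
    by move=> n; apply: measurable_fun_zetaF; exact: finite_nball.
  by move=> w _; apply: pt; exact: exhausting_nball.
split=> // Ls Lex; have Lf n : finite_set (Ls n) by case: Lex.
under eq_fun do rewrite -integral_zetaF//.
have [] // := @dominated_convergence _ T R P setT measurableT
  (fun n w => (f (zeta (Ls n) w))%:E) (fun w => (f (X w))%:E) (cst M%:E).
- by move=> n; apply/measurable_EFinP; exact: measurable_fun_zetaF.
- exact/measurable_EFinP.
- by apply: aeW => w _; apply/fine_cvgP; split; [exact: nearW|exact: pt].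
- exact: finite_measure_integrable_cst.
- by apply: aeW => w n _; rewrite lee_fin; apply/fM/zetaF_bij.
Qed.

Lemma local_cont F f : finite_set F -> local F f -> cont_on_S f.
Proof.
move=> Ff fF s sb e e0; exists F; split=> // t tb st.
by rewrite (fF t s)// subrr normr0.
Qed.

Lemma levent_local F C : levent F C -> local F (\1_C : Perm -> R).
Proof.
move=> FC s t _ _ st; rewrite !indicE; congr ((_ : bool)%:R); apply/idP/idP; rewrite !inE.
  exact: FC.
by apply: FC => x Fx; rewrite st.
Qed.

Lemma indic_bdd1 C : bdd1 (\1_C : Perm -> R).
Proof. by move=> s _; rewrite indicE; case: (_ \in _); rewrite ?normr1 ?normr0. Qed.

Lemma bdd1_bound f : bdd1 f -> exists M, forall s, bijective s -> `|f s| <= M.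
Proof. by exists 1. Qed.

Lemma pr_int C : cyl_sigma setT C -> (\int[P]_w (\1_C (X w))%:E = (pr X C)%:E)%E.
Proof.
move=> sC; transitivity (\int[P]_w (\1_(X @^-1` C) w)%:E)%E; first by [].
have mC := rand_map_pre rmX sC.
by rewrite integral_indic// setIT; apply: prE => //; exact: rmX.
Qed.

Lemma pr_lim F C Ls : finite_set F -> cyl_sigma setT C -> levent F C -> exhausting Ls ->
  E (Ls n) (\1_C) @[n --> \oo] --> pr X C.
Proof.
move=> Ff sC lC Lex.
have [_ /(_ _ Lex)] := exp_cvg (bdd1_bound (indic_bdd1 C)) (local_cont Ff (levent_local lC)).
by rewrite pr_int// => /fine_cvgP[].
Qed.

End Law.

(** * DLR equations, invariance and mixing *)

Section FiniteDLR.
Variables (R : realType) (d : nat) (V : Zd d -> R) (a : R).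
Local Notation Zd := (Zd d).
Local Notation Perm := (Perm d).
Implicit Types (s t : Perm) (L F D : set Zd) (A B C : set Perm) (f : Perm -> R) (xi : Perm).
Local Notation E L f := (Gexp V a L id f).

Lemma gweight_gt0 D s : 0 < gweight V a D s. Proof. exact: expR_gt0. Qed.

Lemma Zpart_gt0 D xi : finite_set D -> bijective xi -> 0 < Zpart V a D xi.
Proof.
move=> Df xb; have Sf := finite_SL xi Df.
rewrite /Zpart (fsbigD1 xi)//=.
rewrite ltr_pwDl ?gweight_gt0//; apply: fsumr_ge0 => s _; exact/ltW/gweight_gt0.
Qed.

Lemma Zpart_SL D xi s : SL D xi s -> Zpart V a D s = Zpart V a D xi.
Proof. by move=> Ds; rewrite /Zpart (SL_trans Ds). Qed.

(** Detailed balance for resampling inside [D]: the energies of [s] and [t] over the part of [L]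
    outside [D] coincide. *)
Lemma gweight_swap L D s t : finite_set L -> D `<=` L -> SL D s t ->
  gweight V a L s * gweight V a D t = gweight V a L t * gweight V a D s.
Proof.
move=> Lf DL Dt; rewrite /gweight -!expRD -!opprD -!mulrDr; congr (expR (- (a * _))).
rewrite /Ham !(@fsbigID _ _ _ _ D L)//= (setIidr DL).
have -> : \sum_(x \in L `&` ~` D) V (t x - x) = \sum_(x \in L `&` ~` D) V (s x - x).
  by apply: eq_fsbigr => x; rewrite inE => -[_ nD]; rewrite Dt.2.
lra.
Qed.

(** Resampling in [D] is a kernel reversible for the measure in [L], hence preserves it; the
    relation [t \in SL D s] is symmetric and both normalizing constants agree. *)
Lemma Gexp_DLR L D f : finite_set L -> D `<=` L ->
  E L (fun s => Gexp V a D s f) = E L f.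
Proof.
move=> Lf DL; have Df : finite_set D := sub_finite_set DL Lf.
have Sf := finite_SL_id Lf.
have sub s : SL L id s -> SL D s `<=` SL L id.
  by move=> Ls; rewrite -(SL_trans Ls); exact: SL_mono.
pose Z := Zpart V a L id.
transitivity (\sum_(s \in SL L id) \sum_(t \in SL L id)
    (if t \in SL D s then gweight V a L t * gweight V a D s / (Z * Zpart V a D t) * f t else 0)).
  rewrite /Gexp; apply: eq_fsbigr => s; rewrite inE => Ls.
  rewrite fsumr_cond// (setIidr (sub _ Ls)) mulr_fsumr; apply: eq_fsbigr => t; rewrite inE => Dt.
  rewrite -(gweight_swap Lf DL Dt) (Zpart_SL Dt) mulrA; congr (_ * _).
  by rewrite invfM mulrACA.
rewrite exchange_fsbig// /Gexp; apply: eq_fsbigr => t; rewrite inE => Lt.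
have tb := SL_bij Lt.
transitivity (\sum_(s \in SL D t) gweight V a D s * (gweight V a L t / (Z * Zpart V a D t) * f t)).
  rewrite -[in RHS](setIidr (sub _ Lt)) -(fsumr_cond (SL D t) _ Sf).
  apply: eq_fsbigr => s; rewrite inE => Ls.
  have -> : (s \in SL D t) = (t \in SL D s).
    by apply/idP/idP; rewrite !inE; apply: SL_sym => //; exact: SL_bij Ls.
  by case: ifP => // _; rewrite [gweight V a L t * _]mulrC -!mulrA.
rewrite -mulr_fsuml -/(Zpart V a D t) invfM !mulrA mulrC !mulrA.
have := Zpart_gt0 Df tb; move: (Zpart V a D t) => z z0.
have -> : f t * z * gweight V a L t / Z / z = f t * gweight V a L t / Z * (z / z) by lra.
by rewrite divff ?gt_eqF// mulr1 [RHS]mulrC mulrA.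
Qed.

Lemma Gexp_comp D xi f : bijective xi -> Gexp V a D xi f =
  \sum_(p \in SL D id) gweight V a D (xi \o p) / Zpart V a D xi * f (xi \o p).
Proof. by move=> xb; rewrite /Gexp (reindex_fsbig _ _ _ _ (SL_bij_comp D xb)). Qed.

Lemma Zpart_comp D xi : bijective xi -> Zpart V a D xi =
  \sum_(p \in SL D id) gweight V a D (xi \o p).
Proof. by move=> xb; rewrite /Zpart (reindex_fsbig _ _ _ _ (SL_bij_comp D xb)). Qed.

(** The set of targets to be permuted, the image of [D] under [xi], is determined by [xi] off [D],
    but by infinitely many of its values. Writing the configurations as [xi \o p], with [p]
    permuting [D], only values on [F] and [D] are read. *)
Lemma Gexp_local D F f : local F f -> local (F `|` D) (fun xi => Gexp V a D xi f).
Proof.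
move=> fF s t sb tb st.
have gw p : SL D id p -> gweight V a D (s \o p) = gweight V a D (t \o p).
  move=> Dp; rewrite /gweight /Ham; congr (expR (- (a * _))).
  apply: eq_fsbigr => x; rewrite inE => Dx; rewrite /= st//; right.
  exact: (SL_stable Dp).
have eZ : Zpart V a D s = Zpart V a D t.
  by rewrite !Zpart_comp//; apply: eq_fsbigr => p; rewrite inE => Dp; exact: gw.
rewrite !Gexp_comp//; apply: eq_fsbigr => p; rewrite inE => Dp.
rewrite eZ gw//; congr (_ * _); apply: fF.
- exact: bij_comp sb (SL_bij Dp).
- exact: bij_comp tb (SL_bij Dp).
- move=> x Fx /=; apply: st; have [Dx|nDx] := pselect (D x).
    by right; exact: (SL_stable Dp).
  by left; rewrite Dp.2.
Qed.

Lemma Gexp_norm D xi f k : finite_set D -> bijective xi ->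
  (forall s, bijective s -> `|f s| <= k) -> `|Gexp V a D xi f| <= k.
Proof.
move=> Df xb fk; have Z0 := Zpart_gt0 Df xb; have Sf := finite_SL xi Df.
apply: (le_trans (ler_norm_fsumr _ Sf)).
apply: (@le_trans _ _ (\sum_(s \in SL D xi) gweight V a D s * (k / Zpart V a D xi))).
  apply: ler_fsumr => // s Ds; have g0 := ltW (gweight_gt0 D s).
  have fs := fk _ (SL_bij Ds).
  rewrite normrM (ger0_norm (divr_ge0 g0 (ltW Z0))) -mulrA [X in _ * X]mulrC.
  by rewrite ler_wpM2l// ler_wpM2r// invr_ge0 ltW.
by rewrite -mulr_fsuml -/(Zpart V a D xi) mulrCA divff ?gt_eqF// mulr1.
Qed.

Lemma GprobT D xi : finite_set D -> bijective xi -> Gprob V a D xi setT = 1.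
Proof.
move=> Df xb; rewrite /Gprob /Gexp; under eq_fsbigr do rewrite indicT mulr1.
by rewrite -mulr_fsuml -/(Zpart V a D xi) divff// gt_eqF// Zpart_gt0.
Qed.

Lemma GprobD D xi A B : finite_set D -> B `<=` A ->
  Gprob V a D xi (A `\` B) = Gprob V a D xi A - Gprob V a D xi B.
Proof.
move=> Df BA; rewrite /Gprob /Gexp fsumrB; last exact: finite_SL.
apply: eq_fsbigr => s _; rewrite -mulrBr; congr (_ * _); rewrite !indicE in_setD.
have [Bs|nBs] := boolP (s \in B); last by rewrite andbT subr0.
by rewrite andbF (_ : s \in A) ?subrr//; move: Bs; rewrite !inE; exact: BA.
Qed.

Lemma indic_ndseq_cvg (G : (set Perm)^nat) s : nondecreasing_seq G ->
  (\1_(G n) s : R) @[n --> \oo] --> (\1_(\bigcup_n G n) s : R).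
Proof.
move=> nd; have [[n _ Gs]|nU] := pselect ((\bigcup_n G n) s).
  rewrite [in X in _ --> X]indicE mem_set; last by exists n.
  apply: cvg_near_cst; exists n => // m /= nm; rewrite indicE mem_set//.
  by have /subsetPset := nd _ _ nm; apply.
rewrite [in X in _ --> X]indicE memNset//.
apply: cvg_near_cst; apply: nearW => n; rewrite indicE memNset// => Gs.
by apply: nU; exists n.
Qed.

Lemma Gprob_cvg D xi (G : (set Perm)^nat) : finite_set D -> nondecreasing_seq G ->
  Gprob V a D xi (G n) @[n --> \oo] --> Gprob V a D xi (\bigcup_n G n).
Proof.
move=> Df nd; have Sf := finite_SL xi Df; rewrite /Gprob /Gexp fsbig_finite//.
under eq_fun do rewrite fsbig_finite//.
apply: cvg_big; first exact: add_continuous.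
by move=> s _; apply: cvgMr; exact: indic_ndseq_cvg.
Qed.

Lemma Gprob_insens D xi A B : cyl_sigma (~` D) B ->
  Gprob V a D xi (A `&` B) = Gprob V a D xi A * \1_B xi.
Proof.
move=> sB; rewrite /Gprob /Gexp mulr_fsuml; apply: eq_fsbigr => s; rewrite inE => Ds.
have e : (s \in B) = (xi \in B).
  by apply/idP/idP; rewrite !inE; apply: (cyl_insens sB _).1 => x nD; rewrite Ds.2.
rewrite -[RHS]mulrA; congr (_ * _); rewrite !indicE.
have -> : (s \in A `&` B) = (s \in A) && (s \in B).
  by apply/idP/andP; rewrite !inE => -[].
rewrite e.
by case: (s \in A); case: (xi \in B); rewrite ?mulr1 ?mulr0 ?mul0r.
Qed.

End FiniteDLR.

Section Infinite.
Variables (R : realType) (d : nat) (V : Zd d -> R) (a : R).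
Hypothesis d0 : (0 < d)%N.
Hypothesis V0 : V 0 = 0.
Hypothesis Hbeta : (beta V a < 1%:E)%E.
Local Notation Zd := (Zd d).
Local Notation Perm := (Perm d).
Implicit Types (s t : Perm) (L F D : set Zd) (A B C : set Perm) (f : Perm -> R).
Local Notation E L f := (Gexp V a L id f).
Variables (dT : measure_display) (T : measurableType dT) (P : probability T R).
Variable zeta : set Zd -> T -> Perm.
Hypothesis Hrm : forall L, finite_set L \/ L = setT -> rand_map (zeta L).
Hypothesis HSL : forall L, finite_set L \/ L = setT -> forall w, SL L id (zeta L w).
Hypothesis Hlaw : forall L, finite_set L -> forall s,
  P (zeta L @^-1` [set s]) = (Gpt V a L id s)%:E.
Hypothesis Hcvg : forall L : nat -> set Zd, exhausting L -> forall w x,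
  exists N, forall n, (N <= n)%N -> zeta (L n) w x = zeta setT w x.
Local Notation X := (zeta setT).
Let exp_cvg := exp_cvg Hrm HSL Hlaw Hcvg.
Let pr_lim := pr_lim Hrm HSL Hlaw Hcvg.
Let rmX := rmX Hrm.
Let zeta_bij := zeta_bij HSL.
Let pr_int := pr_int P Hrm.
Local Notation p := (pr P X).

Lemma rand_map_comp (Phi : Perm -> Perm) (Y : T -> Perm) : rand_map Y ->
  (forall C, cyl_sigma setT C -> cyl_sigma setT (Phi @^-1` C)) ->
  rand_map (fun w => Phi (Y w)).
Proof.
move=> HY HP x y.
have -> : [set w | Phi (Y w) x = y] = Y @^-1` (Phi @^-1` [set s | s x = y]) by [].
apply: (rand_map_pre HY); apply: HP; exact: cylinder_in.
Qed.

Section Invariance.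
Variables h h' : Perm.
Hypotheses (k1 : cancel h h') (k2 : cancel h' h).
Hypothesis Vh : forall x y, V (h x - h y) = V (x - y).

Lemma levent_conjp F C : levent F C -> levent (h' @` F) (conjp h h' @^-1` C).
Proof.
move=> FC s t st; apply: FC => x Fx; by rewrite /conjp /= st//; exists x.
Qed.

Lemma exhausting_image (Ls : nat -> set Zd) : exhausting Ls -> exhausting (fun n => h @` Ls n).
Proof.
move=> [Lf Lm LT]; split=> [n|n|]; first exact: finite_image.
  exact: image_subset.
apply/seteqP; split=> // x _; have : setT (h' x) by [].
by rewrite -LT => -[n _ Lx]; exists n => //; exists (h' x) => //; exact: k2.
Qed.

(** The finite-volume measure in the image of [L] is the conjugate of the one in [L], and the images
    of the balls exhaust as well, so both sides are limits of the same sequence. *)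
Lemma law_conjp C : cyl_sigma setT C -> p (conjp h h' @^-1` C) = p C.
Proof.
have rmY : rand_map (fun w => conjp h h' (X w)).
  by apply: rand_map_comp => //; exact: cyl_conjp.
move: C; apply: (@cmeas_eq _ _ (pr P (fun w => conjp h h' (X w))) p).
- exact: cmeas_pr.
- exact: cmeas_pr.
- by rewrite !prT.
move=> F C Ff sC lC; have ex := exhausting_nball d.
have c1 := pr_lim (finite_image h' Ff) (cyl_conjp k1 sC) (levent_conjp lC) ex.
have c2 := pr_lim Ff sC lC (exhausting_image ex).
rewrite -[LHS]/(p (conjp h h' @^-1` C)) -(cvg_lim _ c1)// -(cvg_lim _ c2)//.
congr (lim (_ @ \oo)); apply/funext => n.
by rewrite (Gexp_conjp a k1 k2 Vh).
Qed.

End Invariance.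

Lemma law_shift u C : cyl_sigma setT C -> p (Defs.shift u @^-1` C) = p C.
Proof.
have k1 : cancel (fun x : Zd => x + u) (fun x => x - u) by move=> y; rewrite addrK.
have k2 : cancel (fun x : Zd => x - u) (fun x => x + u) by move=> y; rewrite subrK.
apply: (law_conjp k1 k2) => x y.
by rewrite opprD addrACA subrr addr0.
Qed.

Lemma cyl_shift u C : cyl_sigma setT C -> cyl_sigma setT (@Defs.shift d u @^-1` C).
Proof. by apply: (@cyl_conjp d (fun x => x + u) (fun x => x - u)) => x; rewrite addrK. Qed.

Lemma levent_setI F F' A B : @levent d F A -> levent F' B -> levent (F `|` F') (A `&` B).
Proof.
move=> FA FB s t st [As Bs]; split.
  by apply: FA As => x Fx; apply: st; left.
by apply: FB Bs => x Fx; apply: st; right.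
Qed.

Lemma indicI_fun A B : (\1_(A `&` B) : Perm -> R) = (fun s => \1_A s * \1_B s).
Proof.
apply/funext => s; rewrite !indicE.
have -> : (s \in A `&` B) = (s \in A) && (s \in B).
  by apply/idP/andP; rewrite !inE => -[].
by case: (s \in A); case: (s \in B); rewrite ?mulr1 ?mulr0.
Qed.

(** Translations along the diagonal; one direction of translation suffices to prove ergodicity. *)
Definition uk k : Zd := const_mx k%:Z.

Lemma nball_uk m k n y : (m + n < k)%N -> nball 0 m y -> ~ nball 0 n (y - uk k).
Proof.
move=> mnk; rewrite /nball /= !subr0 => /nrm_le/(_ (Ordinal d0)) hy /nrm_le/(_ (Ordinal d0)).
rewrite !mxE; move: (y _ _) hy => z; lia.
Qed.

Lemma mixing_local FA FB A B e : finite_set FA -> finite_set FB ->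
  cyl_sigma setT A -> cyl_sigma setT B -> levent FA A -> levent FB B -> 0 < e ->
  exists K, forall k, (K <= k)%N ->
    `|p (A `&` Defs.shift (uk k) @^-1` B) - p A * p B| <= e.
Proof.
move=> FAf FBf sA sB lA lB e0.
have lA' := levent_local R lA; have lB' := levent_local R lB.
have e2 : 0 < e / 2 by rewrite divr_gt0.
have [M HM] := decorrelation V0 Hbeta FAf lA' (indic_bdd1 R A) e2.
have [n Hn] := quasi_local V0 Hbeta FBf lB' (indic_bdd1 R B) e2.
have [r Br] := finite_sub_nball FBf.
exists (maxn n r + M).+1 => k Kk; set u := uk k.
pose hh : Perm := fun x => x + u; pose hh' : Perm := fun x => x - u.
have k1 : cancel hh hh' by move=> y; rewrite /hh /hh' addrK.
have k2 : cancel hh' hh by move=> y; rewrite /hh /hh' subrK.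
have Vh x y : V (hh x - hh y) = V (x - y) by rewrite /hh opprD addrACA subrr addr0.
have lS : levent (hh' @` FB) (Defs.shift u @^-1` B) := levent_conjp (h := hh) (h' := hh') lB.
have sS : cyl_sigma setT (Defs.shift u @^-1` B) by exact: cyl_shift.
have far m y : (m <= maxn n r)%N -> nball 0 m y -> ~ nball 0 M (hh' y).
  by move=> mm; apply: nball_uk; apply: leq_trans Kk; rewrite ltnS leq_add2r.
pose G := Defs.shift u @^-1` B.
pose big := FA `|` (hh' @` (nball 0 n `|` FB)).
have bigf : finite_set big.
  by rewrite finite_setU; split=> //; apply: finite_image; rewrite finite_setU; split=> //; exact: finite_nball.
have [N HN] := exhausting_sub (exhausting_nball d) bigf.
have step m : (N <= m)%N ->
   `|E (nball 0 m) (\1_(A `&` G)) - E (nball 0 m) (\1_A) * E (nball 0 m) (\1_G)| <= e.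
  move=> Nm; rewrite indicI_fun; have bm := HN _ Nm.
  have Lf : finite_set (nball (0 : Zd) m) by exact: finite_nball.
  apply: (@le_trans _ _ (e / 2 + e / 2)); last by lra.
  apply: (HM _ Lf _ (hh' @` FB)).
  - by move=> x Ax; apply: bm; left.
  - exact: (levent_local R lS).
  - exact: indic_bdd1.
  - by move=> _ [x /Br xr <-]; apply: (far r) => //; exact: leq_maxr.
  - move=> D DM.
    (* The volume is translated instead of the event: the hole [D] then lies outside the ball of
       radius [n], and the modulus of quasi-locality of [B], chosen before [k], applies. *)
    have e1 L : E L (\1_G) = E (hh @` L) (\1_B) by rewrite (Gexp_conjp a k1 k2 Vh).
    rewrite !e1; apply: Hn.
    + exact/finite_image/finite_setD.
    + exact: finite_image.
    + move=> x Bx; exists (hh' x); last exact: k2.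
      split; first by apply: bm; right; exists x => //; right.
      by move=> /DM; apply: (far r); [exact: leq_maxr|exact: Br].
    + move=> x Bx; exists (hh' x); last exact: k2.
      by apply: bm; right; exists x => //; right.
    + move=> y yn; split=> -[x Lx xy]; exists x => //; first by case: Lx.
      split=> // /DM; have -> : x = hh' y by rewrite -xy k1.
      by apply: (far n) => //; exact: leq_maxl.
have ex := exhausting_nball d.
have cAG := pr_lim (F := FA `|` (hh' @` FB)) _ (cyl_setI sA sS) (levent_setI lA lS) ex.
have cA := pr_lim FAf sA lA ex.
have cG := pr_lim (finite_image hh' FBf) sS lS ex.
have /cAG{}cAG : finite_set (FA `|` (hh' @` FB)) by rewrite finite_setU; split=> //; exact: finite_image.
rewrite -(law_shift u sB).
have c : `|E (nball 0 m) (\1_(A `&` G)) - E (nball 0 m) (\1_A) * E (nball 0 m) (\1_G)|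
    @[m --> \oo] --> `|p (A `&` G) - p A * p G|.
  by apply: cvg_norm; apply: cvgB => //; exact: cvgM.
rewrite -(cvg_lim _ c)//; apply: limr_le; first exact: cvgP c.
by exists N.
Qed.

Lemma pr_le1 C : cyl_sigma setT C -> p C <= 1.
Proof. by move=> sC; rewrite -(prT P X); apply: pr_mono => //; exact: cyl_setT. Qed.

(** Only [B] is extended beyond local events. In the increasing union, the error of replacing the
    limit by [G n] is unchanged by the shift, by stationarity, and so is small uniformly in [k]. *)
Lemma mixing FA A B e : finite_set FA -> cyl_sigma setT A -> levent FA A ->
  cyl_sigma setT B -> 0 < e -> exists K, forall k, (K <= k)%N ->
    `|p (A `&` Defs.shift (uk k) @^-1` B) - p A * p B| <= e.
Proof.
move=> FAf sA lA sB; move: B sB e; have pA1 := pr_le1 sA; have pA0 := pr_ge0 P X A.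
have sAS u B : cyl_sigma setT B -> cyl_sigma setT (A `&` Defs.shift u @^-1` B).
  by move=> sB; apply: cyl_setI => //; exact: cyl_shift.
apply: cyl_ind.
- move=> e e0; exists 0%N => k _.
  by rewrite preimage_setT setIT prT mulr1 subrr normr0 ltW.
- move=> B C sB sC CB HB HC e e0; have e2 : 0 < e / 2 by rewrite divr_gt0.
  have [K1 H1] := HB _ e2; have [K2 H2] := HC _ e2.
  exists (maxn K1 K2) => k; rewrite geq_max => /andP[/H1 h1 /H2 h2].
  have -> : A `&` Defs.shift (uk k) @^-1` (B `\` C) =
      (A `&` Defs.shift (uk k) @^-1` B) `\` (A `&` Defs.shift (uk k) @^-1` C).
    apply/seteqP; split=> s /= [].
      by move=> As [Bs nC]; split=> // -[].
    by move=> [As Bs] nC; split=> //; split=> // Cs; apply: nC.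
  rewrite !prD//; [|exact: sAS|exact: sAS|]; last by move=> s [As /CB].
  by move: h1 h2; rewrite !ler_norml; lra.
- move=> G sG ndG HG e e0; have e3 : 0 < e / 3 by rewrite divr_gt0.
  have sU : cyl_sigma setT (\bigcup_n G n) by exact: cyl_bigcup.
  have [n hn] : exists n, `|p (\bigcup_n G n) - p (G n)| <= e / 3.
    have /cvgrPdist_le/(_ _ e3)[n _ /(_ n)/=] := pr_cvg (P := P) rmX sG ndG.
    by rewrite leqnn => /(_ isT) h; exists n.
  have [K HK] := HG n _ e3; exists K => k /HK hk.
  have GU : G n `<=` \bigcup_n G n by move=> s Gs; exists n.
  set S := Defs.shift (uk k).
  have dAS : p (A `&` S @^-1` (\bigcup_n G n)) - p (A `&` S @^-1` G n) <= p (\bigcup_n G n) - p (G n).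
    rewrite -!prD//; [|exact: sAS|exact: sAS|]; last by move=> s [As /GU].
    rewrite -(law_shift (uk k) (cyl_setD sU (sG n))); apply: pr_mono => //.
    - by apply: cyl_setD; exact: sAS.
    - by apply: cyl_shift; exact: cyl_setD.
    - by move=> s [[As Us] nG]; split=> // Gs; apply: nG.
  have dAS0 : p (A `&` S @^-1` G n) <= p (A `&` S @^-1` (\bigcup_n G n)).
    by apply: pr_mono => //; [exact: sAS|exact: sAS|move=> s [As /GU]].
  have dA0 : p (G n) <= p (\bigcup_n G n) by exact: pr_mono.
  have : p A * (p (\bigcup_n G n) - p (G n)) <= p (\bigcup_n G n) - p (G n).
    by rewrite ler_piMl// subr_ge0.
  have : 0 <= p A * (p (\bigcup_n G n) - p (G n)) by rewrite mulr_ge0// subr_ge0.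
  move: hn hk dAS dAS0 dA0; rewrite -/S.
  move: (p (\bigcup_n G n)) (p (G n)) (p (A `&` S @^-1` (\bigcup_n G n))) (p (A `&` S @^-1` G n)) (p A) => q1 q2 q3 q4 q5.
  rewrite !ler_norml; lra.
- by move=> F C Ff _ sC lC e e0; exact: (mixing_local FAf Ff sA sC lA lC e0).
Qed.

Lemma cmeasI I : cyl_sigma setT I -> cmeas (fun C => p (C `&` I)).
Proof.
move=> sI; split=> [A B sA sB BA|G sG ndG].
  rewrite -prD//; [|exact: cyl_setI|exact: cyl_setI|by move=> s [/BA]].
  congr (pr P X _); apply/seteqP; split=> s /= [].
    by move=> [As nB] Is; split=> // -[].
  by move=> [As Is] nB; split=> //; split=> // Bs; apply: nB.
rewrite setI_bigcupl; apply: pr_cvg => //; first by move=> n; exact: cyl_setI.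
move=> n m nm; apply/subsetPset => s [Gs Is]; split=> //.
by have /subsetPset := ndG _ _ nm; apply.
Qed.

Lemma cmeasZ (m : set Perm -> R) k : cmeas m -> cmeas (fun C => m C * k).
Proof.
move=> [mD mU]; split=> [A B sA sB BA|G sG ndG]; first by rewrite mD// mulrBl.
by apply: cvgMl; exact: mU.
Qed.

(** For an invariant [I], mixing says that [I] is independent of every local event, hence of every
    event, hence of itself; so its probability equals its square. *)
Lemma ergodic_law : ergodic P X.
Proof.
split=> [u A sA|I sI inv].
  by rewrite !(prE _ rmX)//; [rewrite law_shift|exact: cyl_shift].
have loc A FA : finite_set FA -> cyl_sigma setT A -> levent FA A -> p (A `&` I) = p A * p I.
  move=> FAf sA lA; apply/eqP; rewrite -subr_eq0 -normr_le0.
  apply/ler_addgt0Pr => e e0; rewrite add0r.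
  have [K /(_ K (leqnn K))] := mixing FAf sA lA sI e0.
  by rewrite inv.
have h : forall C, cyl_sigma setT C -> p (C `&` I) = p C * p I.
  apply: cmeas_eq.
  - exact: cmeasI.
  - by apply: cmeasZ; exact: cmeas_pr.
  - by rewrite setTI prT mul1r.
  - by move=> F C Ff sC lC; exact: loc lC.
have := h _ sI; rewrite setIid => e.
have : p I * (1 - p I) = 0 by rewrite mulrBr mulr1 -e subrr.
move=> /eqP; rewrite mulf_eq0 => /orP[/eqP e0|].
  by left; rewrite (prE _ rmX)// e0.
by rewrite subr_eq0 => /eqP e1; right; rewrite (prE _ rmX)// -e1.
Qed.

Section DLR.
Variable D : set Zd.
Hypothesis Df : finite_set D.
Local Notation K w C := (Gprob V a D (X w) C).

Lemma K_le1 C w : `|K w C| <= 1.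
Proof. by apply: Gexp_norm => // s sb; exact: indic_bdd1. Qed.

(** Both sides are limits of expectations of local functions, and these expectations agree in every
    box containing [D], by [Gexp_DLR]. *)
Lemma K_local F C : finite_set F -> cyl_sigma setT C -> levent F C ->
  measurable_fun setT (fun w => K w C) /\ ((p C)%:E = \int[P]_w (K w C)%:E)%E.
Proof.
move=> Ff sC lC; pose g s := Gprob V a D s C.
have gl : local (F `|` D) g by exact: Gexp_local (levent_local R lC).
have g1 : bdd1 g by move=> s sb; apply: Gexp_norm => // t tb; exact: indic_bdd1.
have FDf : finite_set (F `|` D) by rewrite finite_setU.
have [gm gc] := exp_cvg (bdd1_bound g1) (local_cont FDf gl).
split=> //; have ex := exhausting_nball d.
have c1 := gc _ ex; have c2 := pr_lim Ff sC lC ex.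
have [N HN] := exhausting_sub ex Df.
have c3 : (E (nball 0 n) g)%:E @[n --> \oo] --> (p C)%:E.
  apply: cvg_EFin; first exact: nearW.
  apply: cvg_trans c2; apply: near_eq_cvg; exists N => // n /= /HN DN.
  by rewrite /= -[LHS](Gexp_DLR V a _ (finite_nball (0 : Zd) n) DN).
by have <- := cvg_lim _ c1; [apply/esym/cvg_lim|].
Qed.

Lemma K_measurable C : cyl_sigma setT C -> measurable_fun setT (fun w => K w C).
Proof.
move: C; apply: cyl_ind.
- by under eq_fun do rewrite GprobT//; exact: measurable_cst.
- move=> A B _ _ BA mA mB.
  by under eq_fun do rewrite GprobD//; exact: measurable_funB.
- move=> G _ ndG mG; apply: (@measurable_fun_cvg _ _ _ setT (fun n w => K w (G n))) => //.
  by move=> w _; exact: Gprob_cvg.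
- by move=> F C Ff _ sC lC; have [] := K_local Ff sC lC.
Qed.

Lemma K_integrable C : cyl_sigma setT C -> P.-integrable setT (fun w => (K w C)%:E).
Proof.
move=> sC; apply: (@le_integrable _ _ _ P setT measurableT _ (cst 1%:E)).
- exact/measurable_EFinP/K_measurable.
- by move=> w _; rewrite lee_fin normr1 K_le1.
- exact: finite_measure_integrable_cst.
Qed.

Let m2 C := fine (\int[P]_w (K w C)%:E)%E.

Let m2E C : cyl_sigma setT C -> (\int[P]_w (K w C)%:E = (m2 C)%:E)%E.
Proof. by move=> sC; rewrite /m2 fineK//; exact/integrable_fin_num/K_integrable. Qed.

Lemma dlr C : cyl_sigma setT C -> ((p C)%:E = \int[P]_w (K w C)%:E)%E.
Proof.
move=> sC; rewrite m2E//; congr (_%:E); move: C sC.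
apply: cmeas_eq; first exact: cmeas_pr.
- split=> [A B sA sB BA|G sG ndG].
    have sAB := cyl_setD sA sB; apply: EFin_inj; rewrite EFinB -!m2E//.
    rewrite -integralB//; [|exact: K_integrable|exact: K_integrable].
    by apply: eq_integral => w _; rewrite GprobD.
  have sU : cyl_sigma setT (\bigcup_n G n) by exact: cyl_bigcup.
  apply: fine_cvg; rewrite -/(m2 _) -m2E//.
  have [] // := @dominated_convergence _ T R P setT measurableT
    (fun n w => (K w (G n))%:E) (fun w => (K w (\bigcup_n G n))%:E) (cst 1%:E).
  + by move=> n; exact/measurable_EFinP/K_measurable.
  + exact/measurable_EFinP/K_measurable.
  + by apply: aeW => w _; apply: cvg_EFin; [exact: nearW|exact: Gprob_cvg].
  + exact: finite_measure_integrable_cst.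
  + by apply: aeW => w n _; rewrite lee_fin K_le1.
- apply: EFin_inj; rewrite -m2E; last exact: cyl_setT.
  under eq_integral do rewrite GprobT//.
  by rewrite prT integral_cst// mul1e; exact/esym/probability_setT.
- by move=> F C Ff sC lC; apply: EFin_inj; rewrite -m2E//; have [] := K_local Ff sC lC.
Qed.

End DLR.

Lemma gibbs_law : is_gibbs P V a X.
Proof.
split; first by apply: aeW => w; exact: zeta_bij.
move=> D Df A B sA sB; have sB' : cyl_sigma setT B by exact: (cyl_sub (@subsetT _ (~` D))).
have sAB := cyl_setI sA sB'.
rewrite (prE _ rmX)// (dlr Df)//; apply: eq_integral => w _.
by rewrite Gprob_insens.
Qed.

End Infinite.

(** * Quadratic potential: composition with a translation *)

Section Tilt.
Variables (R : realType) (d : nat) (a : R).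
Local Notation Zd := (Zd d).
Local Notation Perm := (Perm d).
Implicit Types (s t : Perm) (L F D : set Zd) (A B C : set Perm) (f : Perm -> R) (xi : Perm).
Local Notation V := (@sqnorm R d).

Lemma sqnorm0 : V 0 = 0.
Proof. by rewrite /sqnorm big1// => i _; rewrite mxE expr0n. Qed.

Lemma sqnormN x : V (- x) = V x.
Proof. by apply: eq_bigr => i _; rewrite mxE mulrNz sqrrN. Qed.

Lemma sqnorm_ge0 x : 0 <= V x.
Proof. by apply: sumr_ge0 => i _; exact: sqr_ge0. Qed.

Lemma sqnormD x v : V (x + v) =
  V x + \sum_(i < d) 2 * (v ord0 i)%:~R * (x ord0 i)%:~R + V v.
Proof.
rewrite /sqnorm -!big_split; apply: eq_bigr => i _; rewrite mxE intrD /=; lra.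
Qed.

Lemma tau_bij v : bijective (@tau d v).
Proof. by exists (tau (- v)) => x; rewrite /tau ?addrK ?subrK. Qed.

(** As [s] is [xi \o q] with [q] permuting [L], both sums run over the same values in a different
    order. *)
Lemma sum_coord_SL L xi s (i : 'I_d) : finite_set L -> bijective xi -> SL L xi s ->
  \sum_(x \in L) (((s x) ord0 i)%:~R : R) = \sum_(x \in L) (((xi x) ord0 i)%:~R : R).
Proof.
move=> Lf xb Ls; have [_ _ /(_ _ Ls)[q Lq <-]] := SL_bij_comp L xb.
apply/esym; apply: (reindex_fsbig q L L (fun x => ((xi x) ord0 i)%:~R : R)).
split.
- by move=> x; exact: (SL_stable Lq).
- by move=> x y _ _; exact: (SL_inj Lq).
- move=> y Ly; have [x e] := bij_surj y (SL_bij Lq); exists x => //.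
  by apply/(SL_stableE _ Lq); rewrite e.
Qed.

Lemma gweight_tau L xi v : finite_set L -> bijective xi -> exists2 k : R, 0 < k &
  forall s, SL L xi s -> gweight V a L (tau v \o s) = k * gweight V a L s.
Proof.
move=> Lf xb.
pose c : R := \sum_(x \in L) (\sum_(i < d) 2 * (v ord0 i)%:~R * ((xi x - x) ord0 i)%:~R + V v).
exists (expR (- (a * c))); first exact: expR_gt0.
move=> s Ls; rewrite /gweight -expRD -opprD -mulrDr; congr (expR (- (a * _))).
rewrite /Ham.
transitivity (\sum_(x \in L) ((\sum_(i < d) 2 * (v ord0 i)%:~R * ((s x - x) ord0 i)%:~R + V v) + V (s x - x))).
  apply: eq_fsbigr => x _.
  have -> : (tau v \o s) x - x = (s x - x) + v by rewrite /= /tau addrAC.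
  by rewrite sqnormD [RHS]addrC addrA.
rewrite fsumrD//; congr (_ + _); rewrite /c !fsumrD//; congr (_ + _).
rewrite !fsbig_finite//= exchange_big [RHS]exchange_big; apply: eq_bigr => i _.
rewrite -!mulr_sumr; congr (_ * _).
have e := sum_coord_SL i Lf xb Ls; rewrite !fsbig_finite//= in e.
transitivity (\sum_(x <- fset_set L) ((s x) ord0 i)%:~R - \sum_(x <- fset_set L) (x ord0 i)%:~R :> R).
  by rewrite -sumrB; apply: eq_bigr => x _; rewrite !mxE intrB.
by rewrite e -sumrB; apply: eq_bigr => x _; rewrite !mxE intrB.
Qed.

Lemma SL_tau L xi v : set_bij (SL L xi) (SL L (tau v \o xi)) (fun s => tau v \o s).
Proof.
split.
- by move=> s Ls; split; [exact: bij_comp (tau_bij v) (SL_bij Ls)|move=> x nx /=; rewrite Ls.2].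
- move=> s t _ _ /funeqP e; apply/funext => x; exact: (bij_inj (tau_bij v) (e x)).
- move=> s Ls; exists (tau (- v) \o s).
    split; first exact: bij_comp (tau_bij _) (SL_bij Ls).
    by move=> x nx /=; rewrite Ls.2//= /tau addrK.
  by apply/funext => x; rewrite /= /tau subrK.
Qed.

(** By [gweight_tau] the weights change by a common factor, which the normalization cancels. *)
Lemma Gexp_tau L xi v f : finite_set L -> bijective xi ->
  Gexp V a L (tau v \o xi) f = Gexp V a L xi (fun s => f (tau v \o s)).
Proof.
move=> Lf xb; have [k k0 kE] := gweight_tau v Lf xb.
have eZ : Zpart V a L (tau v \o xi) = k * Zpart V a L xi.
  rewrite /Zpart mulr_fsumr; apply: (etrans (reindex_fsbig _ _ _ _ (SL_tau L xi v))).
  by apply: eq_fsbigr => s; rewrite inE => Ls; rewrite kE.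
rewrite /Gexp eZ; apply: (etrans (reindex_fsbig _ _ _ _ (SL_tau L xi v))).
apply: eq_fsbigr => s; rewrite inE => Ls; rewrite kE//; congr (_ * _).
by rewrite -mulf_div divff ?mul1r// gt_eqF.
Qed.

Lemma tau_id v : tau v \o id = @tau d v. Proof. by []. Qed.

Lemma Gexp_tau_id L v f : finite_set L ->
  Gexp V a L (tau v) f = Gexp V a L id (fun s => f (tau v \o s)).
Proof. by move=> Lf; rewrite -(tau_id v) Gexp_tau//; exists id. Qed.

Lemma Gpt_tau L v s : finite_set L ->
  Gpt V a L (tau v) s = Gpt V a L id (tau (- v) \o s).
Proof.
move=> Lf; rewrite /Gpt /Gprob Gexp_tau_id//; apply: eq_fsbigr => t _; congr (_ * _).
rewrite !indicE; congr ((_ : bool)%:R); apply/idP/idP; rewrite !inE /=.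
  by move=> <-; apply/funext => x; rewrite /= /tau addrK.
by move=> ->; apply/funext => x; rewrite /= /tau subrK.
Qed.

End Tilt.

(** * The bound on alpha* *)

Section Root.
Variable R : realType.
Implicit Types r s : R.

(** The equation for rho_0 cleared of its denominator, which makes it meaningful and monotone on all
    of [0, 1]. *)
Definition cubic s := s - (1 + s) * (1 - s) ^+ 2.

Lemma cubic_lt r s : 0 <= r <= 1 -> 0 <= s <= 1 -> s < r -> cubic s < cubic r.
Proof.
move=> /andP[r0 r1] /andP[s0 s1] sr; rewrite -subr_gt0.
have -> : cubic r - cubic s = (r - s) * (2 + (r + s) - (r ^+ 2 + r * s + s ^+ 2)).
  (* The second factor is positive because squares on [0, 1] are at most their roots: it is at least
     [2 - r * s]. *)
  by rewrite /cubic; lra.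
by apply: mulr_gt0; [rewrite subr_gt0|nra].
Qed.

Lemma cubic_eq r : r < 1 -> (r / (1 - r) ^+ 2 - r - 1) * (1 - r) ^+ 2 = cubic r.
Proof.
move=> r1; have nz : (1 - r) ^+ 2 != 0 by rewrite expf_neq0// subr_eq0 eq_sym lt_eqF.
by rewrite !mulrBl divfK// /cubic; lra.
Qed.

Lemma cubic_root : exists r, [/\ 0 < r, r < 1 & cubic r = 0].
Proof.
have cc : {within `[0, 1 : R], continuous cubic}.
  apply: continuous_subspaceT => x; rewrite /cubic.
  apply: cvgB; first exact: cvg_id.
  apply: cvgM; first by apply: cvgD; [exact: cvg_cst|exact: cvg_id].
  apply: (@continuous_comp _ _ _ (fun x : R => 1 - x) (fun x => x ^+ 2)); last exact: exprn_continuous.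
  by apply: cvgB; [exact: cvg_cst|exact: cvg_id].
have h0 : cubic 0 = -1 by rewrite /cubic; lra.
have h1 : cubic 1 = 1 by rewrite /cubic; lra.
have [|r /[!in_itv]/= /andP[r0 r1] cr] := @IVT R cubic 0 1 0 ler01 cc.
  by rewrite h0 h1 minEle maxEle; case: ifP => //; lra.
exists r; split=> //; rewrite lt_neqAle ?r0 ?r1 andbT.
  by apply/eqP => e; move: cr; rewrite -e h0; lra.
by apply/eqP => e; move: cr; rewrite e h1; lra.
Qed.

End Root.

Section FinSums.
Variable R : realType.

(* Expanding the product: the sum over [J] is part of the [I]-th power of the sum over the set of all coordinates. *)
Lemma fsum_prod_le (I : finType) (T U : choiceType) (w : T -> R) (B : R)
    (phi : I -> U -> T) (J : set U) :
  (forall t, 0 <= w t) ->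
  (forall C, finite_set C -> \sum_(t \in C) w t <= B) -> finite_set J ->
  (forall x y, J x -> J y -> (forall i, phi i x = phi i y) -> x = y) ->
  \sum_(x \in J) \prod_i w (phi i x) <= B ^+ #|I|.
Proof.
move=> w0 wB Jf inj; pose K := fset_set J.
pose C := fset_set (\bigcup_(i in [set: I]) (phi i @` J)).
have Cf : finite_set (\bigcup_(i in [set: I]) (phi i @` J)).
  by apply: bigcup_finite => // i _; exact: finite_image.
have HC (x : K) i : phi i (val x) \in C.
  rewrite in_fset_set// inE; exists i => //; exists (val x) => //.
  by have := valP x; rewrite in_fset_set// inE.
pose h (x : K) : {ffun I -> C} := [ffun i => [` HC x i]%fset].
have hi : injective h.
  move=> x y /ffunP e; apply/val_inj/inj.
  - by have := valP x; rewrite in_fset_set// inE.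
  - by have := valP y; rewrite in_fset_set// inE.
  - by move=> i; have := e i; rewrite !ffunE => /(congr1 val).
pose F (f : {ffun I -> C}) := \prod_i w (val (f i)).
have -> : \sum_(x \in J) \prod_i w (phi i x) = \sum_(x : K) F (h x).
  rewrite fsbig_finite//= (big_seq_fsetE _ _ predT (fun x => \prod_i w (phi i x)))/=.
  by apply: eq_bigr => x _; apply: eq_bigr => i _; rewrite ffunE.
apply: (@le_trans _ _ (\sum_(f : {ffun I -> C}) F f)).
  rewrite -(big_image _ _ h predT F) big_uniq/=; last by rewrite map_inj_uniq ?enum_uniq.
  rewrite [leRHS](bigID (mem [seq h j | j in predT]))/= lerDl.
  by apply: sumr_ge0 => f _; apply: prodr_ge0.
rewrite -(bigA_distr_bigA (fun (_ : I) (c : C) => w (val c))) prodr_const.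
apply: lerXn2r; rewrite ?nnegrE.
- exact: sumr_ge0.
- by apply: le_trans (wB set0 _) => //; rewrite fsbig_set0.
- rewrite -(big_seq_fsetE _ _ predT w)/= -[C]set_fsetK -fsbig_finite//.
  exact: wB.
Qed.

Lemma sum_nX_le (x : R) n : 0 <= x -> x < 1 ->
  \sum_(2 <= k < n) k%:R * x ^+ k <= x / (1 - x) ^+ 2 - x.
Proof.
move=> x0 x1; have c0 : 0 < (1 - x) ^+ 2 by rewrite exprn_gt0// subr_gt0.
(* The partial sums of [sum_k k x^k] in closed form; the term [k = 1] is added here and accounts for
   the [- x] of the bound. The subtracted remainder is nonnegative. *)
have S m : (\sum_(2 <= k < m.+2) k%:R * x ^+ k + x) * (1 - x) ^+ 2 =
    x - x ^+ m.+2 * (m.+2%:R - m.+1%:R * x).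
  elim: m => [|m IH]; first by rewrite big_geq// !expr2; lra.
  rewrite big_nat_recr//= addrAC mulrDl IH -[m.+3%:R]natr1 -[m.+2%:R]natr1.
  by rewrite (exprS x m.+2); lra.
have [n2|n2] := ltnP n 2.
  rewrite big_geq ?(ltnW n2)// subr_ge0 ler_pdivlMr//.
  by rewrite ler_piMr// exprn_ile1//; lra.
rewrite lerBrDr ler_pdivlMr// -(subnK n2) addn2 S lerBlDr lerDl.
apply: mulr_ge0; first exact: exprn_ge0.
by rewrite subr_ge0 (@le_trans _ _ (n - 2).+1%:R) ?ler_nat// ler_piMr// ltW.
Qed.

End FinSums.

Section CycleSum.
Variables (R : realType) (d : nat) (V : Zd d -> R) (a : R).
Local Notation Zd := (Zd d).
Local Notation Perm := (Perm d).
Implicit Types (g h : Perm).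

(** A repetition within the first [cyc_len g] iterates would confine the orbit of 0 to fewer sites
    than its support has; being distinct, these iterates exhaust the support. *)
Lemma cycle_traject g : cyc 0 g ->
  uniq (traject g 0 (cyc_len g)) /\ fset_set (supp g) =i traject g 0 (cyc_len g).
Proof.
move=> [[gb gf g2 gt] g0]; set n := cyc_len g.
have un : uniq (traject g 0 n).
  have : (0 < n)%N by exact: leq_trans g2.
  case en : n => [//|m] _; rewrite looping_uniq; apply/negP => /loopingP lo.
  have : (n <= size (traject g 0%R m))%N.
    apply: uniq_leq_size; first exact: fset_uniq.
    move=> x; rewrite in_fset_set// inE => /(gt _ _ g0)[k <-]; exact: lo.
  by rewrite size_traject en ltnn.
split=> // x; have sub : {subset traject g 0 n <= fset_set (supp g)}.
  move=> _ /trajectP[i _ ->]; rewrite in_fset_set// inE.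
  by elim: i => //= i IH; exact/(suppP _ gb).
by have [|_ ->] := uniq_min_size un sub; rewrite // size_traject.
Qed.

Definition step (i : nat) g : Zd := iter i.+1 g 0 - iter i g 0.

Lemma cycle_prod g : cyc 0 g ->
  cyc_weight V a g = \prod_(i < cyc_len g) expR (- (a * V (step i g))).
Proof.
move=> gc; have [un E] := cycle_traject gc; have [[gb gf g2 gt] g0] := gc.
rewrite /cyc_weight fsbig_finite//= (perm_big (traject g 0 (cyc_len g)))/=; last first.
  by apply: uniq_perm => //; exact: fset_uniq.
rewrite (big_nth 0) size_traject big_mkord mulr_sumr -sumrN expR_sum.
by apply: eq_bigr => i _; rewrite (nth_traject _ (ltn_ord i)).
Qed.

Lemma step_inj g h : cyc 0 g -> cyc 0 h -> cyc_len g = cyc_len h ->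
  (forall i, (i < cyc_len g)%N -> step i g = step i h) -> g = h.
Proof.
move=> gc hc gh st.
have it i : (i <= cyc_len g)%N -> iter i g 0 = iter i h 0.
  elim: i => // i IH ig; have := st _ ig.
  by rewrite /step IH 1?ltnW// => /addIr.
have [_ Eg] := cycle_traject gc; have [_ Eh] := cycle_traject hc.
have [[_ gf _ _] _] := gc; have [[_ hf _ _] _] := hc.
apply/funext => x; have [gx|gx] := pselect (supp g x).
  have : x \in traject g 0 (cyc_len g) by rewrite -Eg in_fset_set// inE.
  by move=> /trajectP[i ig ->]; rewrite [in RHS]it ?(ltnW ig)// -!iterS it.
rewrite (nsupp gx) nsupp// => hx; apply: gx.
have : x \in traject h 0 (cyc_len h) by rewrite -Eh in_fset_set// inE.
rewrite -gh => /trajectP[i ih ->]; rewrite -it ?(ltnW ih)//.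
have : iter i g 0 \in traject g 0 (cyc_len g) by apply/trajectP; exists i.
by rewrite -Eg in_fset_set// inE.
Qed.

Lemma step_neq0 i g : cyc 0 g -> (i < cyc_len g)%N -> step i g != 0.
Proof.
move=> gc ig; have [_ Eg] := cycle_traject gc; have [[_ gf _ _] _] := gc.
have : iter i g 0 \in traject g 0 (cyc_len g) by apply/trajectP; exists i.
by rewrite -Eg in_fset_set// inE subr_eq0 /= => /eqP.
Qed.

(* A cycle through the origin is determined by its successive jumps, none of which vanishes. *)
Lemma beta_le (q : R) : 0 <= q -> q < 1 ->
  (forall C : set Zd, finite_set C ->
     \sum_(x \in C) (if x == 0 then 0 else expR (- (a * V x))) <= q) ->
  (beta V a <= (q / (1 - q) ^+ 2 - q)%:E)%E.
Proof.
move=> q0 q1 Hq; apply: ub_ereal_sup => _ [F [Ff F0] <-].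
rewrite fsbig_finite//= sumEFin lee_fin -fsbig_finite//.
have [N HN] : exists N, forall g, F g -> (cyc_len g < N)%N.
  apply: finite_fset_bound => // [g _|g n m nm gn]; first by exists (cyc_len g).+1.
  exact: leq_trans gn nm.
apply: le_trans (sum_nX_le N q0 q1).
have -> : \sum_(g \in F) (cyc_len g)%:R * cyc_weight V a g =
    \sum_(2 <= k < N) k%:R * \sum_(g \in F `&` [set g | cyc_len g = k]) cyc_weight V a g.
  under [RHS]eq_bigr do rewrite -fsumr_cond// fsbig_finite//= mulr_sumr.
  rewrite exchange_big/= fsbig_finite//=; apply: eq_big_seq => g.
  rewrite in_fset_set// inE => Fg; have [[_ _ g2 _] _] := F0 _ Fg.
  rewrite (bigD1_seq (cyc_len g)) ?iota_uniq//=; last by rewrite mem_index_iota g2 HN.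
  rewrite mem_set//= big1 ?addr0// => k /eqP kg.
  by rewrite memNset ?mulr0//= => e; apply: kg.
apply: ler_sum_nat => k _; rewrite ler_wpM2l//.
(* Weight 0 for the null jump leaves the cycles untouched and makes the one-jump sum at most [q]
   rather than [1 + q]. *)
pose w (x : Zd) := if x == 0 then 0 else expR (- (a * V x)).
have -> : \sum_(g \in F `&` [set g | cyc_len g = k]) cyc_weight V a g =
    \sum_(g \in F `&` [set g | cyc_len g = k]) \prod_(i < k) w (step i g).
  apply: eq_fsbigr => g; rewrite inE => -[/F0 gc gk].
  rewrite cycle_prod// gk; apply: eq_bigr => i _.
  by rewrite /w (negbTE (step_neq0 gc _))// gk.
rewrite -[X in q ^+ X](card_ord k).
apply: (@fsum_prod_le _ _ _ _ w q (fun i : 'I_k => step i)) => //.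
- by move=> x; rewrite /w; case: ifP => // _; exact: expR_ge0.
- by apply: finite_setIl.
- move=> g h [/F0 gc gk] [/F0 hc hk] e; apply: step_inj => //; first by rewrite gk.
  by move=> i; rewrite gk => ik; exact: (e (Ordinal ik)).
Qed.

End CycleSum.

(** * Comparison of the jump sum with the Gauss integral *)

Section Gauss.
Variable R : realType.
Variable a : R.
Hypothesis a0 : 0 < a.
(** The standard deviation for which the normal density is proportional to [exp(- a t^2)]; its peak
    is then [pk], so the integral of [gs] is [1 / pk = sqrt(pi / a)]. *)
Let sg := (Num.sqrt (2 * a))^-1.
Let sg0 : sg != 0.
Proof. by rewrite invr_eq0 sqrtr_eq0 -ltNge mulr_gt0. Qed.
Let sg2 : (sg ^+ 2) *+ 2 = a^-1.
Proof.
rewrite /sg exprVn sqr_sqrtr ?mulr_ge0 ?ltW// invfM -mulr_natl mulrA divff ?mul1r//.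
Qed.
Let pk := Num.sqrt (a / pi).
Let gs (t : R) := expR (- (a * t ^+ 2)).

Lemma pdf_gauss t : normal_pdf 0 sg t = pk * gs t.
Proof.
rewrite normal_pdfE// /normal_peak /normal_fun subr0 sg2 invrK mulNr [t ^+ 2 * a]mulrC.
by congr (_ * _); rewrite -mulrnAl sg2 -sqrtrV ?mulr_ge0 ?invr_ge0 ?pi_ge0 ?ltW// invfM invrK.
Qed.

Let mu := normal_prob (0 : R) sg.

Lemma gauss_itv (x y m : R) : x <= y -> (forall t, x <= t < y -> `|t| <= m) ->
  ((pk * gs m * (y - x))%:E <= mu `[x, y[%classic)%E.
Proof.
move=> xy tm; rewrite /mu /normal_prob.
have -> : (pk * gs m * (y - x))%:E = (\int[lebesgue_measure]_(t in `[x, y[) cst (pk * gs m)%:E t)%E.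
  have L : lebesgue_measure `[x, y[%classic = (y - x)%:E :> \bar R.
    rewrite lebesgue_measure_itv/= lte_fin; move: xy; rewrite le_eqVlt => /orP[/eqP ->|->].
      by rewrite ltxx subrr.
    by rewrite EFinB.
  rewrite integral_cst// EFinM; congr (_ * _)%E; exact: esym L.
apply: ge0_le_integral => //=.
- by move=> t _; rewrite lee_fin mulr_ge0 ?sqrtr_ge0 ?expR_ge0.
- by apply/measurable_EFinP; apply: measurable_funTS; exact: measurable_normal_pdf.
- move=> t; rewrite ?inE/= ?in_itv/= => /tm tle; rewrite lee_fin pdf_gauss ler_wpM2l ?sqrtr_ge0//.
  rewrite /gs ler_expR lerN2 ler_wpM2l ?(ltW a0)//.
  by rewrite -(real_normK (num_real t)) lerXn2r ?nnegrE// (le_trans _ tle).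
Qed.

Lemma itv_symS K :
  [/\ `[- K.+1%:R, K.+1%:R[%classic =
      (`[- K.+1%:R, - K%:R[ `|` `[- K%:R, K%:R[) `|` `[K%:R, K.+1%:R[ :> set R,
    (`[- K.+1%:R, - K%:R[ `|` `[- K%:R, K%:R[) `&` `[K%:R, K.+1%:R[ = set0 :> set R &
    `[- K.+1%:R, - K%:R[ `&` `[- K%:R, K%:R[ = set0 :> set R].
Proof.
have k1 : (K.+1%:R = K%:R + 1 :> R) by rewrite -natr1.
have k0 : (0 <= K%:R :> R) by [].
split.
- apply/seteqP; split=> t; rewrite /= !in_itv/= k1.
    move=> /andP[h1 h2]; have [h3|h3] := ltP t (- K%:R); first by left; left; rewrite h1.
    by have [h4|h4] := ltP t K%:R; [left; right|right; rewrite h2].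
  by move=> [[|]|] /andP[h1 h2]; apply/andP; split; lra.
- by apply/seteqP; split=> // t; rewrite /= !in_itv/= => -[[|]] /andP[h1 h2] /andP[h3 h4]; lra.
- by apply/seteqP; split=> // t; rewrite /= !in_itv/= => -[] /andP[h1 h2] /andP[h3 h4]; lra.
Qed.

(** Passing from [K] to [K + 1] adds two unit intervals, on each of which [|t| <= K + 1] and the
    density is at least [pk * gs (K + 1)]. *)
Lemma gauss_sum_pos K :
  ((pk * (2 * \sum_(1 <= k < K.+1) gs k%:R))%:E <= mu `[(- K%:R)%R, K%:R%R[%classic)%E.
Proof.
elim: K => [|K IH]; first by rewrite big_geq// mulr0 mulr0 measure_ge0.
have [e1 d1 d2] := itv_symS K.
rewrite e1 big_nat_recr//= !mulrDr EFinD.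
rewrite /mu measureU//; last exact: measurableU.
rewrite measureU//.
rewrite (_ : pk * (2 * gs K.+1%:R) = pk * gs K.+1%:R + pk * gs K.+1%:R); last by lra.
rewrite EFinD addeA [leLHS]addeAC [leLHS]addeC.
have m1 : (- K%:R) - (- K.+1%:R) = 1 :> R by rewrite opprK -[K.+1%:R]natr1 addrA addNr add0r.
have m2 : K.+1%:R - K%:R = 1 :> R by rewrite -[K.+1%:R]natr1 addrAC subrr add0r.
have kk : K%:R <= K.+1%:R :> R by rewrite ler_nat.
rewrite [leLHS]addeA; apply: leeD; last first; first last; first apply: leeD.
- have := @gauss_itv (- K.+1%:R) (- K%:R) K.+1%:R; rewrite m1 mulr1; apply; first by rewrite lerN2.
  move=> t /andP[h1 h2]; rewrite ler_norml h1 (le_trans (ltW h2))// (le_trans _ kk)//.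
  by rewrite (le_trans _ (ler0n _ K))// oppr_le0.
- exact: IH.
- have := @gauss_itv K%:R K.+1%:R K.+1%:R; rewrite m2 mulr1; apply => //.
  move=> t /andP[h1 h2]; rewrite ler_norml (ltW h2) andbT (le_trans _ h1)//.
  by rewrite (le_trans _ (ler0n _ K))// oppr_le0.
Qed.

Lemma gauss_sum (C : set int) : finite_set C ->
  \sum_(k \in C) gs k%:~R <= 1 + Num.sqrt (pi / a).
Proof.
move=> Cf; have [K HK] : exists K : nat, forall k, C k -> (`|k| < K)%N.
  apply: finite_fset_bound => // [k _|k n m nm kn]; first by exists `|k|.+1.
  exact: leq_trans kn nm.
pose S := \sum_(1 <= k < K.+1) gs k%:R.
have S1 : pk * (2 * S) <= 1.
  by rewrite -lee_fin; apply: le_trans (gauss_sum_pos K) _; exact: probability_le1.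
have pk0 : 0 < pk by rewrite sqrtr_gt0 divr_gt0 ?pi_gt0.
have S2 : 2 * S <= Num.sqrt (pi / a).
  by rewrite -[pi / a]invf_div sqrtrV ?divr_ge0 ?pi_ge0 ?(ltW a0)// -[leRHS]mulr1 ler_pdivlMl.
pose N := [set i | (0 < i < K.+1)%N].
have Nf : finite_set N by apply: sub_finite_set (finite_II K.+1) => i /andP[].
have SN : \sum_(i \in N) gs i%:R = S.
  rewrite fsbig_finite//=; apply: perm_big; apply: uniq_perm; rewrite ?fset_uniq ?iota_uniq//.
  by move=> i; rewrite mem_index_iota; apply/idP/idP; rewrite in_fset_set// inE.
pose pos (i : nat) : int := i; pose neg (i : nat) : int := - i%:Z.
have posf : finite_set (pos @` N) by exact: finite_image.
have negf : finite_set (neg @` N) by exact: finite_image.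
apply: (@le_trans _ _ (\sum_(k \in [set 0] `|` (pos @` N `|` neg @` N)) gs k%:~R)).
  apply: fsumr_subset; [|move=> k Ck|by move=> *; exact: expR_ge0].
    by rewrite !finite_setU; split; [exact: finite_set1|split].
  have kK := HK _ Ck; have [k0|k0|->] := ltgtP k 0; last by left.
    by right; right; exists `|k|%N; rewrite /N /neg /=; lia.
  by right; left; exists `|k|%N; rewrite /N /pos /=; lia.
rewrite fsbigU0//=; [|by rewrite finite_setU|]; last first.
  by move=> k [-> [|]] [i /andP[i0 _]]; rewrite /pos /neg; lia.
rewrite fsbigU0//=; last by move=> k [[i /andP[i0 _] <-] [j /andP[j0 _]]]; rewrite /pos /neg; lia.
rewrite fsbig_set1 !fsbig_image; [|by move=> i j _ _; rewrite /neg; lia|by move=> i j _ _; rewrite /pos; lia].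
under [X in _ + (_ + X)]eq_fsbigr do rewrite /gs /neg mulrNz sqrrN.
rewrite [X in _ + (X + _)]SN [X in _ + (_ + X)]SN {1}/gs expr0n mulr0 oppr0 expR0 lerD2l.
by rewrite -mulr2n -mulr_natl.
Qed.

End Gauss.

Section AlphaStar.
Variables (R : realType) (d : nat).
Local Notation Zd := (Zd d).
Local Notation V := (@sqnorm R d).

Lemma expR_sqnorm (a : R) (x : Zd) :
  expR (- (a * V x)) = \prod_(i < d) expR (- (a * ((x ord0 i)%:~R) ^+ 2)).
Proof. by rewrite /sqnorm mulr_sumr -sumrN expR_sum. Qed.

Lemma jump_sum (a : R) (C : set Zd) : 0 < a -> finite_set C ->
  \sum_(x \in C) (if x == 0 then 0 else expR (- (a * V x))) <= (1 + Num.sqrt (pi / a)) ^+ d - 1.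
Proof.
move=> a0 Cf; pose w (x : Zd) := if x == 0 then 0 else expR (- (a * V x)).
rewrite -[leLHS]/(\sum_(x \in C) w x).
(* The origin is added to [C] so that its term, equal to 1, is present in the product bound and can
   be subtracted. *)
have C0f : finite_set (0 |` C) by rewrite finite_setU; split; [exact: finite_set1|].
have C00 : (0 |` C) 0 by left.
have w0 x : 0 <= w x by rewrite /w; case: ifP => // _; exact: expR_ge0.
have S : \sum_(x \in 0 |` C) expR (- (a * V x)) <= (1 + Num.sqrt (pi / a)) ^+ d.
  under eq_fsbigr do rewrite expR_sqnorm.
  rewrite -[X in _ ^+ X](card_ord d).
  apply: (@fsum_prod_le _ _ _ _ (fun k : int => expR (- (a * k%:~R ^+ 2))) _
    (fun (i : 'I_d) (x : Zd) => x ord0 i)) => //.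
  - by move=> D; exact: gauss_sum.
  - by move=> x y _ _ e; apply/rowP.
apply: (@le_trans _ _ (\sum_(x \in 0 |` C) w x)).
  by apply: fsumr_subset => //; right.
move: S; rewrite (fsbigD1 (0 : Zd))//= [X in _ -> X <= _](fsbigD1 (0 : Zd))//=.
rewrite {1}/w eqxx add0r sqnorm0 mulr0 oppr0 expR0 lerBrDl.
have -> // : \sum_(x \in (0 |` C) `\ 0) w x = \sum_(x \in (0 |` C) `\ 0) expR (- (a * V x)).
by apply: eq_fsbigr => x; rewrite inE => -[_ /= /eqP x0]; rewrite /w (negbTE x0).
Qed.

(** With [(1 + c)^d = 1 + r], the hypothesis on [a] reads [sqrt(pi / a) < c], that is [q < r]; then
    [cubic q < cubic r = 0], which is the bound of [beta_le] being below 1. *)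
Lemma beta_lt1 (r a : R) : (0 < d)%N -> 0 < r -> r < 1 -> cubic r = 0 ->
  pi * ((1 + r) `^ (d%:R^-1) - 1) ^- 2 < a -> (beta V a < 1%:E)%E.
Proof.
move=> d0 r0 r1 cr; set c := _ - 1 => ha.
have c0 : 0 < c.
  have -> : c = (1 + r) `^ (d%:R^-1) - 1 `^ (d%:R^-1) by rewrite powR1.
  by rewrite subr_gt0 gt0_ltr_powR ?nnegrE ?invr_gt0 ?ltr0n//; lra.
have a0 : 0 < a by apply: le_lt_trans ha; rewrite mulr_ge0 ?pi_ge0// invr_ge0 exprn_ge0// ltW.
have cd : (1 + c) ^+ d = 1 + r.
  rewrite /c addrC subrK -powR_mulrn ?powR_ge0// -powRrM mulVf ?powRr1//; first lra.
  by rewrite pnatr_eq0 -lt0n.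
have sc : Num.sqrt (pi / a) < c.
  rewrite -[ltRHS]ger0_norm ?ltW// -sqrtr_sqr ltr_sqrt ?exprn_gt0//.
  by rewrite ltr_pdivrMr// mulrC -ltr_pdivrMr ?exprn_gt0.
set q := (1 + Num.sqrt (pi / a)) ^+ d - 1.
have q0 : 0 <= q by rewrite subr_ge0 exprn_ege1// lerDl sqrtr_ge0.
have qr : q < r.
  rewrite ltrBlDl -cd ltrXn2r ?ltrD2l// -?lt0n// addr_ge0 ?sqrtr_ge0.
have q1 : q < 1 by exact: lt_trans r1.
apply: le_lt_trans (@beta_le _ _ V a q q0 q1 _) _; first by move=> C Cf; exact: jump_sum.
rewrite lte_fin -subr_lt0 -(pmulr_llt0 _ (_ : 0 < (1 - q) ^+ 2)); last by rewrite exprn_gt0// subr_gt0.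
by rewrite cubic_eq// -cr; apply: cubic_lt; rewrite ?q0 ?(ltW q1) ?(ltW r0) ?(ltW r1).
Qed.

Lemma alpha_star_bound : (0 < d)%N ->
  exists r : R,
     [/\ 0 <= r <= 1, r / (1 - r) ^+ 2 - r = 1,
         (forall r' : R, 0 <= r' <= 1 -> r' / (1 - r') ^+ 2 - r' = 1 -> r' = r) &
         (alpha_star V <= (pi * ((1 + r) `^ (d%:R^-1) - 1) ^- 2)%:E)%E].
Proof.
move=> d0; have [r [r0 r1 cr]] := cubic_root R; exists r.
have sq (s : R) : s < 1 -> 0 < (1 - s) ^+ 2 by move=> s1; rewrite exprn_gt0// subr_gt0.
split.
- by rewrite !ltW.
- apply/eqP; rewrite -subr_eq0; move: (cubic_eq r1); rewrite cr => /eqP.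
  by rewrite mulf_eq0 (gt_eqF (sq _ r1)) orbF.
- move=> s /andP[s0 s1] e; have s1' : s < 1.
    rewrite lt_neqAle s1 andbT; apply/eqP => s1e; move: e.
    by rewrite s1e subrr expr0n invr0 mulr0; lra.
  have cs : cubic s = 0 by rewrite -cubic_eq// e subrr mul0r.
  have r01 : 0 <= r <= 1 by rewrite !ltW.
  have s01 : 0 <= s <= 1 by rewrite s0.
  have [sr|rs|//] := ltgtP s r.
  + by have := cubic_lt r01 s01 sr; rewrite cr cs ltxx.
  + by have := cubic_lt s01 r01 rs; rewrite cr cs ltxx.
- apply/lee_addgt0Pr => e e0; apply: ereal_inf_lbound.
  eexists; last by rewrite -EFinD.
  by apply: (beta_lt1 d0 r0 r1 cr); rewrite ltrDl.
Qed.

End AlphaStar.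

(** * Mean jump and conclusion *)

Section MeanJump.
Variables (R : realType) (d : nat) (a a' : R).
Local Notation Zd := (Zd d).
Local Notation Perm := (Perm d).
Implicit Types (s t : Perm) (L F D : set Zd) (A B C : set Perm) (f : Perm -> R) (xi : Perm).
Local Notation V := (@sqnorm R d).
Local Notation E L f := (Gexp V a L id f).

Lemma beta_mono : a' <= a -> (beta V a <= beta V a')%E.
Proof.
move=> aa; apply: le_esum => g _; rewrite lee_fin ler_wpM2l// /cyc_weight ler_expR lerN2.
by rewrite ler_wpM2r//; apply: fsumr_ge0 => x _; exact: sqnorm_ge0.
Qed.

Definition jump (x : Zd) (i : 'I_d) s : R := ((s x - x) ord0 i)%:~R.

Lemma int_norm_sqr (t : int) : `|t%:~R| <= (t%:~R : R) ^+ 2.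
Proof.
rewrite -intr_norm -rmorphXn /= ler_int.
have -> : (t ^+ 2 = `|t| * `|t|)%R by rewrite -normrM -expr2 ger0_norm// sqr_ge0.
have [->|t0] := eqVneq t 0; first by rewrite normr0 mulr0.
by rewrite ler_peMl// -gtz0_ge1 normr_gt0.
Qed.

Lemma jump_le_sqnorm x i s : `|jump x i s| <= V (s x - x).
Proof.
apply: (le_trans (int_norm_sqr _)); rewrite /sqnorm (bigD1 i)//= lerDl.
by apply: sumr_ge0 => j _; exact: sqr_ge0.
Qed.

(* [t <= exp (c * t) / c] with [c = a - a']: a slightly smaller temperature absorbs the jump. *)
Lemma jump_wt x i g : a' < a -> cyc x g ->
  cyc_weight V a g * `|jump x i g| <= cyc_weight V a' g / (a - a').
Proof.
move=> aa [[gb gf _ _] gx]; have c0 : 0 < a - a' by rewrite subr_gt0.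
set S := \sum_(y \in supp g) V (g y - y).
have jS : `|jump x i g| <= S.
  apply: (le_trans (jump_le_sqnorm _ _ _)); rewrite /S (fsbigD1 x)//= lerDl.
  by apply: fsumr_ge0 => y _; exact: sqnorm_ge0.
have S0 : 0 <= S by exact: le_trans jS.
have -> : cyc_weight V a g = cyc_weight V a' g * expR (- ((a - a') * S)).
  by rewrite /cyc_weight -/S -expRD; congr expR; lra.
rewrite -mulrA ler_wpM2l ?wt_ge0// expRN mulrC ler_pdivrMr ?expR_gt0//.
rewrite mulrC ler_pdivlMr//.
apply: (@le_trans _ _ ((a - a') * S)); first by rewrite mulrC ler_wpM2l// ltW.
by apply: le_trans (expR_ge1Dx _); rewrite lerDr.
Qed.

Lemma jump_local x i : local [set x] (fun s => `|jump x i s|).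
Proof. by move=> s t _ _ st; rewrite /jump st. Qed.

(** The identity contributes no jump, and each cycle is charged at the smaller parameter [a']. The
    bound does not depend on [L], as needed for Fatou's lemma in the limit. *)
Lemma jump_E x i L : a' < a -> (beta V a' < 1%:E)%E -> finite_set L -> L x ->
  E L (fun s => `|jump x i s|) <= b V a' / (a - a').
Proof.
move=> aa Hb Lf Lx; have V0 := sqnorm0 R d; have xL : [set x] `<=` L by move=> y ->.
have Cf := finite_cycin x Lf.
have -> : E L (fun s => `|jump x i s|) = E L (isin setT [set x] (fun s => `|jump x i s|)).
  by apply: eq_E => // s _; rewrite /isin in_setT.
rewrite (E_good _ V0 _ Lf xL (@jump_local x i)) setIT lcl_cycin// fsbigU0//=; last first.
  by move=> g [-> [[_]]]; rewrite /supp /=.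
rewrite fsbig_set1 /jump subrr mxE normr0 mulr0 mul0r add0r.
apply: (@le_trans _ _ (\sum_(g \in cycin x L) cyc_weight V a' g / (a - a'))).
  apply: ler_fsumr => // g [gx gL]; apply: le_trans (jump_wt i aa gx).
  by rewrite ler_piMr ?mulr_ge0 ?wt_ge0// rho_le1.
rewrite -mulr_fsuml ler_wpM2r ?invr_ge0 ?subr_ge0 ?(ltW aa)//.
apply: (@cyc_sum_wt _ _ _ _ Hb x) => //.
by move=> g [].
Qed.

Hypothesis d0 : (0 < d)%N.
Hypothesis aa : a' < a.
Hypothesis Hbeta' : (beta V a' < 1%:E)%E.
Let Hbeta : (beta V a < 1%:E)%E. Proof. exact: le_lt_trans (beta_mono (ltW aa)) Hbeta'. Qed.
Let V0 := sqnorm0 R d.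
Variables (dT : measure_display) (T : measurableType dT) (P : probability T R).
Variable zeta : set Zd -> T -> Perm.
Hypothesis Hrm : forall L, finite_set L \/ L = setT -> rand_map (zeta L).
Hypothesis HSL : forall L, finite_set L \/ L = setT -> forall w, SL L id (zeta L w).
Hypothesis Hlaw : forall L, finite_set L -> forall s,
  P (zeta L @^-1` [set s]) = (Gpt V a L id s)%:E.
Hypothesis Hcvg : forall L : nat -> set Zd, exhausting L -> forall w x,
  exists N, forall n, (N <= n)%N -> zeta (L n) w x = zeta setT w x.
Local Notation X := (zeta setT).

Lemma jump_event x i (U : set R) : cyl_sigma setT [set s | U (jump x i s)].
Proof.
have -> : [set s | U (jump x i s)] =
    \bigcup_(y : Zd) (if pselect (U ((y - x) ord0 i)%:~R) then [set s : Perm | s x = y] else set0).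
  apply/seteqP; split=> s /=.
    by move=> Us; exists (s x) => //; case: pselect.
  by move=> [y _]; case: pselect => //= Uy; rewrite /jump => ->.
rewrite bigcup_pickle; apply: cyl_bigcup => k.
case: (choice.unpickle k) => [y|]; last exact: cyl_set0.
by case: pselect => Uy /=; [exact: cylinder_in|exact: cyl_set0].
Qed.

Lemma measurable_jump x i : measurable_fun setT (fun w => jump x i (X w)).
Proof.
move=> _ U mU; rewrite setTI.
exact: (rand_map_pre (rmX Hrm) (jump_event x i U)).
Qed.

Lemma jump_integrable x i : P.-integrable setT (fun w => (jump x i (X w))%:E).
Proof.
apply/integrableP; split; first exact/measurable_EFinP/measurable_jump.
(* The radii are shifted so that every ball contains [x], as [jump_E] requires. *)
pose Ls n := nball (0 : Zd) (n + nrm x).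
have Lf n : finite_set (Ls n) by exact: finite_nball.
have Lx n : Ls n x by rewrite /Ls /nball /= subr0 leq_addl.
have Lex : exhausting Ls.
  split=> // [n|]; first by apply: nball_mono; rewrite leq_add2r.
  apply/seteqP; split=> // y _; exists (nrm y) => //.
  by rewrite /Ls /nball /= subr0 leq_addr.
pose Y n w := (`|jump x i (zeta (Ls n) w)|)%:E.
have Yc w : Y n w @[n --> \oo] --> (`|jump x i (X w)|)%:E.
  have [N HN] := Hcvg Lex w x; apply: cvg_near_cst.
  by exists N => // n /= Nn; rewrite /Y /jump HN.
have h := @fatou _ T R P setT measurableT Y.
have /h{h} : forall n, measurable_fun setT (Y n).
  move=> n; apply/measurable_EFinP.
  exact: (measurable_fun_zetaF Hrm HSL (fun s => `|jump x i s|) (Lf n)).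
have Y0 n w : setT w -> (0 <= Y n w)%E by rewrite lee_fin.
move=> /(_ Y0); rewrite (eq_integral (fun w => `|(jump x i (X w))%:E|%E)); last first.
  by move=> w _; rewrite is_cvg_limn_einfE; [exact/cvg_lim/Yc|apply/cvg_ex; eexists; exact: Yc].
move=> /le_lt_trans; apply; apply: (@le_lt_trans _ _ (b V a' / (a - a'))%:E); last exact: ltry.
rewrite limn_einf_lim; apply: lime_le; first exact: is_cvg_einfs.
apply: nearW => n; apply: (@le_trans _ _ (\int[P]_w Y n w)%E).
  by apply: ereal_inf_lbound; exists n => /=.
rewrite /Y (integral_zetaF Hrm HSL Hlaw (fun s => `|jump x i s|) (Lf n)) lee_fin.
exact: jump_E.
Qed.

Lemma jump_mean x i : (\int[P]_w (jump x i (X w))%:E = 0)%E.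
Proof.
pose h (y : Zd) : Zd := (x + x) - y.
have k : cancel h h by move=> y; rewrite /h opprB addrC subrK.
have Vh y z : V (h y - h z) = V (y - z).
  by rewrite -[RHS]sqnormN /h; congr (V _); rewrite opprB opprB addrC addrA subrK.
have jc s : jump x i (conjp h h s) = - jump x i s.
  rewrite /jump /conjp /h /= addrK -intrN; congr (_%:~R).
  by rewrite (_ : x + x - s x - x = - (s x - x)) ?[LHS]mxE// addrAC addrK opprB.
have rX := rmX Hrm.
have mj := measurable_jump x i.
have mjN : measurable_fun setT (fun w => - jump x i (X w)) by exact: measurable_funN.
have ij := jump_integrable x i.
have ijN : P.-integrable setT (fun w => (- jump x i (X w))%:E).
  exact: (integrableN ij).
pose Y1 : {mfun T >-> R} := HB.pack (fun w => jump x i (X w)) (isMeasurableFun.Build _ _ _ _ _ mj).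
pose Y2 : {mfun T >-> R} := HB.pack (fun w => - jump x i (X w)) (isMeasurableFun.Build _ _ _ _ _ mjN).
have id_m : measurable_fun setT (EFin : R -> \bar R) by apply/measurable_EFinP; exact: measurable_id.
have e1 := integral_distribution (X := Y1) id_m ij.
have e2 := integral_distribution (X := Y2) id_m ijN.
have e3 : (\int[P]_w (jump x i (X w))%:E = \int[P]_w (- jump x i (X w))%:E)%E.
  apply: etrans (esym e1) (etrans _ e2); apply: eq_measure_integral => U mU _.
  rewrite -[LHS]/(P (X @^-1` [set s | U (jump x i s)])) -[RHS]/(P (X @^-1` [set s | U (- jump x i s)])).
  have -> : [set s | U (- jump x i s)] = conjp h h @^-1` [set s | U (jump x i s)].
    by apply/seteqP; split=> s /=; rewrite jc.
  have sU := jump_event x i U.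
  rewrite (prE _ rX)// (prE _ rX); last exact: cyl_conjp.
  by rewrite (law_conjp Hrm HSL Hlaw Hcvg k k Vh).
have e4 : (\int[P]_w (- jump x i (X w))%:E = - \int[P]_w (jump x i (X w))%:E)%E.
  under eq_integral do rewrite EFinN.
  by rewrite integralN//; exact: integrable_add_def.
(* Integrability is essential here: a mean equal to its opposite is 0 only when it is finite. *)
move: e3; rewrite e4; have := integrable_fin_num measurableT ij.
case: (\int[P]_w _)%E => // r _ /= [e]; congr (_%:E); lra.
Qed.

Lemma jump_tau x i v s : jump x i (tau v \o s) = jump x i s + (v ord0 i)%:~R.
Proof. by rewrite /jump /= /tau addrAC [in LHS]mxE intrD. Qed.

Lemma mean_jump_tau v : mean_jump P (fun w => tau v \o X w) v.
Proof.
move=> x i; have e w : ((((tau v \o X w) x - x) ord0 i)%:~R)%:E =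
    ((jump x i (X w))%:E + (cst ((v ord0 i)%:~R : R)%:E w))%E :> \bar R.
  by rewrite -EFinD -jump_tau.
have ij := jump_integrable x i.
have iv : P.-integrable setT (cst ((v ord0 i)%:~R : R)%:E) by exact: finite_measure_integrable_cst.
split.
  apply: (eq_integrable _ (fun w => ((jump x i (X w))%:E + (cst ((v ord0 i)%:~R : R)%:E w))%E)) => //; exact: integrableD.
rewrite (eq_integral _ _ (fun w _ => e w)) integralD//= jump_mean add0e.
by rewrite -[RHS]mule1 -(probability_setT P) -integral_cst.
Qed.

(** The kernel with boundary condition [tau v \o xi] is the image under [tau v] of the kernel with
    boundary condition [xi], so the DLR equations are those of the untilted law for the preimage
    events. *)
Lemma gibbs_tau v : is_gibbs P V a (fun w => tau v \o X w).
Proof.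
have [Xb G] := gibbs_law Hrm HSL Hlaw Hcvg.
split; first by apply: aeW => w; apply: bij_comp (tau_bij v) _; exact: zeta_bij HSL w.
move=> D Df A B sA sB.
have -> : (fun w => tau v \o X w) @^-1` (A `&` B) =
   X @^-1` (((fun s : Perm => tau v \o s) @^-1` A) `&` ((fun s : Perm => tau v \o s) @^-1` B)) by [].
rewrite (G D Df); [|exact: cyl_tau|exact: cyl_tau].
apply: eq_integral => w _; congr (_ * _)%:E.
by rewrite /Gprob Gexp_tau//; exact: zeta_bij HSL w.
Qed.

(** Composition with [tau v] commutes with every [shift u], so the preimages of invariant events are
    invariant. *)
Lemma ergodic_tau v : ergodic P (fun w => tau v \o X w).
Proof.
have [inv erg] := ergodic_law d0 V0 Hbeta Hrm HSL Hlaw Hcvg.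
have sh u s : Defs.shift u (tau v \o s) = tau v \o Defs.shift u s.
  by apply/funext => x; rewrite /Defs.shift /= /tau addrAC.
split=> [u A sA|A sA iA].
  have := inv u _ (cyl_tau v sA).
  rewrite /preimage /=; under eq_fun do rewrite -sh; exact.
apply: (erg _ (cyl_tau v sA)) => u; apply/seteqP; split=> s /=.
  by rewrite -sh; have -> // : A (Defs.shift u (tau v \o s)) = (Defs.shift u @^-1` A) (tau v \o s) by []; rewrite iA.
by rewrite -sh -{1}(iA u).
Qed.

End MeanJump.

Theorem theorem2p4 (R : realType) (d : nat) : (0 < d)%N ->
  (exists r : R,
     [/\ 0 <= r <= 1, r / (1 - r) ^+ 2 - r = 1,
         (forall r' : R, 0 <= r' <= 1 -> r' / (1 - r') ^+ 2 - r' = 1 -> r' = r) &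
         (alpha_star (@sqnorm R d) <= (pi * ((1 + r) `^ (d%:R^-1) - 1) ^- 2)%:E)%E])
  /\
  forall a : R, (alpha_star (@sqnorm R d) < a%:E)%E ->
  exists (dT : measure_display) (T : measurableType dT) (P : probability T R)
         (zeta : set (Zd d) -> T -> Perm d),
  [/\ forall L : set (Zd d), finite_set L \/ L = setT ->
        rand_map (zeta L) /\ forall w, SL L id (zeta L w),
      forall L : set (Zd d), finite_set L -> forall s : Perm d,
        P (zeta L @^-1` [set s]) = (Gpt (@sqnorm R d) a L id s)%:E,
      as_conv P zeta,
      is_gibbs P (@sqnorm R d) a (zeta setT) /\ ergodic P (zeta setT) &
      forall v : Zd d,
      [/\ (* (i) *)
          (forall L : set (Zd d), finite_set L ->
             (forall s : Perm d,
                Gpt (@sqnorm R d) a L (tau v) s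
                = Gpt (@sqnorm R d) a L id (tau (- v) \o s)) /\
             (forall s : Perm d,
                P ((fun w => tau v \o zeta L w) @^-1` [set s])
                = (Gpt (@sqnorm R d) a L (tau v) s)%:E)),
          (* (ii) *)
          as_conv P (fun L w => tau v \o zeta L w) /\
          (forall Ls, exhausting Ls ->
           forall f : Perm d -> R, (exists M : R, forall s, bijective s -> `|f s| <= M) ->
             cont_on_S f ->
             (fun n => (Gexp (@sqnorm R d) a (Ls n) (tau v) f)%:E) @ \oo -->
               (\int[P]_w (f (tau v \o zeta setT w))%:E)%E) &
          (* (iii) *)
          [/\ is_gibbs P (@sqnorm R d) a (fun w => tau v \o zeta setT w),
              ergodic P (fun w => tau v \o zeta setT w) &
              mean_jump P (fun w => tau v \o zeta setT w) v]]].
Proof.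
move=> d0; split; first exact: alpha_star_bound.
(* The infimum gives an [a'] strictly below [a] with [beta < 1]; monotonicity yields the contraction
   at [a], and the gap [a - a'] is spent on the jumps. *)
move=> a /ereal_inf_lt[_ [a' /= Hb' <-]]; rewrite lte_fin => aa.
have Hb : (beta (@sqnorm R d) a < 1%:E)%E.
  exact: le_lt_trans (beta_mono d (ltW aa)) Hb'.
have V0 := sqnorm0 R d.
pose zeta := zeta (@sqnorm R d) a.
have Hrm L (hL : finite_set L \/ L = setT) := zeta_rand_map d0 V0 Hb hL.
have HSL L (hL : finite_set L \/ L = setT) w := zeta_SL d0 V0 Hb w hL.
have Hlaw L (Lf : finite_set L) s := zeta_law d0 V0 Hb s Lf.
have Hcvg L (hL : exhausting L) w x := zeta_cvg d0 V0 Hb w x hL.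
exists _, (measurableTypeR R), (U01 R), zeta; split.
- by move=> L hL; split=> [|w]; [exact: Hrm|exact: HSL].
- exact: Hlaw.
- by move=> L hL; apply: aeW => w x; exact: Hcvg.
- split; first exact: gibbs_law Hrm HSL Hlaw Hcvg.
  exact: (@ergodic_law _ _ _ _ d0 V0 Hb _ _ (U01 R) zeta Hrm HSL Hlaw Hcvg).
move=> v; split.
- move=> L Lf; split=> s; first exact: Gpt_tau.
  rewrite Gpt_tau// -Hlaw//; congr (U01 R _); apply/seteqP; split=> w /=.
    by move=> <-; apply/funext => x; rewrite /= /tau addrK.
  by rewrite /zeta => ->; apply/funext => x; rewrite /= /tau subrK.
- split.
    move=> L hL; apply: aeW => w x; have [N HN] := Hcvg L hL w x.
    by exists N => n /HN; rewrite /zeta /= => ->.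
  move=> Ls hL f [M fM] fc; have Lf n : finite_set (Ls n) by case: hL.
  have -> : (fun n => (Gexp (@sqnorm R d) a (Ls n) (tau v) f)%:E) =
      (fun n => (Gexp (@sqnorm R d) a (Ls n) id (fun s => f (tau v \o s)))%:E).
    by apply/funext => n; rewrite Gexp_tau_id.
  have fb : exists M, forall s : Perm d, bijective s -> `|f (tau v \o s)| <= M.
    by exists M => s sb; apply: fM; exact: bij_comp (tau_bij v) sb.
  have ftc : cont_on_S (fun s => f (tau v \o s)).
    move=> s sb e e0; have [F [Ff HF]] := fc _ (bij_comp (tau_bij v) sb) e e0.
    exists F; split=> // t tb st; apply: HF; first exact: bij_comp (tau_bij v) tb.
    by move=> x Fx /=; rewrite st.
  exact: (@exp_cvg _ _ _ _ _ _ (U01 R) zeta Hrm HSL Hlaw Hcvg _ fb ftc).2 _ hL.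
- split.
  + exact: (@gibbs_tau _ _ _ _ _ (U01 R) zeta Hrm HSL Hlaw Hcvg v).
  + exact: (@ergodic_tau _ _ _ _ d0 aa Hb' _ _ (U01 R) zeta Hrm HSL Hlaw Hcvg v).
  + exact: (@mean_jump_tau _ _ _ _ aa Hb' _ _ (U01 R) zeta Hrm HSL Hlaw Hcvg v).
Qed.
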